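(* Let $\Sigma=\mathbb{D}/\Gamma$ be a compact smooth Riemann surface of genus $g\ge 2$, let $\mathcal{G}$ be a finite symmetric set of generators of $\Gamma=\pi_1(\Sigma)$ with $\mathrm{id}\notin\mathcal{G}$, and let $\omega(\alpha)=d_P(0,\alpha(0))$ for $\alpha\in\mathcal{G}$. There exists a constant $K=K(\Gamma)>1$ (not depending on $T$ or on $\rho$ below) such that for every compact metric space $(T,d_T)$ and every representation $\rho\colon\Gamma\to\mathrm{Homeo}(T)$, the suspension $\mathscr{F}$ of $\rho$ satisfies \[2+h(\rho,\mathcal{G},\omega)\le h(\mathscr{F})\le 2+K\,h(\rho,\mathcal{G},\omega).\]
   Context: Notation: $\mathbb{D}$ is the unit disk, $d_P$ its Poincaré distance, normalized by $d_P(0,\xi)=\log\frac{1+|\xi|}{1-|\xi|}$; $\mathbb{D}_R=\{\xi\in\mathbb{D}: d_P(0,\xi)<R\}$ and $\overline{\mathbb{D}}_R$ is its closure. Suspensions: $\Gamma\subset\mathrm{Aut}(\mathbb{D})$ is a Fuchsian group acting freely on $\mathbb{D}$ by deck transformations, with $\Sigma=\mathbb{D}/\Gamma$. Given a compact metric space $(T,d_T)$ and a homomorphism $\rho\colon\Gamma\to\mathrm{Homeo}(T)$, $\Gamma$ acts on $\mathbb{D}\times T$ by $\gamma\cdot(z,t)=(\gamma\cdot z,\rho(\gamma)(t))$. Put $X=(\mathbb{D}\times T)/\Gamma$ (compact) and write $[\cdot]$ for images in $X$. The suspension of $\rho$ is the lamination $\mathscr{F}$ of $X$ by the hyperbolic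 Riemann surfaces (leaves) $[\mathbb{D}\times\{t\}]$, $t\in T$. Standing assumption: $X$ is embedded in a real manifold $M$ carrying a smooth Riemannian metric $g_M$ which restricts to a Hermitian metric on the leaves, and $d$ is the distance on $X$ induced by $g_M$. Hyperbolic entropy: for $x\in X$, let $L_x$ be the leaf through $x$ and $\phi_x\colon\mathbb{D}\to L_x$ a holomorphic universal covering with $\phi_x(0)=x$ (unique up to a rotation). For $R>0$ let $d_R(x,y)=\inf_{\theta\in\mathbb{R}}\sup_{\xi\in\overline{\mathbb{D}}_R}d(\phi_x(\xi),\phi_y(e^{i\theta}\xi))$ and $B_R(x,\varepsilon)=\{y: d_R(x,y)<\varepsilon\}$. For $Y\subset X$, $N(Y,R,\varepsilon)$ is the minimal number of balls $B_R(x_i,\varepsilon)$, $x_i\in X$, covering $Y$; $h(Y)=\sup_{\varepsilon>0}\limsup_{R\to+\infty}\frac1R\log N(Y,R,\varepsilon)$ and $h(\mathscr{F})=h(X)$. Weighted entropy of $\rho$: $\mathcal{G}$ symmetric means $\mathcal{G}=\mathcal{G}^{-1}$. For $R>0$, $t,s\in T$, let $d_R^{\rho,\mathcal{G},\omega}(t,s)=\sup d_T(\rho(g_1\cdots g_k)(t),\rho(g_1\cdots g_k)(s))$, the sup being over all $k\ge 0$ and $g_1,\dots,g_k\in\mathcal{G}$ with $\sum_{i=1}^k\omega(g_i)\le R$. Let $N(T,R,\varepsilon,\rho,\mathcal{G},\omega)$ be the minimal number of $d_R^{\rho,\mathcal{G},\omega}$-balls of radius $\varepsilon$ covering $T$,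 and $h(\rho,\mathcal{G},\omega)=\sup_{\varepsilon>0}\limsup_{R\to+\infty}\frac1R\log N(T,R,\varepsilon,\rho,\mathcal{G},\omega)$. *)

(* Defs.v *)
From HB Require Import structures.
From mathcomp Require Import all_boot all_order all_algebra.
From mathcomp Require Import complex.
From mathcomp Require Import all_classical all_reals all_analysis.

Set Implicit Arguments.
Unset Strict Implicit.
Unset Printing Implicit Defensive.

Import Order.TTheory GRing.Theory Num.Theory.
Import numFieldTopology.Exports numFieldNormedType.Exports.

Local Open Scope classical_set_scope.
Local Open Scope ring_scope.
Local Open Scope complex_scope.
Local Open Scope quotient_scope.

(* [R[i]^o] is the field C seen as a normed space over itself, so that
   [derivable F z 1] below is complex differentiability.  Used as a type,
   [unit_disk R] is the subtype of C with the induced topology. *)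
Definition unit_disk (R : realType) : set R[i]^o := [set z | `|z| < 1].
Arguments unit_disk : clear implicits.

(* [`|z|] lives in R[i]; [cmod z] is the same modulus as an element of R. *)
Definition cmod (R : realType) (z : R[i]) : R := complex.Re `|z|.

Definition poincare_dist (R : realType) (z w : unit_disk R) : R :=
  let u : R[i] := \val z in let v : R[i] := \val w in
  let delta := cmod ((u - v) / (1 - v^* * u)) in
  ln ((1 + delta) / (1 - delta)).

Lemma disk0_subproof (R : realType) : (0 : R[i]^o) \in unit_disk R.
Proof. by rewrite inE /unit_disk /= normr0 ltr01. Qed.

Definition disk0 (R : realType) : unit_disk R :=
  exist (fun z => z \in unit_disk R) 0 (disk0_subproof R).

Lemma rotation_subproof (R : realType) (theta : R) (z : unit_disk R) :
  ((cos theta +i* sin theta : R[i]) * (\val z : R[i])) \in unit_disk R.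
Proof.
have := set_valP z; rewrite inE /unit_disk /= normrM => zlt1.
by rewrite normc_def /= cos2Dsin2 sqrtr1 mul1r.
Qed.

Lemma poincare_dist0 (R : realType) (xi : unit_disk R) :
  poincare_dist (disk0 R) xi =
  ln ((1 + cmod (\val xi)) / (1 - cmod (\val xi))).
Proof. by rewrite /poincare_dist /= mulr0 subr0 divr1 sub0r /cmod normrN. Qed.

Definition rotation (R : realType) (theta : R) (z : unit_disk R) :
    unit_disk R :=
  exist (fun w => w \in unit_disk R) _ (rotation_subproof theta z).

(* Meant for open [U]. *)
Definition holomorphic_on (R : realType) (U : set (unit_disk R))
    (f : unit_disk R -> unit_disk R) : Prop :=
  exists F : R[i]^o -> R[i]^o,
    forall z, U z -> \val (f z) = F (\val z) /\ derivable F (\val z) 1.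

Definition mutual_inverse (A B : Type) (f : A -> B) (g : B -> A) : Prop :=
  cancel f g /\ cancel g f.

Definition aut_disk (R : realType) : set (unit_disk R -> unit_disk R) :=
  [set f | holomorphic_on setT f /\
     exists2 g, holomorphic_on setT g & mutual_inverse f g].

Record aut_subgroup (R : realType) := AutSubgroup {
  aut_set :> (unit_disk R -> unit_disk R) -> Prop;
  aut_set_sub : forall a, aut_set a -> aut_disk a;
  aut_set1 : aut_set idfun;
  aut_setM : forall a b, aut_set a -> aut_set b -> aut_set (a \o b);
  aut_setV : forall a, aut_set a -> exists2 b, aut_set b & mutual_inverse a b
}.

(* Discreteness, in the compact-open topology of Aut(D). *)
Definition fuchsian (R : realType) (Gam : aut_subgroup R) : Prop :=
  exists2 U : set {compact-open, unit_disk R -> unit_disk R},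
    nbhs (idfun : {compact-open, unit_disk R -> unit_disk R}) U &
    aut_set Gam `&` U = [set idfun].

Definition acts_freely (R : realType) (Gam : aut_subgroup R) : Prop :=
  forall a z, Gam a -> a z = z -> a = idfun.

Definition acts_by_deck_transformations (R : realType)
    (Gam : aut_subgroup R) : Prop :=
  forall z : unit_disk R, exists2 V, nbhs z V &
    forall a, Gam a -> a <> idfun -> (a @` V) `&` V = set0.

Record action (R : realType) (Gam : aut_subgroup R) (Y : Type) := Action {
  act :> (unit_disk R -> unit_disk R) -> Y -> Y;
  act1 : forall y, act idfun y = y;
  actM : forall a b y, Gam a -> Gam b -> act (a \o b) y = act a (act b y)
}.

Definition orbit_rel (R : realType) (Gam : aut_subgroup R) (Y : Type)
    (phi : action Gam Y) : rel Y :=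
  fun x y => `[< exists2 a, Gam a & phi a x = y >].

Lemma orbit_rel_refl (R : realType) (Gam : aut_subgroup R) (Y : Type)
  (phi : action Gam Y) : reflexive (orbit_rel phi).
Proof.
by move=> x; apply/asboolP; exists idfun; [exact: aut_set1 | exact: act1].
Qed.

Lemma orbit_rel_sym (R : realType) (Gam : aut_subgroup R) (Y : Type)
  (phi : action Gam Y) : symmetric (orbit_rel phi).
Proof.
suff H x y : orbit_rel phi x y -> orbit_rel phi y x.
  by move=> x y; apply/idP/idP; exact: H.
move=> /asboolP[a Ga <-]; have [b Gb [ab _]] := aut_setV Ga.
apply/asboolP; exists b => //; rewrite -actM// (_ : b \o a = idfun) ?act1//.
by apply/funext => z; exact: ab.
Qed.

Lemma orbit_rel_trans (R : realType) (Gam : aut_subgroup R) (Y : Type)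
  (phi : action Gam Y) : transitive (orbit_rel phi).
Proof.
move=> y x z /asboolP[a Ga <-] /asboolP[b Gb <-].
by apply/asboolP; exists (b \o a); [exact: aut_setM | rewrite actM].
Qed.

Definition orbit_equiv (R : realType) (Gam : aut_subgroup R)
    (Y : choiceType) (phi : action Gam Y) : equiv_rel Y :=
  EquivRel (orbit_rel phi) (orbit_rel_refl phi) (orbit_rel_sym phi)
    (@orbit_rel_trans _ _ _ phi).

Definition orbit_space (R : realType) (Gam : aut_subgroup R)
    (Y : topologicalType) (phi : action Gam Y) : topologicalType :=
  quotient_topology {eq_quot orbit_equiv phi}.

Definition orbit_pi (R : realType) (Gam : aut_subgroup R)
    (Y : topologicalType) (phi : action Gam Y) (y : Y) : orbit_space phi :=
  \pi_{eq_quot orbit_equiv phi} y.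

Definition disk_action (R : realType) (Gam : aut_subgroup R) :
    action Gam (unit_disk R) :=
  @Action R Gam (unit_disk R) (fun a z => a z)
    (fun=> erefl) (fun _ _ _ _ _ => erefl).

Definition surface (R : realType) (Gam : aut_subgroup R) : topologicalType :=
  orbit_space (disk_action Gam).

(* The commutator subgroup [Gamma, Gamma]; [a'] and [b'] are the inverses of
   [a] and [b]. *)
Inductive derived_subgroup (R : realType) (Gam : aut_subgroup R) :
    (unit_disk R -> unit_disk R) -> Prop :=
| Derived1 : derived_subgroup Gam idfun
| DerivedM a a' b b' c : Gam a -> Gam b ->
    mutual_inverse a a' -> mutual_inverse b b' ->
    derived_subgroup Gam c ->
    derived_subgroup Gam (a \o b \o a' \o b' \o c).

(* As Gamma = pi_1(Sigma), the genus of the closed surface Sigma is the g such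
   that H_1(Sigma, Z) = Gamma / [Gamma, Gamma] is isomorphic to Z^(2g). *)
Definition has_genus (R : realType) (Gam : aut_subgroup R) (g : nat) : Prop :=
  exists h : (unit_disk R -> unit_disk R) -> 'rV[int]_(g.*2),
  [/\ forall a b, Gam a -> Gam b -> h (a \o b) = h a + h b,
      forall v, exists2 a, Gam a & h a = v &
      forall a, Gam a -> (h a = 0 <-> derived_subgroup Gam a)].

(* [word [:: a_1; ...; a_k]] is a_1 ... a_k. *)
Definition word (A : Type) (s : seq (A -> A)) : A -> A :=
  foldr (fun a b => a \o b) idfun s.

Definition symmetric_generators (R : realType) (Gam : aut_subgroup R)
    (G : set (unit_disk R -> unit_disk R)) : Prop :=
  [/\ finite_set G,
      G `<=` aut_set Gam,
      forall a b, G a -> mutual_inverse a b -> G b,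
      forall a, Gam a -> exists2 s, {in s, forall b, G b} & a = word s &
      ~ G idfun].

Definition homeomorphism (Y Z : topologicalType) (f : Y -> Z) : Prop :=
  continuous f /\ exists2 g : Z -> Y, continuous g & mutual_inverse f g.

(* A homomorphism Gamma -> Homeo(T); the values of [rho] outside of Gamma are
   irrelevant. *)
Record representation (R : realType) (Gam : aut_subgroup R)
    (T : topologicalType) := Representation {
  rho :> (unit_disk R -> unit_disk R) -> T -> T;
  rho_homeo : forall a, Gam a -> homeomorphism (rho a);
  rhoM : forall a b, Gam a -> Gam b -> rho (a \o b) = rho a \o rho b
}.

Lemma rho1 (R : realType) (Gam : aut_subgroup R) (T : topologicalType)
  (r : representation Gam T) (t : T) : r idfun t = t.
Proof.
have G1 := aut_set1 Gam; have [_ [g _ [rK _]]] := rho_homeo r G1.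
apply: (can_inj rK); have := rhoM r G1 G1.
by move=> /(congr1 (fun f => f t)) /= <-.
Qed.

Lemma diag_act1 (R : realType) (Gam : aut_subgroup R) (T : topologicalType)
  (r : representation Gam T) (p : unit_disk R * T) :
  (idfun p.1, r idfun p.2) = p.
Proof. by case: p => z t; rewrite rho1. Qed.

Lemma diag_actM (R : realType) (Gam : aut_subgroup R) (T : topologicalType)
  (r : representation Gam T) a b (p : unit_disk R * T) : Gam a -> Gam b ->
  ((a \o b) p.1, r (a \o b) p.2) = (a (b p.1), r a (r b p.2)).
Proof. by move=> Ga Gb; rewrite rhoM. Qed.

Definition diag_action (R : realType) (Gam : aut_subgroup R)
    (T : topologicalType) (r : representation Gam T) :
    action Gam (unit_disk R * T)%type :=
  @Action R Gam _ (fun a p => (a p.1, r a p.2))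
    (diag_act1 r) (@diag_actM _ _ _ r).

Definition suspension (R : realType) (Gam : aut_subgroup R)
    (T : topologicalType) (r : representation Gam T) : topologicalType :=
  orbit_space (diag_action r).

Definition susp_pi (R : realType) (Gam : aut_subgroup R)
    (T : topologicalType) (r : representation Gam T)
    (z : unit_disk R) (t : T) : suspension r :=
  orbit_pi (diag_action r) (z, t).

Definition leaf (R : realType) (Gam : aut_subgroup R)
    (T : topologicalType) (r : representation Gam T) (t : T) :
    set (suspension r) := [set susp_pi r z t | z in setT].
Arguments leaf {R Gam T} r t.

(* The topology of the leaf as a Riemann surface (in general finer than the
   one induced by X): the quotient topology for z |-> [z, t]. *)
Definition leaf_open (R : realType) (Gam : aut_subgroup R)
    (T : topologicalType) (r : representation Gam T) (t : T)
    (U : set (suspension r)) : Prop :=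
  U `<=` leaf r t /\ open [set z | U (susp_pi r z t)].

(* The complex structure of the leaf is the one for which z |-> [z, t] is
   a local biholomorphism. *)
Definition leaf_holomorphic (R : realType) (Gam : aut_subgroup R)
    (T : topologicalType) (r : representation Gam T) (t : T)
    (phi : unit_disk R -> suspension r) : Prop :=
  forall z0, exists V f,
    [/\ open V, V z0, holomorphic_on V f &
        forall z, V z -> phi z = susp_pi r (f z) t].

(* Each point of the leaf has an open neighbourhood [U] whose preimage is
   a disjoint union of open sets [V i] mapped homeomorphically onto [U]. *)
Definition leaf_covering (R : realType) (Gam : aut_subgroup R)
    (T : topologicalType) (r : representation Gam T) (t : T)
    (phi : unit_disk R -> suspension r) : Prop :=
  forall x, leaf r t x -> exists2 U, leaf_open t U /\ U x &
    exists (I : Type) (V : I -> set (unit_disk R)),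
  [/\ phi @^-1` U = \bigcup_i V i,
      trivIset setT V &
      forall i, [/\ open (V i),
        set_bij (V i) U phi,
        forall W, leaf_open t W -> open (V i `&` phi @^-1` W) &
        forall W, open W -> leaf_open t (phi @` (V i `&` W))]].

(* [phi] is a holomorphic universal covering of the leaf through [x] mapping 0
   to [x]; universality is automatic as D is simply connected. *)
Definition leaf_uniformization (R : realType) (Gam : aut_subgroup R)
    (T : topologicalType) (r : representation Gam T) (x : suspension r)
    (phi : unit_disk R -> suspension r) : Prop :=
  phi (disk0 R) = x /\
  exists t, [/\ range phi = leaf r t, leaf_holomorphic t phi &
                leaf_covering t phi].

Local Open Scope ereal_scope.

(* Extended-valued: +oo when no finite cover exists, and 0 for empty [Y], for
   which [lne] gives entropy -oo. *)
Definition covering_number (R : realType) (X : Type)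
    (delta : X -> X -> \bar R) (Y : set X) (eps : R) : \bar R :=
  ereal_inf [set n%:R%:E | n in [set n : nat | exists c : 'I_n -> X,
    Y `<=` \bigcup_i [set y | delta (c i) y < eps%:E]]].

(* [delta r] is the pseudo-distance at scale [r]. *)
Definition entropy (R : realType) (X : Type)
    (delta : R -> X -> X -> \bar R) (Y : set X) : \bar R :=
  ereal_sup [set limf_esup
      (fun r : R => (r^-1)%:E * lne (covering_number (delta r) Y eps))
      (pinfty_nbhs R) | eps in [set eps : R | (0 < eps)%R]].

Definition topological_embedding (X M : topologicalType) (f : X -> M) : Prop :=
  injective f /\ forall U : set X,
    open U <-> exists2 V : set M, open V & f @^-1` V = U.

Definition closed_disk (R : realType) (r : R) : set (unit_disk R) :=
  closure [set xi | (poincare_dist (disk0 R) xi < r)%R].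
Arguments closed_disk {R} r.

(* [phi] is the choice of the universal coverings phi_x, and the distance on
   [X] is the one induced by [iota : X -> M].  The ambient [M] is an arbitrary
   metric space; the main instance is a connected Riemannian manifold with its
   Riemannian distance, which induces the manifold topology. *)
Definition leafwise_dist (R : realType) (X : Type) (M : metricType R)
    (iota : X -> M) (phi : X -> unit_disk R -> X) (r : R) (x y : X) : \bar R :=
  ereal_inf [set ereal_sup
      [set (mdist (iota (phi x xi)) (iota (phi y (rotation theta xi))))%:E
         | xi in closed_disk r] | theta in [set: R]].

Definition hyperbolic_entropy (R : realType) (X : Type) (M : metricType R)
    (iota : X -> M) (phi : X -> unit_disk R -> X) : \bar R :=
  entropy (leafwise_dist iota phi) setT.

Definition poincare_weight (R : realType) (a : unit_disk R -> unit_disk R) :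
  R := poincare_dist (disk0 R) (a (disk0 R)).

Definition weighted_dist (R : realType) (Gam : aut_subgroup R)
    (T : metricType R) (r : representation Gam T)
    (G : set (unit_disk R -> unit_disk R))
    (omega : (unit_disk R -> unit_disk R) -> R) (rad : R) (t s : T) : \bar R :=
  ereal_sup [set (mdist (r (word w) t) (r (word w) s))%:E | w in
    [set w : seq (unit_disk R -> unit_disk R) |
      {in w, forall a, G a} /\ (\sum_(a <- w) omega a <= rad)%R]].

Definition weighted_entropy (R : realType) (Gam : aut_subgroup R)
    (T : metricType R) (r : representation Gam T)
    (G : set (unit_disk R -> unit_disk R))
    (omega : (unit_disk R -> unit_disk R) -> R) : \bar R :=
  entropy (weighted_dist r G omega) setT.

(* Main.v *)
(* The uniformization of the leaf through [z, t] is xi |-> [tau_z (rot xi), t] with tau_z the Moebius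
   translation, because holomorphic automorphisms of the disk are Moebius maps (Schwarz lemma, from
   Goursat's lemma applied to z = exp (u + i v), which gives constancy of circle means).

   Two points [z, t], [z', t'] with z, z' in a compact set are close at scale R exactly when |z - z'|
   is O(exp (- R)) and t, t' stay close under all rho (gamma) with d (0, gamma 0) <= R, up to an
   additive constant in R.  The first condition contributes exp (2 R) balls, hence the summand 2.  For
   the second one, a word of weight R moves 0 by at most R, whereas gamma with d (0, gamma 0) <= R is
   a word of weight at most K R + O (1) by the Svarc-Milnor lemma: this gives the two inequalities. *)

Require Import Defs.
From HB Require Import structures.
From mathcomp Require Import all_boot all_order all_algebra.
From mathcomp Require Import complex.
From mathcomp Require Import all_classical all_reals all_analysis.
From mathcomp Require Import ring lra.

Set Implicit Arguments.
Unset Strict Implicit.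
Unset Printing Implicit Defensive.

Import Order.TTheory GRing.Theory Num.Theory.
Import numFieldTopology.Exports numFieldNormedType.Exports.

Local Open Scope classical_set_scope.
Local Open Scope ring_scope.
Local Open Scope complex_scope.
Local Notation "z ^*" := (conjc z) : ring_scope.
Local Notation Re := complex.Re.
Local Notation Im := complex.Im.

(** * Goursat's lemma for closed 1-forms *)

(** The entropy is computed with arbitrary holomorphic coverings of the leaves, so their explicit
    form is needed before any counting. Such a covering and the parametrization z |-> [z, t] are
    lifted through each other, and by uniqueness of lifts the two lifts are mutually inverse. Only
    the lift of the covering comes with holomorphy; the other one is produced merely continuous.
    This is why the classification of automorphisms is proved for holomorphic maps with a continuous
    inverse.

    Two obstacles shape the count. Points that are close in X have representatives that are close
    only after applying an element of Gamma, which may vary along the leaf; the injectivity radius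
    pins it down. Moreover the leafwise distance allows an unknown rotation; the separation estimate
    for the centers therefore has to hold for every unimodular factor. For the lower bound, covering
    numbers must multiply: a family of pairs (grid point, separated point of T) is injected into the
    set of balls. Shifts of R by a constant and constant factors in the counts disappear in the
    limit, so crude constants suffice throughout. *)

Section Integral.
Variable R : realType.
Implicit Types (f g F : R -> R) (a b c x : R).

Lemma cvg_at_dist f x : {for x, continuous f} <->
  forall e, 0 < e -> exists2 d, 0 < d & forall y, `|y - x| < d -> `|f y - f x| < e.
Proof.
split=> [fx e e0|H].
  have /cvgrPdist_lt /(_ e e0) /nbhs_ballP [d /= d0 H] := fx.
  by exists d => // y yx; rewrite distrC; apply: H; rewrite /ball/= distrC.
apply/cvgrPdist_lt => e /H[d d0 K]; apply/nbhs_ballP; exists d => //= y.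
by rewrite /ball/= distrC => /K; rewrite distrC.
Qed.

Lemma mean_value f (df : R -> R) a b : a < b ->
  (forall x, a <= x <= b -> is_derive x (1:R) f (df x)) ->
  exists2 c, a < c < b & f b - f a = df c * (b - a).
Proof.
move=> ab H.
have H1 x : x \in `]a, b[ -> is_derive x (1:R) f (df x).
  by rewrite in_itv/= => /andP[ac cb]; apply: H; rewrite !ltW.
have H2 : {within `[a, b], continuous f}.
  apply: derivable_within_continuous => x; rewrite in_itv/= => xab.
  by have [] := H _ xab.
have [c] := MVT ab H1 H2.
by rewrite in_itv /= => cab; exists c.
Qed.

Definition primitive_on a b f F := forall x, a <= x <= b -> is_derive x (1:R) F (f x).

(** Clamping the argument to [a, b] turns [f] into a function continuous on the whole line.
    Integrating from a - 1, inside a segment that ends at b + 1, makes both endpoints interior, so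
    the derivative is two-sided there. *)
Lemma primitive_exists a b f :
  (forall x, a <= x <= b -> {for x, continuous f}) -> exists F, primitive_on a b f F.
Proof.
move=> fc; have [ab|ba] := leP a b; last first.
  by exists f => x; lra.
pose g x := f (Num.max a (Num.min b x)).
have gc : continuous g.
  move=> x; apply/cvg_at_dist => e e0.
  have mab y : a <= Num.max a (Num.min b y) <= b.
    by rewrite le_max lexx ge_max ab ge_min lexx.
  have /cvg_at_dist/(_ e e0)[d d0 H] := fc _ (mab x).
  exists d => // y yx; apply: H; apply: le_lt_trans yx.
  have [u0 v0] : y - x <= `|y - x| /\ x - y <= `|y - x|.
    by rewrite -(opprB y) ler_norm ler_normr lexx orbT.
  rewrite ler_norml; case: (leP b y) => ?; case: (leP b x) => ?.
  - by case: (leP a b) => ?; apply/andP; split; lra.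
  - by case: (leP a b) => ?; case: (leP a x) => ?; apply/andP; split; lra.
  - by case: (leP a y) => ?; case: (leP a b) => ?; apply/andP; split; lra.
  - by case: (leP a y) => ?; case: (leP a x) => ?; apply/andP; split; lra.
have gi : lebesgue_measure.-integrable `[a - 1, b + 1] (EFin \o g).
  apply: continuous_compact_integrable; first exact: segment_compact.
  exact: continuous_subspaceT.
exists (fun x => \int[lebesgue_measure]_(t in `[a - 1, x]) g t) => x xab.
have [||dF F'] := @continuous_FTC1_closed R g (a - 1) x (b + 1) _ gi _ (gc x).
- by lra.
- by lra.
have -> : f x = g x.
  by case/andP: xab => ax xb; rewrite /g (min_idPr xb) (max_idPr ax).
by rewrite -F' derive1E; apply: DeriveDef.
Qed.

(** Defining the integral by primitives reduces its linearity, monotonicity and additivity to the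
    mean value theorem. For a <= b the choice of the primitive is immaterial; 0 is the default when
    there is none. *)
Definition intg f a b : R := xget 0 [set v | exists2 F, primitive_on a b f F & v = F b - F a].

Lemma intgE F f a b : a <= b -> primitive_on a b f F -> intg f a b = F b - F a.
Proof.
move=> ab HF; rewrite /intg; case: xgetP => [v _ [G HG ->]|/(_ (F b - F a))]; last first.
  by case; exists F.
move: ab; rewrite le_eqVlt => /predU1P[->|ab]; first by rewrite !subrr.
have H x : a <= x <= b -> is_derive x (1:R) (G - F) ((f - f) x).
  by move=> xab; apply: is_deriveB; [exact: HG|exact: HF].
by have [c _] := mean_value ab H; rewrite !fctE/=; lra.
Qed.

Definition cont_on a b f := forall x, a <= x <= b -> {for x, continuous f}.

Lemma intg_comb f g a b (k l : R) : a <= b -> cont_on a b f -> cont_on a b g ->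
  intg (fun x => k * f x + l * g x) a b = k * intg f a b + l * intg g a b.
Proof.
move=> ab /primitive_exists[F HF] /primitive_exists[G HG].
have H : primitive_on a b (fun x => k * f x + l * g x) (k *: F + l *: G).
  move=> x xab; have := HF _ xab; have := HG _ xab => HG' HF'.
  by apply: is_deriveD; exact: is_deriveZ.
by rewrite (intgE ab HF) (intgE ab HG) (intgE ab H) !fctE /GRing.scale /=; ring.
Qed.

Lemma intg_split f a b c : a <= b -> b <= c -> cont_on a c f ->
  intg f a c = intg f a b + intg f b c.
Proof.
move=> ab bc /primitive_exists[F HF].
have H1 : primitive_on a b f F by move=> x xab; apply: HF; lra.
have H2 : primitive_on b c f F by move=> x xab; apply: HF; lra.
rewrite (intgE (le_trans ab bc) HF) (intgE ab H1) (intgE bc H2); lra.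
Qed.

Lemma intg_le f g a b : a <= b -> cont_on a b f -> cont_on a b g ->
  (forall x, a <= x <= b -> f x <= g x) -> intg f a b <= intg g a b.
Proof.
move=> ab /primitive_exists[F HF] /primitive_exists[G HG] fg.
rewrite (intgE ab HF) (intgE ab HG).
move: ab; rewrite le_eqVlt => /predU1P[->|ab]; first by rewrite !subrr.
have H x : a <= x <= b -> is_derive x (1:R) (G - F) ((g - f) x).
  by move=> xab; apply: is_deriveB; [exact: HG|exact: HF].
have [c cab] := mean_value ab H; rewrite !fctE /=; have : f c <= g c by apply: fg; lra.
by nra.
Qed.

Lemma intg_cst a b (k : R) : a <= b -> intg (fun=> k) a b = k * (b - a).
Proof.
move=> ab; have H : primitive_on a b (fun=> k) (fun x => k * x).
  by move=> x _; apply: is_derive_eq; rewrite /GRing.scale/=; ring.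
by rewrite (intgE ab H) mulrBr.
Qed.

Lemma cont_on_cst a b (k : R) : cont_on a b (fun=> k).
Proof. by move=> x _; exact: cst_continuous. Qed.

Lemma intg_near f g a b M : a <= b -> cont_on a b f -> cont_on a b g ->
  (forall x, a <= x <= b -> `|f x - g x| <= M) ->
  `|intg f a b - intg g a b| <= M * (b - a).
Proof.
move=> ab fc gc fg.
have E := @intg_comb f g a b 1 (-1) ab fc gc.
have dc : cont_on a b (fun x => 1 * f x + -1 * g x).
  move=> x xab; apply: cvgD; apply: cvgM; try exact: cst_continuous.
    exact: fc.
  exact: gc.
have H1 := intg_le ab dc (@cont_on_cst a b M).
have H2 := intg_le ab (@cont_on_cst a b (- M)) dc.
rewrite ler_norml; apply/andP; split.
  rewrite -mulNr -intg_cst//; have -> : intg f a b - intg g a b = 1 * intg f a b + -1 * intg g a b by ring.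
  by rewrite -E; apply: H2 => x /fg; rewrite ler_norml => /andP[]; lra.
rewrite -intg_cst//; have -> : intg f a b - intg g a b = 1 * intg f a b + -1 * intg g a b by ring.
by rewrite -E; apply: H1 => x /fg; rewrite ler_norml => /andP[]; lra.
Qed.

Lemma intg_affine a b (k l x0 : R) : a <= b ->
  intg (fun x => k + l * (x - x0)) a b = (k + l * ((a + b) / 2 - x0)) * (b - a).
Proof.
move=> ab; pose F x := k * x + l * (2^-1 * x * x - x0 * x).
have H : primitive_on a b (fun x => k + l * (x - x0)) F.
  by move=> x _; apply: is_derive_eq; rewrite /GRing.scale /=; field.
by rewrite (intgE ab H) /F; field.
Qed.

Lemma intg_eq0 f a b : cont_on a b f -> (forall x, a <= x <= b -> 0 <= f x) ->
  intg f a b = 0 -> forall x, a < x < b -> f x = 0.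
Proof.
move=> fc f0 I0 x xab; apply/eqP; rewrite eq_le f0 ?andbT; last by lra.
rewrite leNgt; apply/negP => fx.
have xab' : a <= x <= b by lra.
have fx2 : 0 < f x / 2 by lra.
have /cvg_at_dist/(_ _ fx2)[d d0 H] := fc x xab'.
pose e := Num.min (d / 2) (Num.min ((x - a) / 2) ((b - x) / 2)).
have e0 : 0 < e by rewrite !lt_min; apply/and3P; split; lra.
have [ed [ea eb]] : e <= d / 2 /\ e <= (x - a) / 2 /\ e <= (b - x) / 2.
  by rewrite !ge_min !lexx /= ?orbT.
have sub u v : a <= u -> v <= b -> cont_on u v f by move=> au vb y yuv; apply: fc; lra.
have /= A := @intg_split f a x b; have B := @intg_split f x (x + e) b.
have z0 u v : a <= u -> u <= v -> v <= b -> 0 <= intg f u v.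
  move=> au uv vb; rewrite -(mul0r (v - u)) -intg_cst//; apply: intg_le => //.
  - exact: cont_on_cst.
  - exact: sub.
  - by move=> y yuv; apply: f0; lra.
have : f x / 2 * (x + e - x) <= intg f x (x + e).
  rewrite -intg_cst; last by lra.
  apply: intg_le; [by lra|exact: cont_on_cst|by apply: sub; lra|].
  move=> y yx; have /H : `|y - x| < d by rewrite ger0_norm; lra.
  by rewrite ltr_norml => /andP[]; lra.
move: I0; rewrite A; [|by lra|by lra|by []].
rewrite B; [|by lra|by lra|by apply: sub; lra].
have := z0 a x; have := z0 (x + e) b; nra.
Qed.
End Integral.

Section Goursat.
Variable R : realType.
Variables p q : R -> R -> R.

(* Pointwise closedness of the 1-form [q dx + p dy] without continuity of partial derivatives: the
   first-order coefficient [k1] of [p] in [x] and of [q] in [y] is the same. *)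
Definition closed_at (x0 y0 : R) := exists k1 k2 k3 : R, forall e, 0 < e ->
  exists2 d, 0 < d & forall x y, `|x - x0| < d -> `|y - y0| < d ->
    `|p x y - (p x0 y0 + k1 * (x - x0) + k2 * (y - y0))| <= e * (`|x - x0| + `|y - y0|) /\
    `|q x y - (q x0 y0 + k3 * (x - x0) + k1 * (y - y0))| <= e * (`|x - x0| + `|y - y0|).

(** The terms [k' * 0] and [+ 0] give the hypothesis the shape taken by [closed_at] when one of the
    two increments vanishes. *)
Let near_cont (f : R -> R) x0 (k k' : R) :
  (exists2 d, 0 < d & forall x, `|x - x0| < d ->
     `|f x - (f x0 + k * (x - x0) + k' * 0)| <= 1 * (`|x - x0| + 0)) ->
  {for x0, continuous f}.
Proof.
case=> d d0 H; apply/cvg_at_dist => e e0.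
exists (Num.min d (e / (2 + `|k|))) => [|x].
  by rewrite lt_min d0 divr_gt0// ltr_wpDr.
rewrite lt_min => /andP[/H h1 h2].
have -> : f x - f x0 = (f x - (f x0 + k * (x - x0) + k' * 0)) + k * (x - x0) by ring.
apply: le_lt_trans (ler_normD _ _) _; rewrite normrM.
rewrite ltr_pdivlMr in h2; last by rewrite ltr_wpDr.
have := normr_ge0 (x - x0); nra.
Qed.

Lemma closed_at_cont x0 y0 : closed_at x0 y0 ->
  [/\ {for x0, continuous (p^~ y0)}, {for y0, continuous (p x0)},
      {for x0, continuous (q^~ y0)} & {for y0, continuous (q x0)}].
Proof.
case=> k1 [k2 [k3 /(_ 1 ltr01)[d d0 H]]].
have h0 z : `|z - z : R| < d by rewrite subrr normr0.
split.
- apply: (@near_cont _ _ k1 k2); exists d => // x xd.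
  by have [+ _] := H x y0 xd (h0 _); rewrite subrr normr0.
- apply: (@near_cont _ _ k2 k1); exists d => // y yd.
  have [+ _] := H x0 y (h0 _) yd; rewrite subrr normr0 mulr0 !addr0 add0r.
  by [].
- apply: (@near_cont _ _ k3 k1); exists d => // x xd.
  by have [_] := H x y0 xd (h0 _); rewrite subrr normr0.
- apply: (@near_cont _ _ k1 k3); exists d => // y yd.
  have [_] := H x0 y (h0 _) yd; rewrite subrr normr0 mulr0 !addr0 add0r.
  by [].
Qed.

(** The integral of [q dx + p dy] counterclockwise along the boundary of the rectangle [a, b] x
    [c, d]. *)
Definition bdry_int a b c d : R :=
  intg (q^~ c) a b + intg (p b) c d - intg (q^~ d) a b - intg (p a) c d.

Definition rect_closed a b c d := forall x y, a <= x <= b -> c <= y <= d -> closed_at x y.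

Lemma rect_cont a b c d : rect_closed a b c d ->
  (forall y, c <= y <= d -> cont_on a b (p^~ y) /\ cont_on a b (q^~ y)) /\
  (forall x, a <= x <= b -> cont_on c d (p x) /\ cont_on c d (q x)).
Proof.
by move=> H; split=> u Hu; split=> v Hv;
  [have [] := closed_at_cont (H v u Hv Hu)|have [] := closed_at_cont (H v u Hv Hu)|
   have [] := closed_at_cont (H u v Hu Hv)|have [] := closed_at_cont (H u v Hu Hv)].
Qed.

Lemma bdry_int_split a b c d m n : a <= m <= b -> c <= n <= d -> rect_closed a b c d ->
  bdry_int a b c d = bdry_int a m c n + bdry_int m b c n + bdry_int a m n d + bdry_int m b n d.
Proof.
move=> /andP[am mb] /andP[cn nd] H; have [H1 H2] := rect_cont H.
have hc : c <= c <= d by lra.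
have hd : c <= d <= d by lra.
have hn : c <= n <= d by lra.
have ha : a <= a <= b by lra.
have hb : a <= b <= b by lra.
have hm : a <= m <= b by lra.
rewrite /bdry_int (intg_split am mb (H1 _ hc).2) (intg_split am mb (H1 _ hd).2).
rewrite (intg_split cn nd (H2 _ ha).1) (intg_split cn nd (H2 _ hb).1); ring.
Qed.

(** The affine part of the form integrates to 0 along the boundary, precisely because [p] in x and
    [q] in y share the coefficient [k1]. Only the error remains: at most e / 2 times the
    half-perimeter, integrated over the whole perimeter. *)
Lemma bdry_int_small x0 y0 : closed_at x0 y0 -> forall e, 0 < e ->
  exists2 r, 0 < r & forall a b c d, a <= x0 <= b -> c <= y0 <= d ->
   rect_closed a b c d -> (b - a) + (d - c) < r ->
   `|bdry_int a b c d| <= e * ((b - a) + (d - c)) ^+ 2.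
Proof.
move=> [k1 [k2 [k3 Hk]]] e e0; have [|r r0 H] := Hk (e / 2); first by lra.
exists r => // a b c d abx cdy /rect_cont[H1 H2] small.
have ab : a <= b by lra.
have cd : c <= d by lra.
pose S := (b - a) + (d - c).
pose M := e / 2 * S.
have est x y : a <= x <= b -> c <= y <= d ->
  `|p x y - (p x0 y0 + k1 * (x - x0) + k2 * (y - y0))| <= M /\
  `|q x y - (q x0 y0 + k3 * (x - x0) + k1 * (y - y0))| <= M.
  move=> xab ycd.
  have nx : `|x - x0| <= b - a by rewrite ler_norml; lra.
  have ny : `|y - y0| <= d - c by rewrite ler_norml; lra.
  have [||h1 h2] := H x y; [by lra|by lra|].
  suff : e / 2 * (`|x - x0| + `|y - y0|) <= M by split; lra.
  by rewrite /M /S ler_wpM2l//; lra.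
have hor y : c <= y <= d ->
  `|intg (q^~ y) a b - intg (fun x => (q x0 y0 + k1 * (y - y0)) + k3 * (x - x0)) a b| <= M * (b - a).
  move=> ycd; apply: intg_near => //; first exact: (H1 _ ycd).2.
    move=> x _; apply: (@near_cont _ _ k3 0); exists 1 => // u _.
    have -> : q x0 y0 + k1 * (y - y0) + k3 * (u - x0) -
      (q x0 y0 + k1 * (y - y0) + k3 * (x - x0) + k3 * (u - x) + 0 * 0) = 0 by ring.
    by rewrite normr0 mul1r addr0.
  move=> x xab; have [_] := est x y xab ycd.
  by rewrite (_ : q x0 y0 + k3 * (x - x0) + k1 * (y - y0) = q x0 y0 + k1 * (y - y0) + k3 * (x - x0)); last by ring.
have ver x : a <= x <= b ->
  `|intg (p x) c d - intg (fun y => (p x0 y0 + k1 * (x - x0)) + k2 * (y - y0)) c d| <= M * (d - c).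
  move=> xab; apply: intg_near => //; first exact: (H2 _ xab).1.
    move=> y _; apply: (@near_cont _ _ k2 0); exists 1 => // u _.
    have -> : p x0 y0 + k1 * (x - x0) + k2 * (u - y0) -
      (p x0 y0 + k1 * (x - x0) + k2 * (y - y0) + k2 * (u - y) + 0 * 0) = 0 by ring.
    by rewrite normr0 mul1r addr0.
  by move=> y ycd; have [] := est x y xab ycd.
have hc := hor c; have hd := hor d; have va := ver a; have vb := ver b.
rewrite !intg_affine // in hc hd va vb.
have {}hc := hc ltac:(lra); have {}hd := hd ltac:(lra).
have {}va := va ltac:(lra); have {}vb := vb ltac:(lra).
have -> : e * (b - a + (d - c)) ^+ 2 = M * (b - a) + M * (d - c) + M * (b - a) + M * (d - c).
  by rewrite /M /S; field.
rewrite /bdry_int; move: hc hd va vb; rewrite !ler_norml.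
move=> /andP[? ?] /andP[? ?] /andP[? ?] /andP[? ?]; apply/andP; split; nra.
Qed.

Lemma goursat a b c d : a <= b -> c <= d -> rect_closed a b c d -> bdry_int a b c d = 0.
Proof.
move=> ab cd H; apply/eqP; rewrite -normr_le0 leNgt; apply/negP => I0.
set k := `|_| in I0.
pose w n := (b - a) / 2 ^+ n; pose h n := (d - c) / 2 ^+ n.
have p2 n : 0 < (2:R) ^+ n by rewrite exprn_gt0.
have w0 n : 0 <= w n by rewrite divr_ge0 ?(ltW (p2 n)) ?subr_ge0.
have h0 n : 0 <= h n by rewrite divr_ge0 ?(ltW (p2 n)) ?subr_ge0.
have wS n : w n = w n.+1 + w n.+1 by rewrite /w exprS; field; rewrite gt_eqF.
have hS n : h n = h n.+1 + h n.+1 by rewrite /h exprS; field; rewrite gt_eqF.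
pose J n (z : R * R) := bdry_int z.1 (z.1 + w n) z.2 (z.2 + h n).
pose ok n (z : R * R) := [/\ a <= z.1, z.1 + w n <= b, c <= z.2, z.2 + h n <= d & k / 4 ^+ n <= `|J n z|].
(* Since the four quarters add up to the whole, one of them carries at least a quarter of the
   absolute value. *)
have step n z : ok n z -> exists z', ok n.+1 z' /\
  [/\ z.1 <= z'.1, z'.1 + w n.+1 <= z.1 + w n, z.2 <= z'.2 & z'.2 + h n.+1 <= z.2 + h n].
  move=> [za zb zc zd zJ].
  have E := @bdry_int_split z.1 (z.1 + w n) z.2 (z.2 + h n) (z.1 + w n.+1) (z.2 + h n.+1).
  have := w0 n.+1; have := h0 n.+1; have := wS n; have := hS n => ? ? ? ?.
  have {}E := E ltac:(lra) ltac:(lra) _.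
  have {}E : J n z = J n.+1 z + J n.+1 (z.1 + w n.+1, z.2) + J n.+1 (z.1, z.2 + h n.+1)
     + J n.+1 (z.1 + w n.+1, z.2 + h n.+1).
    rewrite /J E /=; last by move=> x y hx hy; apply: H; lra.
    have -> : z.1 + w n.+1 + w n.+1 = z.1 + w n by lra.
    by have -> : z.2 + h n.+1 + h n.+1 = z.2 + h n by lra.
  have k4 : k / 4 ^+ n = k / 4 ^+ n.+1 + k / 4 ^+ n.+1 + k / 4 ^+ n.+1 + k / 4 ^+ n.+1.
    by rewrite exprS; field; rewrite expf_eq0 pnatr_eq0 andbF.
  case: (leP (k / 4 ^+ n.+1) `|J n.+1 z|) => j1.
    by exists z; split; [split|split]; lra.
  case: (leP (k / 4 ^+ n.+1) `|J n.+1 (z.1 + w n.+1, z.2)|) => j2.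
    by exists (z.1 + w n.+1, z.2); split; [split|split]; rewrite /=; lra.
  case: (leP (k / 4 ^+ n.+1) `|J n.+1 (z.1, z.2 + h n.+1)|) => j3.
    by exists (z.1, z.2 + h n.+1); split; [split|split]; rewrite /=; lra.
  case: (leP (k / 4 ^+ n.+1) `|J n.+1 (z.1 + w n.+1, z.2 + h n.+1)|) => j4.
    by exists (z.1 + w n.+1, z.2 + h n.+1); split; [split|split]; rewrite /=; lra.
  exfalso; move: zJ; rewrite E k4.
  move: j1 j2 j3 j4; move: (J n.+1 z) => t1; move: (J n.+1 (_, z.2)) => t2.
  move: (J n.+1 (z.1, _)) => t3; move: (J n.+1 _) => t4 *.
  have := ler_normD (t1 + t2 + t3) t4; have := ler_normD (t1 + t2) t3.
  have := ler_normD t1 t2; lra.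
have ok0 : ok 0 (a, c).
  split; rewrite /w /h /= ?expr0 ?divr1 ?lexx //; try lra.
  by rewrite /J/= /w /h expr0 !divr1 !subrKC.
have /cid[s [s0 sS]] : exists s : nat -> R * R, s 0%N = (a, c) /\ forall n, ok n (s n) /\
  [/\ (s n).1 <= (s n.+1).1, (s n.+1).1 + w n.+1 <= (s n).1 + w n,
      (s n).2 <= (s n.+1).2 & (s n.+1).2 + h n.+1 <= (s n).2 + h n].
  have /choice[f Hf] : forall nz : nat * (R * R), exists z', ok nz.1 nz.2 -> ok nz.1.+1 z' /\
    [/\ nz.2.1 <= z'.1, z'.1 + w nz.1.+1 <= nz.2.1 + w nz.1, nz.2.2 <= z'.2 &
        z'.2 + h nz.1.+1 <= nz.2.2 + h nz.1].
    move=> [n z]; case: (pselect (ok n z)) => [/step[z' ?]|]; last by exists z.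
    by exists z'.
  pose fix s n := if n is m.+1 then f (m, s m) else (a, c).
  have oks n : ok n (s n) by elim: n => [//|n IH] /=; have [] := Hf (n, s n) IH.
  exists s; split=> // n; split=> //.
  by have [_] := Hf (n, s n) (oks n).
have mono n m : (n <= m)%N -> [/\ (s n).1 <= (s m).1, (s m).1 + w m <= (s n).1 + w n,
      (s n).2 <= (s m).2 & (s m).2 + h m <= (s n).2 + h n].
  elim: m => [|m IH]; first by rewrite leqn0 => /eqP->; split.
  rewrite leq_eqVlt => /predU1P[->|]; first by split.
  rewrite ltnS => /IH[? ? ? ?]; have [_ [? ? ? ?]] := sS m; split; lra.
have lim (f : R * R -> R) (u : nat -> R) : (forall n, 0 <= u n) ->
   (forall n m, (n <= m)%N -> f (s n) <= f (s m) /\ f (s m) + u m <= f (s n) + u n) ->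
   exists x, forall n, f (s n) <= x <= f (s n) + u n.
  move=> u0 Hf; exists (sup (range (f \o s))) => n.
  have ubd m : f (s m) <= f (s n) + u n.
    have [mn|/ltnW nm] := leqP m n.
      by have [? _] := Hf _ _ mn; have := u0 n; lra.
    by have [_ ?] := Hf _ _ nm; have := u0 m; lra.
  have ne : range (f \o s) !=set0 by exists (f (s 0%N)); exists 0%N.
  apply/andP; split.
    apply: ub_le_sup; last by exists n.
    by exists (f (s n) + u n) => _ [m _ <-]; exact: ubd.
  by apply: ge_sup => // _ [m _ <-]; exact: ubd.
have [|x Hx] := lim fst w w0; first by move=> n m /mono[].
have [|y Hy] := lim snd h h0; first by move=> n m /mono[].
have xab : a <= x <= b by have := Hx 0%N; have := w0 0%N; rewrite s0 /w expr0 divr1 /=; lra.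
have ycd : c <= y <= d by have := Hy 0%N; have := h0 0%N; rewrite s0 /h expr0 divr1 /=; lra.
pose S := (b - a) + (d - c).
(* With this factor the bound of [bdry_int_small] on the n-th rectangle is below k / 4 ^ n, against
   the lower bound preserved by the bisection. The added 1 covers the degenerate case S = 0. *)
have e0 : 0 < k / (2 * (S ^+ 2 + 1)) by rewrite divr_gt0// mulr_gt0// ltr_wpDl // sqr_ge0.
have [r r0 Hr] := bdry_int_small (H x y xab ycd) e0.
have [n Hn] : exists n, S / 2 ^+ n < r.
  have S0 : 0 <= S by rewrite /S; lra.
  exists (Num.truncn (S / r)).+1; rewrite ltr_pdivrMr // mulrC -ltr_pdivrMr//.
  have := truncnS_gt (S / r) => /lt_le_trans; apply.
  by rewrite -natrX ler_nat ltnW // ltn_expl.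
have [[ha hb hc hd hk] _] := sS n.
have := Hr (s n).1 ((s n).1 + w n) (s n).2 ((s n).2 + h n) (Hx n) (Hy n).
have -> : (s n).1 + w n - (s n).1 + ((s n).2 + h n - (s n).2) = S / 2 ^+ n.
  by rewrite /w /h /S; ring.
move=> /(_ _ Hn) K; have {}K : `|J n (s n)| <= k / (2 * (S ^+ 2 + 1)) * (S / 2 ^+ n) ^+ 2.
  by apply: K => u v Hu Hv; apply: H; lra.
have := le_trans hk K; apply/negP; rewrite -ltNge.
have -> : (S / 2 ^+ n) ^+ 2 = S ^+ 2 / 4 ^+ n.
  by rewrite exprMn exprVn -exprM mulnC exprM (_ : 2 ^+ 2 = 4) //; ring.
rewrite mulrA ltr_pM2r ?invr_gt0 ?exprn_gt0 //.
have S2 : 0 <= S ^+ 2 by exact: sqr_ge0.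
rewrite mulrAC ltr_pdivrMr ?mulr_gt0 //; last by lra.
nra.
Qed.

(** Goursat on [u1, u2] x [c, c + L]: periodicity cancels the two horizontal sides, and the vertical
    sides are the two integrals. *)
Lemma periodic_mean_cst u1 u2 (L c : R) : u1 <= u2 -> 0 <= L ->
  (forall u v, u1 <= u <= u2 -> closed_at u v) ->
  (forall u v, q u (v + L) = q u v) ->
  intg (p u1) c (c + L) = intg (p u2) c (c + L).
Proof.
move=> u12 L0 H per.
have cL : c <= c + L by lra.
have := goursat u12 cL (fun x y hx _ => H x y hx).
rewrite /bdry_int (_ : q^~ (c + L) = q^~ c); first by lra.
by apply/funext => u; exact: per.
Qed.
End Goursat.

(** * Complex derivatives and Moebius maps *)

Section ComplexModulus.
Variable R : realType.
Implicit Types z w c : R[i].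

Lemma cmodC z : (cmod z)%:C = `|z|.
Proof. by rewrite /cmod normc_def. Qed.

Lemma cmodE z : cmod z = Num.sqrt (complex.Re z ^+ 2 + complex.Im z ^+ 2).
Proof. by rewrite /cmod normc_def. Qed.

Lemma cmod_ge0 z : 0 <= cmod z.
Proof. by rewrite cmodE sqrtr_ge0. Qed.

Lemma sqr_cmod z : cmod z ^+ 2 = complex.Re z ^+ 2 + complex.Im z ^+ 2.
Proof. by rewrite cmodE sqr_sqrtr// addr_ge0 ?sqr_ge0. Qed.

Lemma sqr_cmodC z : (cmod z ^+ 2)%:C = z * z^*.
Proof. by rewrite rmorphXn/= cmodC sqr_normc. Qed.

Lemma cmod_eq0 z : (cmod z == 0) = (z == 0).
Proof. by rewrite -(inj_eq (@complexI R)) cmodC normr_eq0. Qed.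

Lemma cmod0 : cmod (0 : R[i]) = 0.
Proof. by apply/eqP; rewrite cmod_eq0. Qed.

Lemma cmodM z w : cmod (z * w) = cmod z * cmod w.
Proof. by apply: complexI; rewrite rmorphM/= !cmodC normrM. Qed.

Lemma cmodR (x : R) : cmod x%:C = `|x|.
Proof. by rewrite cmodE /= expr0n addr0 sqrtr_sqr. Qed.

Lemma cmod1 : cmod (1 : R[i]) = 1.
Proof. by rewrite -[1]/(1%:C) cmodR normr1. Qed.

Lemma cmodV z : cmod z^-1 = (cmod z)^-1.
Proof. by apply: complexI; rewrite fmorphV/= !cmodC normfV. Qed.

Lemma cmodN z : cmod (- z) = cmod z.
Proof. by rewrite /cmod normrN. Qed.

Lemma cmodBC z w : cmod (z - w) = cmod (w - z).
Proof. by rewrite -opprB cmodN. Qed.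

Lemma cmodD z w : cmod (z + w) <= cmod z + cmod w.
Proof. by rewrite -lecR rmorphD/= !cmodC ler_normD. Qed.

Lemma cmod_conj z : cmod z^* = cmod z.
Proof. by rewrite /cmod normcJ. Qed.

Lemma Re_le_cmod z : `|complex.Re z| <= cmod z.
Proof. by rewrite -lecR cmodC normc_ge_Re. Qed.

Lemma Im_le_cmod z : `|complex.Im z| <= cmod z.
Proof. by rewrite cmodE -sqrtr_sqr ler_wsqrtr // lerDr sqr_ge0. Qed.

Lemma cmod_le_ReIm z : cmod z <= `|complex.Re z| + `|complex.Im z|.
Proof.
rewrite cmodE -[leRHS]ger0_norm ?addr_ge0// -sqrtr_sqr ler_wsqrtr //.
rewrite sqrrD !real_normK ?num_real // lerD2r lerDl.
by rewrite mulrn_wge0 // mulr_ge0.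
Qed.

Lemma cmod_subr_ge z w : cmod z - cmod w <= cmod (z - w).
Proof. by rewrite lerBlDr -{1}(subrK w z) cmodD. Qed.

Lemma cmod_gt0 z : z != 0 -> 0 < cmod z.
Proof. by move=> z0; rewrite lt_neqAle cmod_ge0 eq_sym cmod_eq0 z0. Qed.

Lemma ReB z w : complex.Re (z - w) = complex.Re z - complex.Re w.
Proof. by case: z w => [? ?] [? ?]. Qed.

Lemma ImB z w : complex.Im (z - w) = complex.Im z - complex.Im w.
Proof. by case: z w => [? ?] [? ?]. Qed.

Lemma unit_direction w : exists2 k, cmod k = 1 & k * w = (cmod w)%:C.
Proof.
have [->|w0] := eqVneq w 0; first by exists 1; rewrite ?cmod1 ?mulr0 ?cmod0.
have c0 : (cmod w)%:C != 0 by rewrite cmodC normr_eq0.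
exists ((cmod w)%:C / w); last by rewrite divfK.
by rewrite cmodM cmodV cmodR ger0_norm ?cmod_ge0 // divff // cmod_eq0.
Qed.

Lemma unit_angle (k : R[i]) : cmod k = 1 -> exists t : R, k = cos t +i* sin t.
Proof.
move=> k1; have := sqr_cmod k; rewrite k1 expr1n => E.
have kx : -1 <= complex.Re k <= 1.
  by rewrite -ler_norml -k1 Re_le_cmod.
have sE : Num.sqrt (1 - complex.Re k ^+ 2) = `|complex.Im k|.
  by rewrite E addrC addKr sqrtr_sqr.
case: (leP 0 (complex.Im k)) => im.
  exists (acos (complex.Re k)); rewrite acosK // sin_acos // sE ger0_norm //.
  by case: k {k1 E kx sE im}.
exists (- acos (complex.Re k)); rewrite cosN sinN acosK // sin_acos // sE ltr0_norm // opprK.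
by case: k {k1 E kx sE im}.
Qed.

Lemma cmod_angle (t : R) : cmod (cos t +i* sin t : R[i]) = 1.
Proof. by rewrite cmodE /= cos2Dsin2 sqrtr1. Qed.
End ComplexModulus.

Section Cdiff.
Variable R : realType.
Implicit Types (F G : R[i] -> R[i]) (z w c : R[i]).

(** Complex differentiability with derivative c, written with real moduli and real tolerances so
    that estimates stay within ordered-field arithmetic. [derivable_cdiff] links it to
    [derivable]. *)
Definition cdiff F z c := forall e : R, 0 < e -> exists2 d : R, 0 < d & forall w,
  cmod (w - z) < d -> cmod (F w - F z - c * (w - z)) <= e * cmod (w - z).

Definition ccont F z := forall e : R, 0 < e -> exists2 d : R, 0 < d & forall w,
  cmod (w - z) < d -> cmod (F w - F z) < e.

Lemma cdiff_lip F z c : cdiff F z c -> exists2 d : R, 0 < d & forall w,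
  cmod (w - z) < d -> cmod (F w - F z) <= (1 + cmod c) * cmod (w - z).
Proof.
move=> /(_ 1 ltr01)[d d0 H]; exists d => // w /H Hw.
rewrite -(subrK (c * (w - z)) (F w - F z)); apply: le_trans (cmodD _ _) _.
by rewrite cmodM mulrDl lerD.
Qed.

Lemma cdiff_ccont F z c : cdiff F z c -> ccont F z.
Proof.
move=> /cdiff_lip[d d0 H] e e0; have c0 := cmod_ge0 c.
exists (Num.min d (e / (2 + cmod c))) => [|w]; first by rewrite lt_min d0 divr_gt0//; lra.
rewrite lt_min => /andP[/H h1]; rewrite ltr_pdivlMr; last by lra.
by move=> h2; apply: le_lt_trans h1 _; have := cmod_ge0 (w - z); nra.
Qed.

Lemma cdiff_cst k z : cdiff (fun=> k) z 0.
Proof. by move=> e e0; exists 1 => // w _; rewrite subrr mul0r subr0 cmod0 mulr_ge0 ?cmod_ge0 ?ltW. Qed.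

Lemma cdiff_id z : cdiff id z 1.
Proof. by move=> e e0; exists 1 => // w _; rewrite mul1r subrr cmod0 mulr_ge0 ?cmod_ge0 ?ltW. Qed.

Lemma cdiffD F G z a b : cdiff F z a -> cdiff G z b -> cdiff (fun w => F w + G w) z (a + b).
Proof.
move=> HF HG e e0; have e2 : 0 < e / 2 by lra.
have [d1 d10 H1] := HF _ e2; have [d2 d20 H2] := HG _ e2.
exists (Num.min d1 d2) => [|w]; first by rewrite lt_min d10.
rewrite lt_min => /andP[/H1 h1 /H2 h2].
have -> : F w + G w - (F z + G z) - (a + b) * (w - z) =
  (F w - F z - a * (w - z)) + (G w - G z - b * (w - z)) by ring.
by apply: le_trans (cmodD _ _) _; lra.
Qed.

Lemma cdiffM F G z a b : cdiff F z a -> cdiff G z b ->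
  cdiff (fun w => F w * G w) z (a * G z + F z * b).
Proof.
(* [K] dominates |F z|, |G z| and the local Lipschitz constant 1 + |a| of F, the factors of the
   three error terms; each term receives a third of e. *)
move=> HF HG e e0; pose K := 1 + cmod (F z) + cmod (G z) + (1 + cmod a).
have := cmod_ge0 (F z); have := cmod_ge0 (G z); have := cmod_ge0 a => a0 g0 f0.
have K0 : 0 < K by rewrite /K; lra.
have eK : 0 < e / (3 * K) by rewrite divr_gt0// mulr_gt0.
have [d1 d10 H1] := HF _ eK; have [d2 d20 H2] := HG _ eK.
have [d3 d30 H3] := cdiff_lip HF; have [d4 d40 H4] := cdiff_ccont HG eK.
exists (Num.min (Num.min d1 d2) (Num.min d3 d4)) => [|w].
  by rewrite !lt_min d10 d20 d30.
rewrite !lt_min => /andP[/andP[/H1 h1 /H2 h2] /andP[/H3 h3 /H4 h4]].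
have -> : F w * G w - F z * G z - (a * G z + F z * b) * (w - z) =
  (F w - F z - a * (w - z)) * G z + F z * (G w - G z - b * (w - z)) +
  (F w - F z) * (G w - G z) by ring.
apply: le_trans (cmodD _ _) _; apply: le_trans (lerD (cmodD _ _) (lexx _)) _.
rewrite !cmodM; set t := cmod (w - z) in h1 h2 h3 *.
have t0 : 0 <= t := cmod_ge0 _.
have -> : e * t = K * (e / (3 * K)) * t + K * (e / (3 * K)) * t + K * (e / (3 * K)) * t.
  by field; rewrite gt_eqF.
set e' := e / (3 * K) in eK h1 h2 h4 *.
have KF : cmod (F z) <= K by rewrite /K; lra.
have KG : cmod (G z) <= K by rewrite /K; lra.
have Ka : 1 + cmod a <= K by rewrite /K; lra.
have := cmod_ge0 (F w - F z); have := cmod_ge0 (G w - G z).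
move=> x1 x2; apply: lerD; first apply: lerD.
- by rewrite -mulrA mulrC ler_pM ?cmod_ge0.
- by rewrite -mulrA ler_pM ?cmod_ge0.
- rewrite mulrAC; apply: ler_pM => //; last exact: ltW.
  by apply: le_trans h3 _; rewrite ler_wpM2r.
Qed.

Lemma cdiff_comp F G z a b : cdiff F z a -> cdiff G (F z) b -> cdiff (G \o F) z (b * a).
Proof.
move=> HF HG e e0.
have a0 := cmod_ge0 a; have b0 := cmod_ge0 b.
have e1 : 0 < e / 2 / (1 + cmod a) by rewrite !divr_gt0//; lra.
have e2 : 0 < e / 2 / (1 + cmod b) by rewrite !divr_gt0//; lra.
have [d1 d10 H1] := HG _ e1; have [d2 d20 H2] := HF _ e2.
have [d3 d30 H3] := cdiff_lip HF; have [d4 d40 H4] := cdiff_ccont HF d10.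
exists (Num.min d2 (Num.min d3 d4)) => [|w]; first by rewrite !lt_min d20 d30.
rewrite !lt_min => /and3P[/H2 h2 /H3 h3 /H4 /H1 h1] /=.
have -> : G (F w) - G (F z) - b * a * (w - z) =
  (G (F w) - G (F z) - b * (F w - F z)) + b * (F w - F z - a * (w - z)) by ring.
apply: le_trans (cmodD _ _) _; rewrite cmodM.
set t := cmod (w - z) in h2 h3 *; have t0 : 0 <= t := cmod_ge0 _.
have na : 1 + cmod a != 0 by rewrite gt_eqF //; lra.
have nb : 1 + cmod b != 0 by rewrite gt_eqF //; lra.
have -> : e * t = e / 2 / (1 + cmod a) * ((1 + cmod a) * t) +
   (1 + cmod b) * (e / 2 / (1 + cmod b) * t) by field; rewrite na nb.
apply: lerD; first by apply: le_trans h1 _; rewrite ler_wpM2l// ltW.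
by apply: ler_pM => //; [exact: cmod_ge0|lra].
Qed.

Lemma cdiffV z : z != 0 -> cdiff (fun w => w^-1) z (- z^-2).
Proof.
move=> z0 e e0; have c0 := cmod_gt0 z0.
(* The remainder is (w - z) ^ 2 / (w z ^ 2). The first bound keeps |w| above |z| / 2, and the second
   then makes |w - z| at most e |w| |z| ^ 2. *)
exists (Num.min (cmod z / 2) (e * cmod z ^+ 3 / 2)) => [|w].
  by rewrite lt_min !divr_gt0// mulr_gt0// exprn_gt0.
rewrite lt_min => /andP[h1 h2].
have wz : cmod z / 2 < cmod w by have := cmod_subr_ge z w; rewrite cmodBC; lra.
have w0 : w != 0 by rewrite -cmod_eq0 gt_eqF//; lra.
have -> : w^-1 - z^-1 - - z ^- 2 * (w - z) = (w - z) ^+ 2 * (w^-1 * z ^- 2).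
  by field; rewrite z0 w0.
rewrite !cmodM !cmodV exprS !cmodM expr1 [in X in _ <= X]mulrC -mulrA ler_wpM2l ?cmod_ge0//.
have wp : 0 < cmod w by lra.
rewrite mulrA ler_pdivrMr ?mulr_gt0// ler_pdivrMr //.
have : e * cmod z ^+ 3 / 2 <= e * (cmod z * cmod z) * cmod w.
  rewrite (_ : e * cmod z ^+ 3 / 2 = e * (cmod z * cmod z) * (cmod z / 2)); last by field.
  by rewrite ler_wpM2l ?ltW// mulr_gt0// mulr_gt0.
by rewrite !exprS !expr0 ?mulr1 in h2 *; lra.
Qed.

Lemma cdiff_eq F G z c (r : R) : 0 < r -> (forall w, cmod (w - z) < r -> F w = G w) ->
  cdiff F z c -> cdiff G z c.
Proof.
move=> r0 FG HF e /HF[d d0 H]; exists (Num.min d r) => [|w]; first by rewrite lt_min d0.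
rewrite lt_min => /andP[/H + /FG <-]; rewrite (FG z) //.
by rewrite subrr cmod0.
Qed.

Lemma cdiff_unique F z a b : cdiff F z a -> cdiff F z b -> a = b.
Proof.
move=> Ha Hb; apply/eqP; rewrite -subr_eq0 -cmod_eq0 eq_le cmod_ge0 andbT.
apply/ler_addgt0Pl => e e0; rewrite addr0.
have e2 : 0 < e / 2 by lra.
have [d1 d10 H1] := Ha _ e2; have [d2 d20 H2] := Hb _ e2.
pose h : R := Num.min d1 d2 / 2.
have h0 : 0 < h by rewrite divr_gt0// lt_min d10.
have [l1 l2] : h < d1 /\ h < d2.
  have : Num.min d1 d2 <= d1 by rewrite ge_min lexx.
  have : Num.min d1 d2 <= d2 by rewrite ge_min lexx orbT.
  rewrite /h in h0 *; lra.
have hC : cmod (z + h%:C - z) = h by rewrite addrC addKr cmodR gtr0_norm.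
have {}H1 := H1 (z + h%:C); have {}H2 := H2 (z + h%:C); rewrite hC in H1 H2.
have {}H1 := H1 l1; have {}H2 := H2 l2.
have E : (a - b) * (z + h%:C - z) = (F (z + h%:C) - F z - b * (z + h%:C - z)) -
   (F (z + h%:C) - F z - a * (z + h%:C - z)) by ring.
have : cmod (a - b) * h <= e * h.
  rewrite -{1}hC -cmodM E; apply: le_trans (cmodD _ _) _; rewrite cmodN; lra.
by rewrite ler_pM2r.
Qed.
End Cdiff.

Section Moebius.
Variable R : realType.
Implicit Types a z w : R[i].

Definition mob a z : R[i] := (z + a) / (1 + a^* * z).

Lemma mob_den a z : cmod a < 1 -> cmod z < 1 -> 1 + a^* * z != 0.
Proof.
move=> a1 z1; rewrite -cmod_eq0 gt_eqF //.
have := cmod_subr_ge 1 (- (a^* * z)); rewrite opprK cmod1 cmodN cmodM cmod_conj.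
by have := cmod_ge0 a; have := cmod_ge0 z; nra.
Qed.

Lemma conj_mob a z : (mob a z)^* = (z^* + a^*) / (1 + a * z^*).
Proof. by rewrite /mob rmorphM fmorphV !rmorphD rmorph1 rmorphM /= conjcK. Qed.

(** The identity |1 + conj(a) z| ^ 2 - |z + a| ^ 2 = (1 - |a| ^ 2) (1 - |z| ^ 2). It gives
    invariance of the disk, and later the triangle inequality and the decay of 1 - |mob a z| ^ 2
    towards the boundary. *)
Lemma mob_norm a z : cmod a < 1 -> cmod z < 1 ->
  1 - cmod (mob a z) ^+ 2 = (1 - cmod a ^+ 2) * (1 - cmod z ^+ 2) / cmod (1 + a^* * z) ^+ 2.
Proof.
move=> a1 z1; apply: complexI.
have d := mob_den a1 z1.
have d' : 1 + a * z^* != 0.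
  by have := @mob_den a^* z^*; rewrite !cmod_conj conjcK => /(_ a1 z1).
rewrite rmorphB /= sqr_cmodC rmorph1 [((_ - _) * _ * _)%:C]rmorphM fmorphV /= sqr_cmodC.
rewrite [((_ - _) * _)%:C]rmorphM !rmorphB rmorph1 /= !sqr_cmodC.
rewrite conj_mob /mob.
rewrite [(1 + _)^*]rmorphD rmorph1 rmorphM /= conjcK.
by field; rewrite d d'.
Qed.

Lemma mob_disk a z : cmod a < 1 -> cmod z < 1 -> cmod (mob a z) < 1.
Proof.
move=> a1 z1; have a0 := cmod_ge0 a; have z0 := cmod_ge0 z.
rewrite -(@ltr_pXn2r _ 2) ?nnegrE ?cmod_ge0// expr1n -subr_gt0 mob_norm //.
rewrite divr_gt0 ?mulr_gt0 ?exprn_gt0 ?cmod_gt0 ?mob_den // subr_gt0 expr_lt1 //.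
Qed.

Lemma mobK a z : cmod a < 1 -> cmod z < 1 -> mob (- a) (mob a z) = z.
Proof.
move=> a1 z1; rewrite /mob rmorphN/=.
have d := mob_den a1 z1.
have aa : 1 - a * a^* != 0.
  rewrite -sqr_cmodC -[1]/(1%:C) -rmorphB/= fmorph_eq0 subr_eq0 eq_sym.
  by rewrite lt_eqF // expr_lt1 // cmod_ge0.
have E : 1 + - a^* * ((z + a) / (1 + a^* * z)) = (1 - a * a^*) / (1 + a^* * z) by field.
by rewrite E; field; rewrite aa d.
Qed.

Lemma mob0 a : mob a 0 = a.
Proof. by rewrite /mob add0r mulr0 addr0 divr1. Qed.

Lemma mobNr a : cmod a < 1 -> mob (- a) a = 0.
Proof. by move=> a1; rewrite -{2}(mob0 a) mobK ?cmod0. Qed.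

Lemma cdiff_mob a z : cmod a < 1 -> cmod z < 1 ->
  cdiff (mob a) z ((1 - a * a^*) / (1 + a^* * z) ^+ 2).
Proof.
move=> a1 z1; have d := mob_den a1 z1.
have H1 := cdiffD (cdiff_id z) (cdiff_cst a z).
have H2 := cdiffD (cdiff_cst 1 z) (cdiffM (cdiff_cst a^* z) (cdiff_id z)).
have H3 := cdiffM H1 (cdiff_comp H2 (cdiffV d)).
have := H3; rewrite /comp /mob.
by congr (cdiff _ _ _); field.
Qed.
End Moebius.

(** * Mean values on circles and the Schwarz lemma *)

Section CircleMean.
Variable R : realType.
Implicit Types (F : R[i] -> R[i]) (u v t r : R).

(** [circ (expR u) v] is exp (u + i v): in these coordinates annuli about 0 become rectangles and
    circles become vertical segments of length 2 pi. *)
Definition circ r v : R[i] := (r * cos v) +i* (r * sin v).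

Lemma cmod_circ r v : cmod (circ r v) = `|r|.
Proof.
rewrite cmodE /= !exprMn -mulrDr (_ : cos v ^+ 2 + sin v ^+ 2 = 1) ?cos2Dsin2//.
by rewrite mulr1 sqrtr_sqr.
Qed.

Lemma circ_per r v : circ r (v + 2 * pi) = circ r v.
Proof.
have -> : v + 2 * pi = v + pi *+ 2 by rewrite mulr_natl.
by rewrite /circ cosD2pi sinD2pi.
Qed.

Lemma is_derive_err (f : R -> R) x d : is_derive x (1:R) f d -> forall e, 0 < e ->
  exists2 r, 0 < r & forall y, `|y - x| < r -> `|f y - f x - d * (y - x)| <= e * `|y - x|.
Proof.
move=> Hf e e0.
have [Hd Hv] := Hf; move: Hd; rewrite /derivable.
move=> /(@cvgP _ _ _); rewrite -/(derive f x 1) => H.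
have : h^-1 *: (f (h *: (1:R) + x) - f x) @[h --> 0^'] --> d by rewrite -Hv.
move/cvgrPdist_le => /(_ e e0); rewrite near_withinE => /nbhs_ballP[r /= r0 K].
exists r => // y yx; have [->|yx0] := eqVneq y x; first by rewrite !subrr mulr0 subr0 normr0 mulr0.
have h0 : y - x != 0 by rewrite subr_eq0.
have := K (y - x); rewrite /ball /= sub0r normrN => /(_ yx h0).
rewrite /GRing.scale /= mulr1 subrK distrC => L.
have -> : f y - f x - d * (y - x) = ((y - x)^-1 * (f y - f x) - d) * (y - x) by field.
by rewrite normrM ler_wpM2r.
Qed.

Lemma expi_err e : 0 < e -> exists2 d : R, 0 < d & forall s t, `|s| < d -> `|t| < d ->
  cmod (circ (expR s) t - 1 - (s +i* t)) <= e * (`|s| + `|t|).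
Proof.
move=> e0; have e6 : 0 < Num.min (e / 6) 1 by rewrite lt_min ltr01 divr_gt0.
have [d1 d10 H1] := is_derive_err (is_derive_expR (0:R)) e6.
have [d2 d20 H2] := is_derive_err (is_derive_cos (0:R)) e6.
have [d3 d30 H3] := is_derive_err (is_derive_sin (0:R)) e6.
exists (Num.min (Num.min d1 (e / 12)) (Num.min (Num.min d2 d3) (2^-1))) => [|s t].
  by rewrite !lt_min d10 d20 d30 invr_gt0 divr_gt0 //=.
rewrite !lt_min => /andP[/andP[s1 s5] /andP[/andP[s2 s3] s4]] /andP[/andP[t1 t5] /andP[/andP[t2 t3] t4]].
have := H1 s; have := H2 t; have := H3 t.
rewrite !subr0 expR0 cos0 sin0 !mul1r oppr0 mul0r !subr0.
move=> /(_ t3) h3 /(_ t2) h2 /(_ s1) h1; rewrite addr0 in h3.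
have [m1 m2] : Num.min (e / 6) 1 <= e / 6 /\ Num.min (e / 6) 1 <= 1.
  by split; rewrite ge_min lexx ?orbT.
set m := Num.min (e / 6) 1 in e6 h1 h2 h3 m1 m2.
apply: le_trans (cmod_le_ReIm _) _.
rewrite /circ /=.
have as0 := normr_ge0 s; have at0 := normr_ge0 t.
have e2 : `|expR s - 1| <= 2 * `|s|.
  have -> : expR s - 1 = (expR s - 1 - s) + s by ring.
  by apply: le_trans (ler_normD _ _) _; nra.
have e3 : `|expR s| <= 2.
  have -> : expR s = (expR s - 1) + 1 by ring.
  by apply: le_trans (ler_normD _ _) _; rewrite normr1; lra.
have -> : expR s * cos t - 1 - s = (expR s - 1 - s) + expR s * (cos t - 1) by ring.
have -> : expR s * sin t - 0 - t = (expR s - 1) * (sin t - t) + (expR s - 1) * t + (sin t - t) by ring.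
have n1 := ler_normD (expR s - 1 - s) (expR s * (cos t - 1)).
have n2 := ler_normD ((expR s - 1) * (sin t - t) + (expR s - 1) * t) (sin t - t).
have n3 := ler_normD ((expR s - 1) * (sin t - t)) ((expR s - 1) * t).
rewrite !normrM in n1 n2 n3.
have k1 : `|expR s| * `|cos t - 1| <= 2 * (m * `|t|) by apply: ler_pM.
have e4 : `|expR s - 1| <= 1 by lra.
have k2 : `|expR s - 1| * `|sin t - t| <= 1 * (m * `|t|). by apply: ler_pM.
have k3 : `|expR s - 1| * `|t| <= e / 6 * `|t| by apply: ler_wpM2r => //; lra.
have k4 : m * `|t| <= e / 6 * `|t| by apply: ler_wpM2r.
have k5 : m * `|s| <= e / 6 * `|s| by apply: ler_wpM2r.
have := mulr_ge0 (ltW e0) at0; have := mulr_ge0 (ltW e0) as0; lra.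
Qed.

Lemma circ_expD u v s t : circ (expR (u + s)) (v + t) = circ (expR u) v * circ (expR s) t.
Proof.
by rewrite /circ expRD cosD sinD; apply/eqP; rewrite eq_complex /=; apply/andP; split; apply/eqP; ring.
Qed.

(** By the chain rule F (exp (u + i v)) has complex derivative k = c z, and Cauchy-Riemann makes Re
    k the common coefficient of Re F in u and of Im F in v. The closed form is the imaginary part of
    F dz / z. *)
Lemma cdiff_exp_closed F u v c : cdiff F (circ (expR u) v) c ->
  closed_at (fun u v => Re (F (circ (expR u) v))) (fun u v => Im (F (circ (expR u) v))) u v.
Proof.
move=> HF; set z := circ (expR u) v in HF *; pose k := c * z.
exists (Re k), (- Im k), (Im k) => e e0.
have z0 : z != 0 by rewrite -cmod_eq0 cmod_circ normr_eq0 gt_eqF ?expR_gt0.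
have zp := cmod_gt0 z0; have c0 := cmod_ge0 c.
have e2 : 0 < e / 4 / cmod z by rewrite !divr_gt0.
have e3 : 0 < Num.min 1 (e / 2 / (cmod z * (1 + cmod c))).
  by rewrite lt_min ltr01 !divr_gt0 // mulr_gt0 //; lra.
have [d1 d10 H1] := HF _ e2; have [d2 d20 H2] := expi_err e3.
exists (Num.min d2 (d1 / (4 * cmod z))) => [|x y]; first by rewrite lt_min d20 divr_gt0 // mulr_gt0.
rewrite !lt_min => /andP[x1 x2] /andP[y1 y2].
set s := x - u in x1 x2 *; set t := y - v in y1 y2 *.
have {H2} h2 := H2 s t x1 y1.
pose w := circ (expR x) y.
have wE : w = z * circ (expR s) t by rewrite /z -circ_expD /s /t !subrKC.
set m := Num.min _ _ in e3 h2.
have [m1 m2] : m <= 1 /\ m <= e / 2 / (cmod z * (1 + cmod c)) by split; rewrite ge_min lexx ?orbT.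
have n0 : 0 <= `|s| + `|t| by rewrite addr_ge0.
have nst : cmod (s +i* t) <= `|s| + `|t| by exact: cmod_le_ReIm.
have wz : cmod (w - z) <= cmod z * (2 * (`|s| + `|t|)).
  have -> : w - z = z * ((circ (expR s) t - 1 - (s +i* t)) + (s +i* t)) by rewrite wE; ring.
  rewrite cmodM ler_wpM2l ?(ltW zp) //; apply: le_trans (cmodD _ _) _.
  have : m * (`|s| + `|t|) <= 1 * (`|s| + `|t|) by rewrite ler_wpM2r.
  lra.
have wd : cmod (w - z) < d1.
  apply: le_lt_trans wz _.
  rewrite !ltr_pdivlMr ?mulr_gt0 // in x2 y2; lra.
have {H1} h1 := H1 w wd.
have K : cmod (F w - F z - k * (s +i* t)) <= e * (`|s| + `|t|).
  have -> : F w - F z - k * (s +i* t) =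
    (F w - F z - c * (w - z)) + c * z * (circ (expR s) t - 1 - (s +i* t)).
    by rewrite wE /k; ring.
  apply: le_trans (cmodD _ _) _; rewrite !cmodM.
  have a1 : e / 4 / cmod z * cmod (w - z) <= e / 4 / cmod z * (cmod z * (2 * (`|s| + `|t|))).
    by rewrite ler_wpM2l // ltW.
  have a2 : e / 4 / cmod z * (cmod z * (2 * (`|s| + `|t|))) = e / 2 * (`|s| + `|t|).
    by field; rewrite gt_eqF.
  have a3 : cmod c * cmod z * cmod (circ (expR s) t - 1 - (s +i* t)) <=
     ((1 + cmod c) * cmod z) * (e / 2 / (cmod z * (1 + cmod c)) * (`|s| + `|t|)).
    apply: ler_pM; rewrite ?mulr_ge0 ?cmod_ge0 //.
      by rewrite ler_wpM2r ?cmod_ge0 //; lra.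
    by apply: le_trans h2 _; rewrite ler_wpM2r.
  have nc : 1 + cmod c != 0 by rewrite gt_eqF //; lra.
  have a4 : ((1 + cmod c) * cmod z) * (e / 2 / (cmod z * (1 + cmod c)) * (`|s| + `|t|)) =
     e / 2 * (`|s| + `|t|) by field; rewrite nc gt_eqF.
  lra.
have KR := le_trans (Re_le_cmod _) K; have KI := le_trans (Im_le_cmod _) K.
rewrite !ReB in KR; rewrite !ImB in KI.
have kR : Re (k * (s +i* t)) = Re k * s - Im k * t by case: (k).
have kI : Im (k * (s +i* t)) = Re k * t + Im k * s by case: (k).
rewrite kR in KR; rewrite kI in KI.
by split; [move: KR|move: KI]; congr (`|_| <= _); rewrite -/w; ring.
Qed.

(** The starting angle is a parameter so that a given point of the circle can be placed inside the
    interval of integration, where [intg_eq0] gives its conclusion. *)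
Definition circle_int F r (a : R) := intg (fun v => Re (F (circ r v))) a (a + 2 * pi).

Lemma pi2_ge0 : 0 <= 2 * pi :> R.
Proof. by rewrite mulr_ge0 // pi_ge0. Qed.

Lemma circle_cont F r (a b : R) : 0 < r ->
  (forall v, exists c, cdiff F (circ r v) c) -> cont_on a b (fun v => Re (F (circ r v))).
Proof.
move=> r0 H v _; have [c Hc] := H v.
rewrite -[in circ r _](lnK r0) in Hc.
have [_ + _ _] := closed_at_cont (cdiff_exp_closed Hc).
by rewrite lnK.
Qed.

Lemma circle_int_cst F (r1 r2 a : R) : 0 < r1 -> r1 <= r2 ->
  (forall z, r1 <= cmod z <= r2 -> exists c, cdiff F z c) -> circle_int F r1 a = circle_int F r2 a.
Proof.
move=> r10 r12 H; have r20 : 0 < r2 by lra.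
have l12 : ln r1 <= ln r2 by rewrite ler_ln ?posrE.
have := @periodic_mean_cst R (fun u v => Re (F (circ (expR u) v)))
  (fun u v => Im (F (circ (expR u) v))) (ln r1) (ln r2) (2 * pi) a l12 pi2_ge0.
rewrite /circle_int !lnK ?posrE //; apply.
  move=> u v ur; have [|c Hc] := H (circ (expR u) v); last exact: cdiff_exp_closed Hc.
  rewrite cmod_circ ger0_norm ?expR_ge0 //.
  by rewrite -[X in X <= _ <= _](lnK r10) -[X in _ <= _ <= X](lnK r20) !ler_expR.
by move=> u v; rewrite circ_per.
Qed.

(** The integral is constant in the radius, so the circle can shrink to 0, where continuity
    identifies the limit. Mere continuity at 0 is what is available for quotients such as F z /
    z. *)
Lemma circle_int_mean F r (a : R) : 0 < r < 1 ->
  (forall z, 0 < cmod z < 1 -> exists c, cdiff F z c) -> ccont F 0 ->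
  circle_int F r a = 2 * pi * Re (F 0).
Proof.
move=> /andP[r0 r1] HF Hc.
have dF s v : 0 < s < 1 -> exists c, cdiff F (circ s v) c.
  by move=> s01; apply: HF; rewrite cmod_circ gtr0_norm //; lra.
apply/eqP; rewrite -subr_eq0 -normr_le0; apply/ler_addgt0Pl => e e0; rewrite addr0.
have p0 := pi2_ge0.
have e1 : 0 < e / (1 + 2 * pi) by rewrite divr_gt0 //; lra.
have [d d0 H] := Hc _ e1.
pose s := Num.min (d / 2) r.
have [s1 s2] : s <= d / 2 /\ s <= r by split; rewrite ge_min lexx ?orbT.
have s0 : 0 < s by rewrite lt_min r0 divr_gt0.
rewrite -(@circle_int_cst F s r a s0 s2); last by move=> z zr; apply: HF; lra.
have -> : 2 * pi * Re (F 0) = intg (fun=> Re (F 0)) a (a + 2 * pi).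
  by rewrite intg_cst; last (by lra); ring.
apply: (@le_trans _ _ (e / (1 + 2 * pi) * (a + 2 * pi - a))).
  apply: intg_near; first by lra.
  - by apply: circle_cont => // v; apply: dF; lra.
  - exact: cont_on_cst.
  - move=> v _; rewrite -ReB; apply: le_trans (Re_le_cmod _) _; apply/ltW/H.
    by rewrite subr0 cmod_circ gtr0_norm //; lra.
rewrite addrAC subrr add0r mulrAC ler_pdivrMr; last by lra.
by rewrite ler_wpM2l //; lra.
Qed.

Lemma circle_int_le F r (a M : R) : 0 < r -> (forall z, cmod z = r -> exists c, cdiff F z c) ->
  (forall z, cmod z = r -> Re (F z) <= M) -> circle_int F r a <= 2 * pi * M.
Proof.
move=> r0 HF FM; have p0 := pi2_ge0.
have cr v : cmod (circ r v) = r by rewrite cmod_circ gtr0_norm.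
have -> : 2 * pi * M = intg (fun=> M) a (a + 2 * pi) by rewrite intg_cst; last (by lra); ring.
apply: intg_le; first by lra.
- by apply: circle_cont => // v; exact: HF.
- exact: cont_on_cst.
- by move=> v _; exact: FM.
Qed.
End CircleMean.

Section Schwarz.
Variable R : realType.
Implicit Types (F f : R[i] -> R[i]) (z w c : R[i]).

Definition holo_disk f := forall z, cmod z < 1 -> exists c, cdiff f z c.
Definition disk_map f := forall z, cmod z < 1 -> cmod (f z) < 1.

(** The quotient F z / z with its singularity at 0 filled in by c, the derivative of F at 0 in all
    uses. *)
Definition slope F c z := if z == 0 then c else F z / z.

Lemma slope_cdiff F c z : holo_disk F -> 0 < cmod z < 1 -> exists k, cdiff (slope F c) z k.
Proof.
move=> HF /andP[z0 z1]; have [a Ha] := HF z z1.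
have zn : z != 0 by rewrite -cmod_eq0 gt_eqF.
exists (a * z^-1 + F z * - z^-2); apply: cdiff_eq z0 _ (cdiffM Ha (cdiffV zn)) => w wz.
rewrite /slope; case: eqP => // w0.
by move: wz; rewrite w0 sub0r cmodN ltxx.
Qed.

Lemma slope_ccont F c : F 0 = 0 -> cdiff F 0 c -> ccont (slope F c) 0.
Proof.
move=> F0 HF e e0; have e2 : 0 < e / 2 by lra.
have [d d0 H] := HF _ e2; exists d => // w wd; rewrite /slope eqxx.
case: eqP => [_|/eqP w0]; first by rewrite subrr cmod0.
have := H w wd; rewrite F0 !subr0.
have -> : F w - c * w = (F w / w - c) * w by field.
rewrite cmodM ler_pM2r ?cmod_gt0 //; lra.
Qed.

Lemma slope_mean F c k r (a : R) : 0 < r < 1 -> holo_disk F -> F 0 = 0 -> cdiff F 0 c ->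
  circle_int (fun z => k * slope F c z) r a = 2 * pi * Re (k * c).
Proof.
move=> r01 HF F0 dF; rewrite circle_int_mean //; first by rewrite /slope eqxx.
  by move=> z /(slope_cdiff c HF)[l Hl]; exists (0 * slope F c z + k * l); exact: cdiffM (cdiff_cst _ _) Hl.
move=> e e0; have k0 := cmod_ge0 k; have e1 : 0 < e / (1 + cmod k) by rewrite divr_gt0 //; lra.
have [d d0 H] := slope_ccont F0 dF e1; exists d => // w /H.
rewrite ltr_pdivlMr; last by lra.
by rewrite -mulrBr cmodM; have := cmod_ge0 (slope F c w - slope F c 0); nra.
Qed.

Lemma Re_mul_conj c : Re (c^* * c) = cmod c ^+ 2.
Proof. by rewrite sqr_cmod; case: c => a b /=; ring. Qed.

Lemma schwarz_deriv F c : holo_disk F -> disk_map F -> F 0 = 0 -> cdiff F 0 c -> cmod c <= 1.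
Proof.
move=> HF DF F0 dF; rewrite leNgt; apply/negP => c1.
have c0 : 0 < cmod c by lra.
(* If |c| > 1, this radius lies strictly between 1 / |c| and 1. Multiplying the slope by the
   conjugate of c makes its mean |c| ^ 2, while its modulus on the circle is at most |c| / r: this
   gives |c| <= 1 / r, a contradiction. *)
pose r : R := (1 + (cmod c)^-1) / 2.
have ci : (cmod c)^-1 < 1 by rewrite invf_lt1.
have ci0 : 0 < (cmod c)^-1 by rewrite invr_gt0.
have r01 : 0 < r < 1 by rewrite /r; lra.
have := slope_mean c^* 0 r01 HF F0 dF; rewrite Re_mul_conj => E.
have : circle_int (fun z => c^* * slope F c z) r 0 <= 2 * pi * (cmod c / r).
  apply: circle_int_le; first by lra.
    move=> z zr; have [|k Hk] := @slope_cdiff F c z HF; first by rewrite zr.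
    by exists (0 * slope F c z + c^* * k); exact: cdiffM (cdiff_cst _ _) Hk.
  move=> z zr; apply: le_trans (ler_norm _) _; apply: le_trans (Re_le_cmod _) _.
  have zn : z != 0 by rewrite -cmod_eq0 zr gt_eqF //; lra.
  rewrite cmodM cmod_conj ler_wpM2l ?cmod_ge0 // /slope (negPf zn) cmodM cmodV zr.
  have : cmod (F z) < 1 by apply: DF; rewrite zr; lra.
  have ri : 0 < r^-1 by rewrite invr_gt0; lra.
  by move=> h; rewrite -[leRHS]mul1r ler_wpM2r ?ltW.
rewrite E ler_pM2l ?mulr_gt0 ?pi_gt0 //.
rewrite ler_pdivlMr; last by lra.
have -> : cmod c ^+ 2 * r = cmod c * (cmod c + 1) / 2 by rewrite /r; field; rewrite gt_eqF.
nra.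
Qed.

(** Moebius maps move z and F z to 0, where the bound is [schwarz_deriv]; the two factors 1 - |.| ^
    2 are their derivatives. *)
Lemma schwarz_pick F z c : holo_disk F -> disk_map F -> cmod z < 1 -> cdiff F z c ->
  cmod c * (1 - cmod z ^+ 2) <= 1 - cmod (F z) ^+ 2.
Proof.
move=> HF DF z1 dF; set b := F z.
have b1 : cmod b < 1 by exact: DF.
have nb1 : cmod (- b) < 1 by rewrite cmodN.
pose H w := mob (- b) (F (mob z w)).
have c01 : cmod (0 : R[i]) < 1 by rewrite cmod0.
have HH w l : cmod w < 1 -> cdiff F (mob z w) l -> cdiff H w
  (((1 - - b * (- b)^*) / (1 + (- b)^* * F (mob z w)) ^+ 2) *
     (l * ((1 - z * z^*) / (1 + z^* * w) ^+ 2))).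
  move=> w1 Hl; apply: (@cdiff_comp _ (F \o mob z) (mob (- b))).
    by apply: cdiff_comp Hl; exact: cdiff_mob.
  by apply: cdiff_mob => //; apply: DF; exact: mob_disk.
have dH : holo_disk H.
  move=> w w1; have [l Hl] := HF _ (mob_disk z1 w1); eexists; exact: HH Hl.
have mH : disk_map H by move=> w w1; apply: mob_disk => //; apply: DF; exact: mob_disk.
have H0 : H 0 = 0 by rewrite /H mob0 mobNr.
have := HH 0 c c01; rewrite mob0 => /(_ dF) /(schwarz_deriv dH mH H0).
have pz : 0 < 1 - cmod z ^+ 2 by rewrite subr_gt0 expr_lt1 // cmod_ge0.
have pb : 0 < 1 - cmod b ^+ 2 by rewrite subr_gt0 expr_lt1 // cmod_ge0.
have e1 (y : R[i]) : 1 - y * y^* = (1 - cmod y ^+ 2)%:C.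
  by rewrite rmorphB rmorph1 /= sqr_cmodC.
rewrite (e1 (- b)) -/b cmodN.
have -> : 1 + (- b)^* * b = (1 - cmod b ^+ 2)%:C by rewrite -e1 rmorphN /=; ring.
rewrite e1 mulr0 addr0 expr1n divr1 !cmodM cmodV exprS expr1 cmodM !cmodR !gtr0_norm //.
have -> : (1 - cmod b ^+ 2) / ((1 - cmod b ^+ 2) * (1 - cmod b ^+ 2)) * (cmod c * (1 - cmod z ^+ 2)) =
  (cmod c * (1 - cmod z ^+ 2)) / (1 - cmod b ^+ 2) by field; rewrite gt_eqF.
by rewrite ler_pdivrMr // mul1r.
Qed.
End Schwarz.

(** * Holomorphic automorphisms of the disk *)

Section FiniteCover.
Variable R : realType.

(** The radius may depend on the center, which yields Lebesgue-number arguments directly. Centers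
    may lie outside [S]. *)
Definition finite_cover (A : choiceType) (d : A -> A -> R) (S : set A) :=
  forall r : A -> R, (forall a, 0 < r a) ->
  exists s : seq A, forall a, S a -> exists2 b, b \in s & d b a < r b.

Lemma min_radius (A : choiceType) (s : seq A) (r : A -> R) : (forall a, 0 < r a) ->
  exists2 m, 0 < m & forall a, a \in s -> m <= r a.
Proof.
move=> r0; elim: s => [|a s [m m0 Hm]]; first by exists 1.
exists (Num.min (r a) m) => [|b]; first by rewrite lt_min r0.
by rewrite inE ge_min => /predU1P[->|/Hm ->]; rewrite ?lexx ?orbT.
Qed.

(** The tube lemma: for fixed a, finitely many centers cover T, and the smallest of their radii
    serves as the radius at a in a cover of S. *)
Lemma finite_cover_prod (A B : choiceType) dA dB (S : set A) (T : set B)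
  (r : A -> B -> R) : finite_cover dA S -> finite_cover dB T -> (forall a b, 0 < r a b) ->
  exists s : seq (A * B), forall a b, S a -> T b ->
    exists2 p, p \in s & dA p.1 a < r p.1 p.2 /\ dB p.2 b < r p.1 p.2.
Proof.
move=> HA HB r0.
have /choice[sB HsB] : forall a, exists s : seq B, forall b, T b -> exists2 b', b' \in s & dB b' b < r a b'.
  by move=> a; exact: HB.
have /choice[m Hm] : forall a, exists m : R, 0 < m /\ forall b, b \in sB a -> m <= r a b.
  by move=> a; have [m m0 Hm] := @min_radius _ (sB a) (r a) (r0 a); exists m.
have [sA HsA] := HA m (fun a => (Hm a).1).
exists [seq (a, b) | a <- sA, b <- sB a] => a b Sa Tb.
have [a' a's aa'] := HsA a Sa; have [b' b's bb'] := HsB a' b Tb.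
exists (a', b'); first by apply/allpairsPdep; exists a', b'.
by split=> //=; apply: lt_le_trans aa' _; exact: (Hm a').2.
Qed.

Lemma compact_open_cover (X : topologicalType) (A : set X) (I : choiceType) (f : I -> set X) :
  compact A -> (forall i, open (f i)) -> (forall x, A x -> exists i, f i x) ->
  exists s : seq I, forall x, A x -> exists2 i, i \in s & f i x.
Proof.
move=> /compact_near_coveringP cA fo fA.
(* The filter of finite subfamilies ordered by inclusion: a property holds eventually when it holds
   for all lists containing some given one. *)
pose F : set_system (seq I) := [set U : set (seq I) | exists s0 : seq I, forall s : seq I, {subset s0 <= s} -> U s].
have FF : Filter F.
  split; first by exists [::].
    move=> P Q [s1 H1] [s2 H2]; exists (s1 ++ s2) => s Hs; split.
      by apply: H1 => i is1; apply: Hs; rewrite mem_cat is1.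
    by apply: H2 => i is2; apply: Hs; rewrite mem_cat is2 orbT.
  by move=> P Q PQ [s H]; exists s => s' /H /PQ.
have := cA (seq I) F (fun (s : seq I) x => exists2 i, i \in s & f i x) FF.
case.
  move=> x /fA[i fix_]; exists (f i, [set s : seq I | i \in s]) => /=.
    split; first by apply: open_nbhs_nbhs; split.
    by exists [:: i] => s; apply; rewrite inE.
  by move=> [y s] /= [fy is_]; exists i.
by move=> s /(_ s (fun _ h => h)) H; exists s => x /H.
Qed.

Lemma finite_cover_compact (T : metricType R) (S : set T) : compact S ->
  finite_cover (@mdist R T) S.
Proof.
move=> cS r r0.
have := @compact_open_cover T S T (fun x => [set y | mdist x y < r x]) cS.
apply.
- move=> x; rewrite openE => y /= xy; rewrite /interior.
  apply/nbhs_ballP; exists (r x - mdist x y) => /=; first by rewrite subr_gt0.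
  move=> z; rewrite ballEmdist => /= yz /=.
  by apply: le_lt_trans (metric_triangle _ y _) _; rewrite addrC -ltrBrDr.
- by move=> x Sx; exists x => //=; rewrite mdistxx.
Qed.

Lemma finite_cover_segment (a b : R) : finite_cover (fun x y => `|x - y|) `[a, b].
Proof.
move=> r r0.
have := @compact_open_cover R _ R (fun x => [set y | `|x - y| < r x]) (@segment_compact R a b).
apply.
- move=> x; rewrite openE => y /= xy; rewrite /interior.
  apply/nbhs_ballP; exists (r x - `|x - y|) => /=; first by rewrite subr_gt0.
  move=> z; rewrite /ball /= => yz.
  by apply: le_lt_trans (ler_distD y _ _) _; rewrite addrC -ltrBrDr.
- by move=> x Sx; exists x => //=; rewrite subrr normr0.
Qed.

Lemma finite_cover_disk (rho : R) :
  finite_cover (fun z w : R[i] => cmod (z - w)) [set z | cmod z <= rho].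
Proof.
move=> r r0.
(* A center outside the closed disk gets a radius so small that its cell misses the disk; the halves
   add up over the two coordinates. *)
pose r' x y := let z := x +i* y in if cmod z <= rho then r z / 2 else (cmod z - rho) / 2.
have r'0 x y : 0 < r' x y.
  by rewrite /r' /=; case: (leP (cmod _) rho) => h; rewrite divr_gt0 // subr_gt0.
have [s Hs] := finite_cover_prod (finite_cover_segment (- rho) rho) (finite_cover_segment (- rho) rho) r'0.
exists [seq p.1 +i* p.2 | p <- s] => z /= zr.
have [||p ps [p1 p2]] := Hs (Re z) (Im z).
- by rewrite /= in_itv /= -ler_norml (le_trans (Re_le_cmod _)).
- by rewrite /= in_itv /= -ler_norml (le_trans (Im_le_cmod _)).
have d : cmod ((p.1 +i* p.2) - z) < r' p.1 p.2 + r' p.1 p.2.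
  apply: le_lt_trans (cmod_le_ReIm _) _.
  by rewrite ReB ImB /= ltrD.
exists (p.1 +i* p.2); first by apply/mapP; exists p.
move: d; rewrite /r' /=; case: (leP (cmod _) rho) => h; first by lra.
by have := cmod_subr_ge (p.1 +i* p.2) z; lra.
Qed.
End FiniteCover.

Section DiskAut.
Variable R : realType.
Implicit Types (F f g : R[i] -> R[i]) (z w c : R[i]).

Lemma is_derive_of_err (f : R -> R) (x d : R) :
  (forall e, 0 < e -> exists2 r, 0 < r & forall y, `|y - x| < r ->
     `|f y - f x - d * (y - x)| <= e * `|y - x|) -> is_derive x (1:R) f d.
Proof.
move=> H.
have K : h^-1 *: (f (h *: (1:R) + x) - f x) @[h --> 0^'] --> d.
  apply/cvgrPdist_le => e /H[r r0 Hr]; rewrite near_withinE; apply/nbhs_ballP; exists r => //= h.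
  rewrite /ball /= sub0r normrN => hr h0.
  rewrite /GRing.scale /= mulr1.
  have := Hr (h + x); rewrite addrK => /(_ hr).
  have -> : f (h + x) - f x - d * h = (d - h^-1 * (f (h + x) - f x)) * (- h) by field.
  by rewrite normrM normrN ler_pM2r ?normr_gt0.
by split; [exact: cvgP K|apply: cvg_lim K; exact: Rhausdorff].
Qed.

(** The factor k selects a direction in the target, so that the real mean value theorem applies to
    complex-valued functions. *)
Lemma ray_derive F x e k c (s : R) : cdiff F (x + s%:C * e) c ->
  is_derive s (1:R) (fun s : R => Re (k * F (x + s%:C * e))) (Re (k * c * e)).
Proof.
move=> HF; apply: is_derive_of_err => eps eps0.
have k0 := cmod_ge0 k; have e0 := cmod_ge0 e.
have e1 : 0 < eps / ((1 + cmod k) * (1 + cmod e)) by rewrite divr_gt0 // mulr_gt0 //; lra.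
have [d d0 H] := HF _ e1.
exists (d / (1 + cmod e)) => [|y]; first by rewrite divr_gt0 //; lra.
rewrite ltr_pdivlMr => [yd|]; last by lra.
have E : x + y%:C * e - (x + s%:C * e) = (y - s)%:C * e by rewrite rmorphB /=; ring.
have := H (x + y%:C * e); rewrite E cmodM cmodR.
have := normr_ge0 (y - s) => n0 /(_ _) h.
have {}h := h ltac:(nra).
have -> : Re (k * F (x + y%:C * e)) - Re (k * F (x + s%:C * e)) - Re (k * c * e) * (y - s) =
   Re (k * (F (x + y%:C * e) - F (x + s%:C * e) - c * ((y - s)%:C * e))).
  have -> : k * (F (x + y%:C * e) - F (x + s%:C * e) - c * ((y - s)%:C * e)) =
     k * F (x + y%:C * e) - k * F (x + s%:C * e) - (k * c * e) * (y - s)%:C by ring.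
  rewrite !ReB; congr (_ - _ - _).
  by case: (k * c * e) => u v /=; ring.
apply: le_trans (Re_le_cmod _) _; rewrite cmodM.
have -> : eps * `|y - s| = (1 + cmod k) * (eps / ((1 + cmod k) * (1 + cmod e)) * (`|y - s| * (1 + cmod e))).
  by field; apply/andP; split; rewrite gt_eqF //; lra.
apply: ler_pM; rewrite ?cmod_ge0 //; first by lra.
apply: le_trans h _; rewrite ler_wpM2l ?(ltW e1) // ler_wpM2l //; lra.
Qed.

Lemma ray_decompose w : exists2 e, cmod e = 1 & w = (cmod w)%:C * e.
Proof.
have [k k1 kw] := unit_direction w; exists k^* ; rewrite ?cmod_conj //.
rewrite -kw mulrAC -sqr_cmodC k1 expr1n mul1r //.
Qed.

(** The mean value argument bounds F only to first order at the center. The Schwarz-Pick inequality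
    transports that bound to each point of the ray from 0 to w, along which it is integrated. *)
Lemma schwarz_lemma F w : holo_disk F -> disk_map F -> F 0 = 0 -> cmod w < 1 ->
  cmod (F w) <= cmod w.
Proof.
move=> HF DF F0 w1; have [w0|wn0] := eqVneq w 0; first by rewrite w0 F0 lexx.
have wp := cmod_gt0 wn0.
have /choice[dF HdF] : forall z, exists c, cmod z < 1 -> cdiff F z c.
  move=> z; case: (boolP (cmod z < 1)) => [z1|_]; last by exists 0.
  by have [c Hc] := HF z z1; exists c.
have [e e1 we] := ray_decompose w; have [k k1 kw] := unit_direction (F w).
pose psi (s : R) := Re (k * F (0 + s%:C * e)).
pose dpsi (s : R) := Re (k * dF (s%:C * e) * e).
have seE (s : R) : 0 <= s -> cmod (s%:C * e) = s by move=> s0; rewrite cmodM cmodR e1 mulr1 ger0_norm.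
have dp (s : R) : 0 <= s < 1 -> is_derive s (1:R) psi (dpsi s).
  move=> s01; apply: ray_derive; rewrite add0r; apply: HdF; rewrite seE; lra.
have psiF (s : R) : `|psi s| <= cmod (F (s%:C * e)).
  by apply: le_trans (Re_le_cmod _) _; rewrite cmodM k1 mul1r add0r.
have psi1 (s : R) : 0 <= s < 1 -> `|psi s| < 1.
  by move=> s01; apply: le_lt_trans (psiF s) _; apply: DF; rewrite seE; lra.
have dpsi_le (s : R) : 0 <= s < 1 -> dpsi s * (1 - s ^+ 2) <= 1 - psi s ^+ 2.
  move=> s01; have sx : cmod (s%:C * e) = s by apply: seE; lra.
  have z1 : cmod (s%:C * e) < 1 by lra.
  have := schwarz_pick HF DF z1 (HdF _ z1); rewrite sx.
  have : dpsi s <= cmod (dF (s%:C * e)).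
    apply: le_trans (ler_norm _) _; apply: le_trans (Re_le_cmod _) _.
    by rewrite !cmodM k1 e1 mul1r mulr1.
  have : psi s ^+ 2 <= cmod (F (s%:C * e)) ^+ 2.
    by rewrite -(real_normK (num_real (psi s))) lerXn2r ?nnegrE ?cmod_ge0.
  have : 0 <= 1 - s ^+ 2 by nra.
  nra.
(* The exponential of the hyperbolic length of [0, psi s] minus that of [0, s]. Schwarz-Pick makes
   its derivative nonpositive, and D 0 = 1, so D <= 1 at the end of the ray, which says psi <=
   |w|. *)
pose D (s : R) := (1 + psi s) * (1 - s) * ((1 - psi s) * (1 + s))^-1.
pose dD (s : R) := 2 * (dpsi s * (1 - s ^+ 2) - (1 - psi s ^+ 2)) / ((1 - psi s) * (1 + s)) ^+ 2.
have den (s : R) : 0 <= s < 1 -> 0 < (1 - psi s) * (1 + s).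
  by move=> s01; have := psi1 s s01; rewrite ltr_norml => /andP[]; nra.
have HD (s : R) : 0 <= s <= cmod w -> is_derive s (1:R) D (dD s).
  move=> sw; have s01 : 0 <= s < 1 by lra.
  have := dp s s01 => dps; have dn : (1 - psi s) * (1 + s) != 0 by rewrite gt_eqF ?den.
  rewrite /D; apply: is_derive_eq.
  rewrite /dD; clear dps; move: (psi s) (dpsi s) dn => x y.
  rewrite mulf_eq0 negb_or => /andP[d1 d2]; rewrite /= /GRing.scale /=; field.
  by rewrite d1 d2.
have [x xw E] := mean_value wp HD.
have psi0 : psi 0 = 0 by rewrite /psi rmorph0 mul0r addr0 F0 mulr0.
have psiw : psi (cmod w) = cmod (F w) by rewrite /psi add0r -we kw.
have D0 : D 0 = 1 by rewrite /D psi0 subr0 !addr0 !mul1r invr1.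
have x01 : 0 <= x < 1 by lra.
have dDx : dD x <= 0.
  have := dpsi_le x x01 => h.
  by rewrite /dD pmulr_lle0 ?invr_gt0 ?exprn_gt0 ?den //; lra.
have w01 : 0 <= cmod w < 1 by rewrite cmod_ge0.
have : D (cmod w) <= 1 by rewrite D0 in E; nra.
by rewrite /D ler_pdivrMr ?den // psiw; nra.
Qed.

Lemma zero_deriv_cst F w : (forall z, cmod z < 1 -> cdiff F z 0) -> cmod w < 1 -> F w = F 0.
Proof.
move=> HF w1; apply/eqP; rewrite -subr_eq0 -cmod_eq0.
have [k k1 kw] := unit_direction (F w - F 0).
have H (s : R) : 0 <= s <= 1 ->
    is_derive s (1:R) (fun s : R => Re (k * F (0 + s%:C * w))) (Re (k * 0 * w)).
  move=> s01; apply: ray_derive; apply: HF; rewrite add0r cmodM cmodR ger0_norm; last by lra.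
  by have := cmod_ge0 w; nra.
have [s _] := mean_value ltr01 H.
rewrite !add0r rmorph1 rmorph0 mul0r mul1r mulr0 mul0r -ReB -mulrBr kw.
by rewrite [Re 0]/= mul0r /= => ->.
Qed.

(** With G = F z / z, the mean value property of c / G together with properness forces |c| >= 1.
    Then G attains in mean the maximal modulus that the Schwarz lemma permits, so it is constant. *)
Lemma rotation_of_proper F c : holo_disk F -> disk_map F -> F 0 = 0 -> cdiff F 0 c -> c != 0 ->
  (forall z, cmod z < 1 -> z != 0 -> F z != 0) ->
  (forall e : R, 0 < e -> exists2 r : R, r < 1 & forall z, r < cmod z < 1 -> 1 - e < cmod (F z)) ->
  cmod c = 1 /\ forall z, cmod z < 1 -> F z = c * z.
Proof.
move=> HF DF F0 dF c0 Fn0 prop; have cp := cmod_gt0 c0.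
have c_le1 := schwarz_deriv HF DF F0 dF.
pose G := slope F c; pose H z := c * (G z)^-1.
have Gn0 z : cmod z < 1 -> G z != 0.
  move=> z1; rewrite /G /slope; case: ifPn => // zn.
  by rewrite mulf_neq0 ?invr_eq0 // Fn0.
have dG z : 0 < cmod z < 1 -> exists k, cdiff G z k by exact: slope_cdiff.
have dH z : 0 < cmod z < 1 -> exists k, cdiff H z k.
  move=> z01; have [k Hk] := dG z z01; have z1 : cmod z < 1 by lra.
  eexists; exact: (cdiffM (cdiff_cst c z) (cdiff_comp Hk (cdiffV (Gn0 z z1)))).
have G0 : G 0 = c by rewrite /G /slope eqxx.
have cH : ccont H 0.
  move=> e e0; have e1 : 0 < Num.min (cmod c / 2) (e * cmod c / 4).
    by rewrite lt_min !divr_gt0 // mulr_gt0.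
  have [d d0 Hd] := slope_ccont F0 dF e1; exists (Num.min d 1) => [|w]; first by rewrite lt_min d0 ltr01.
  rewrite lt_min => /andP[/Hd]; rewrite subr0 lt_min -/G G0 => /andP[h1 h2] w1.
  have Gw : cmod c / 2 < cmod (G w) by have := cmod_subr_ge c (G w); rewrite cmodBC; lra.
  have gn := Gn0 w w1.
  have -> : H w - H 0 = (c - G w) / G w by rewrite /H G0; field; rewrite gn c0.
  rewrite cmodM cmodV ltr_pdivrMr; last by lra.
  rewrite cmodBC; apply: lt_trans h2 _.
  have h3 : e * (cmod c / 2) < e * cmod (G w) by rewrite ltr_pM2l.
  have := mulr_gt0 e0 cp; lra.
(* [H] has value 1 at 0, and on circles near the boundary its modulus is at most |c| / (1 - e');
   hence 1 - e' <= |c|. *)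
have c_ge1 : 1 <= cmod c.
  apply/ler_addgt0Pl => e e0.
  pose e' := Num.min (e / 2) (2^-1).
  have [e'1 e'2] : e' <= e / 2 /\ e' <= 2^-1 by split; rewrite ge_min lexx ?orbT.
  have e'0 : 0 < e' by rewrite lt_min invr_gt0 !divr_gt0 // ltr0n.
  have [r r1 Hr] := prop e' e'0.
  pose s := Num.max ((1 + r) / 2) (2^-1).
  have [s1 [s2 s3]] : (1 + r) / 2 <= s /\ 2^-1 <= s /\ s < 1.
    by rewrite !le_max !lexx orbT gt_max; split=> //; split=> //; apply/andP; split; lra.
  have s01 : 0 < s < 1 by lra.
  have p0 := pi_gt0 R.
  have := @circle_int_mean R H s 0 s01 dH cH; rewrite {2}/H G0 divff //= => E.
  have : circle_int H s 0 <= 2 * pi * (cmod c / (1 - e')).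
    apply: circle_int_le; first by lra.
      by move=> z zs; apply: dH; rewrite zs.
    move=> z zs; apply: le_trans (ler_norm _) _; apply: le_trans (Re_le_cmod _) _.
    have zn : z != 0 by rewrite -cmod_eq0 zs gt_eqF //; lra.
    have Fz := Hr z ltac:(lra).
    rewrite cmodM ler_wpM2l ?cmod_ge0 // cmodV lef_pV2 ?posrE; last 2 first.
      by apply: cmod_gt0; apply: Gn0; lra.
      by lra.
    rewrite /G /slope (negPf zn) cmodM cmodV ler_pdivlMr; last by rewrite zs; lra.
    by rewrite zs; nra.
  rewrite E ler_pM2l; last by lra.
  rewrite ler_pdivlMr; last by lra.
  lra.
have c1 : cmod c = 1 by lra.
split=> // z z1.
have [->|zn] := eqVneq z 0; first by rewrite F0 mulr0.
have zp := cmod_gt0 zn.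
suff Gz : c^* * G z = 1.
  have cc : c * c^* = 1 by rewrite -sqr_cmodC c1 expr1n.
  have -> : F z = G z * z by rewrite /G /slope (negPf zn) divfK.
  by rewrite -[G z]mul1r -cc -(mulrA c) Gz mulr1.
pose r := cmod z.
have r01 : 0 < r < 1 by rewrite /r zp.
(* Nonnegative by the Schwarz lemma and of integral 0 by the mean value property, hence 0 at the
   angle of z. A number of modulus at most 1 with real part 1 is 1. *)
pose u v := 1 - Re (c^* * G (circ r v)).
have [e e1 ze] := ray_decompose z; have [t et] := unit_angle e1.
have zt : z = circ r t.
  by rewrite {1}ze et /circ /r; apply/eqP; rewrite eq_complex /=; apply/andP; split; apply/eqP; ring.
have GR w : 0 < cmod w < 1 -> cmod (c^* * G w) <= 1.
  move=> w01; have wn : w != 0 by rewrite -cmod_eq0 gt_eqF //; lra.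
  rewrite cmodM cmod_conj c1 mul1r /G /slope (negPf wn) cmodM cmodV ler_pdivrMr; last by lra.
  by rewrite mul1r; apply: schwarz_lemma => //; lra.
have cr v : cmod (circ r v) = r by rewrite cmod_circ gtr0_norm.
have dGc v : exists k, cdiff (fun z => c^* * G z) (circ r v) k.
  have [|k Hk] := dG (circ r v); first by rewrite cr.
  eexists; exact: cdiffM (cdiff_cst _ _) Hk.
have pp := pi_gt0 R.
have Gc : cont_on (t - pi) (t - pi + 2 * pi) (fun v => Re (c^* * G (circ r v))).
  by apply: (@circle_cont R (fun z => c^* * G z)); [lra|exact: dGc].
have uc : cont_on (t - pi) (t - pi + 2 * pi) u.
  by move=> v vr; apply: cvgB; [exact: cvg_cst|exact: Gc].
have u0 v : 0 <= u v.
  rewrite subr_ge0; apply: le_trans (ler_norm _) _; apply: le_trans (Re_le_cmod _) _.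
  by apply: GR; rewrite cr.
have Iu : intg u (t - pi) (t - pi + 2 * pi) = 0.
  have tp : t - pi <= t - pi + 2 * pi by lra.
  have := @intg_comb R (fun=> 1) _ _ _ 1 (-1) tp (@cont_on_cst R _ _ _) Gc.
  rewrite (_ : (fun x => 1 * 1 + -1 * Re (c^* * G (circ r x))) = u); last first.
    by apply/funext => v; rewrite /u; ring.
  have := slope_mean c^* (t - pi) r01 HF F0 dF.
  rewrite /circle_int Re_mul_conj c1 -/G => -> ->.
  by rewrite intg_cst //; ring.
have := intg_eq0 uc (fun x _ => u0 x) Iu (x := t) ltac:(lra).
rewrite /u -zt => /eqP; rewrite subr_eq0 eq_sym => /eqP Rz.
have := GR z r01; rewrite -(@ler_pXn2r _ 2) ?nnegrE ?cmod_ge0 // sqr_cmod Rz expr1n gerDl => Iz.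
have /eqP : Im (c^* * G z) ^+ 2 = 0 by apply/eqP; rewrite eq_le Iz sqr_ge0.
rewrite sqrf_eq0 => /eqP Iz0.
by apply/eqP; rewrite eq_complex Rz Iz0 /= !eqxx.
Qed.

Lemma ccont_comp F G z : ccont F z -> ccont G (F z) -> ccont (G \o F) z.
Proof.
move=> HF HG e /HG[d d0 H]; have [d' d'0 H'] := HF d d0.
by exists d' => // w /H' /H.
Qed.

Lemma ccont_disk_bound F (rho : R) : (forall z, cmod z <= rho -> ccont F z /\ cmod (F z) < 1) ->
  exists2 r : R, r < 1 & forall z, cmod z <= rho -> cmod (F z) <= r.
Proof.
move=> H.
have /choice[d Hd] : forall z, exists d : R, 0 < d /\ (cmod z <= rho -> forall w, cmod (w - z) < d ->
    cmod (F w) < (1 + cmod (F z)) / 2).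
  move=> z; case: (leP (cmod z) rho) => zr; last by exists 1; split.
  have [cF F1] := H z zr; have e0 : 0 < (1 - cmod (F z)) / 2 by lra.
  have [d d0 K] := cF _ e0; exists d; split=> // _ w /K.
  by have := cmod_subr_ge (F w) (F z); lra.
pose d' z := if cmod z <= rho then d z else (cmod z - rho).
have d'0 z : 0 < d' z by rewrite /d'; case: (leP (cmod _) rho) => h; [exact: (Hd z).1|lra].
have [s Hs] := @finite_cover_disk R rho _ d'0.
have [r r1 Hr] : exists2 r : R, r < 1 & forall z, z \in s -> cmod z <= rho -> (1 + cmod (F z)) / 2 <= r.
  elim: {Hs} s => [|z s [r r1 Hr]]; first by exists 0.
  case: (leP (cmod z) rho) => zr; last first.
    by exists r => // w; rewrite inE => /predU1P[->|/Hr//]; lra.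
  exists (Num.max r ((1 + cmod (F z)) / 2)) => [|w].
    by have [_ ?] := H z zr; rewrite gt_max r1 /=; lra.
  by rewrite inE le_max => /predU1P[-> _|/Hr h /h ->]; rewrite ?lexx ?orbT.
exists r => // z zr; have [w ws] := Hs z zr; rewrite /d'.
case: (leP (cmod _) rho) => wr wd.
  apply: le_trans (Hr w ws wr); apply/ltW; apply: (Hd w).2 => //.
  by rewrite cmodBC.
by have := cmod_subr_ge w z; lra.
Qed.

Lemma ccont_mob a z : cmod a < 1 -> cmod z < 1 -> ccont (mob a) z.
Proof. by move=> a1 z1; exact: cdiff_ccont (cdiff_mob a1 z1). Qed.

Definition disk_homeo f g := [/\ disk_map f, disk_map g,
  forall z, cmod z < 1 -> g (f z) = z, forall z, cmod z < 1 -> f (g z) = z &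
  forall z, cmod z < 1 -> ccont g z].

(** Properness comes from the inverse: the continuous G maps the closed disk of radius 1 - e into a
    disk of radius r < 1, so points beyond r are sent beyond 1 - e. Injectivity excludes further
    zeros. *)
Lemma rotation_of_homeo F G c : disk_homeo F G -> holo_disk F -> F 0 = 0 -> cdiff F 0 c -> c != 0 ->
  cmod c = 1 /\ forall z, cmod z < 1 -> F z = c * z.
Proof.
move=> [DF DG GF FG cG] HF F0 dF c0.
have c01 : cmod (0 : R[i]) < 1 by rewrite cmod0.
apply: (rotation_of_proper HF DF F0 dF c0) => [z z1|e e0].
  apply: contra_neq => Fz0; rewrite -(GF z) // Fz0 -{1}F0 GF //.
have [r r1 Hr] : exists2 r : R, r < 1 & forall z, cmod z <= 1 - e -> cmod (G z) <= r.
  by apply: ccont_disk_bound => z ze; split; [apply: cG|apply: DG]; lra.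
exists r => // z /andP[rz z1]; rewrite ltNge; apply/negP => /Hr.
by rewrite GF //; lra.
Qed.

(* The inverse is only assumed continuous, so [f'] could a priori vanish somewhere.  It does not vanish
   identically, and one point [a] with [f' a != 0] suffices: in Moebius coordinates centered at [a]
   and [f a], the mean value property of [f z / z] and of its inverse force a rotation. *)
Theorem disk_automorphism f g : disk_homeo f g -> holo_disk f ->
  exists2 c, cmod c = 1 & forall z, cmod z < 1 -> f z = mob (f 0) (c * z).
Proof.
move=> fg Hf; have [Df Dg gf fgK cg] := fg.
have c01 : cmod (0 : R[i]) < 1 by rewrite cmod0.
have nz x : cmod x < 1 -> 1 - x * x^* != 0.
  move=> x1; rewrite -sqr_cmodC -[1]/(1%:C) -rmorphB/= fmorph_eq0 subr_eq0 eq_sym.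
  by rewrite lt_eqF // expr_lt1 // cmod_ge0.
have conjugate a b c : cmod a < 1 -> cmod b < 1 -> cdiff f a c -> c != 0 -> b = f a ->
   exists2 k, cmod k = 1 & forall z, cmod z < 1 -> f (mob a z) = mob b (k * z).
  move=> a1 b1 dc c0 bE.
  have na : cmod (- a) < 1 by rewrite cmodN.
  have nb : cmod (- b) < 1 by rewrite cmodN.
  pose F z := mob (- b) (f (mob a z)); pose G z := mob (- a) (g (mob b z)).
  have mobKN (x z : R[i]) : cmod x < 1 -> cmod z < 1 -> mob x (mob (- x) z) = z.
    by move=> x1 z1; have := @mobK R (- x) z; rewrite opprK cmodN; apply.
  have FGh : disk_homeo F G.
    split.
    - by move=> z z1; apply: mob_disk => //; apply: Df; exact: mob_disk.
    - by move=> z z1; apply: mob_disk => //; apply: Dg; exact: mob_disk.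
    - move=> z z1; have m1 := mob_disk a1 z1.
      by rewrite /G /F mobKN ?gf ?mobK //; exact: Df.
    - move=> z z1; have m1 := mob_disk b1 z1.
      by rewrite /G /F mobKN ?fgK ?mobK //; exact: Dg.
    - move=> z z1; have m1 := mob_disk b1 z1.
      apply: (@ccont_comp (g \o mob b) (mob (- a))).
        by apply: ccont_comp; [exact: ccont_mob|exact: cg].
      by apply: ccont_mob => //; exact: Dg.
  have dF z k : cmod z < 1 -> cdiff f (mob a z) k ->
    cdiff F z (((1 - - b * (- b)^*) / (1 + (- b)^* * f (mob a z)) ^+ 2) *
     (k * ((1 - a * a^*) / (1 + a^* * z) ^+ 2))).
    move=> z1 Hk; have m1 := mob_disk a1 z1.
    apply: (@cdiff_comp _ (f \o mob a) (mob (- b))).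
      by apply: cdiff_comp Hk; exact: cdiff_mob.
    by apply: cdiff_mob => //; apply: Df.
  have HF : holo_disk F.
    move=> z z1; have [k Hk] := Hf _ (mob_disk a1 z1); eexists; exact: dF Hk.
  have F0 : F 0 = 0 by rewrite /F mob0 -bE mobNr.
  have := dF 0 c c01; rewrite mob0 => /(_ dc) dF0.
  have [|k1 Hk] := rotation_of_homeo FGh HF F0 dF0.
    rewrite -bE !mulf_neq0 ?invr_eq0 ?expf_neq0 ?nz // ?mob_den //.
  eexists; first exact: k1.
  move=> z z1; rewrite -Hk // /F mobKN //.
  by apply: Df; exact: mob_disk.
have [a [c [a1 dc c0]]] : exists a c, [/\ cmod a < 1, cdiff f a c & c != 0].
  apply: contrapT => nex.
  have d0 z : cmod z < 1 -> cdiff f z 0.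
    move=> z1; have [c Hc] := Hf z z1; have [<-//|cn] := eqVneq c 0.
    by exfalso; apply: nex; exists z, c.
  have h2 : cmod (2^-1 : R[i]) < 1.
    by rewrite (_ : 2^-1 = (2^-1)%:C) ?cmodR ?ger0_norm ?invr_ge0 //; [lra|rewrite fmorphV rmorphMn].
  have := gf _ h2; rewrite (zero_deriv_cst d0 h2) gf // => /eqP.
  by rewrite eq_sym invr_eq0 pnatr_eq0.
have [k k1 Hk] := conjugate a (f a) c a1 (Df _ a1) dc c0 erefl.
have [c' Hc'] := Hf 0 c01.
have na : cmod (- a) < 1 by rewrite cmodN.
have fE z : cmod z < 1 -> mob (f a) (k * mob (- a) z) = f z.
  move=> z1; rewrite -Hk; last exact: mob_disk.
  by have := @mobK R (- a) z; rewrite opprK cmodN => ->.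
have kd z : cmod z < 1 -> cmod (k * z) < 1 by move=> ?; rewrite cmodM k1 mul1r.
(* Near 0, f is now an explicit composition of Moebius maps, so its derivative there is nonzero;
   [conjugate] can then be applied at the center 0, which gives the announced form. *)
have D1 := cdiffM (cdiff_cst k 0) (cdiff_mob na c01).
have m01 := mob_disk na c01.
have D2 := cdiff_comp D1 (cdiff_mob (Df _ a1) (kd _ m01)).
have fE' w : cmod (w - 0) < 1 -> (mob (f a) \o (fun z => k * mob (- a) z)) w = f w.
  by rewrite subr0; exact: fE.
have D3 := cdiff_eq ltr01 fE' D2.
have kn0 : k != 0 by rewrite -cmod_eq0 k1 oner_eq0.
have c'0 : c' != 0.
  rewrite (cdiff_unique Hc' D3) mul0r add0r.
  rewrite !mulf_neq0 ?invr_eq0 ?expf_neq0 ?nz // ?mob_den //; try exact: Df.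
  exact: kd.
have [l l1 Hl] := conjugate 0 (f 0) c' c01 (Df _ c01) Hc' c'0 erefl.
by exists l => // z z1; rewrite -Hl // /mob conjc0 mul0r !addr0 divr1.
Qed.
End DiskAut.

(** * The Poincare metric *)

Section Artanh.
Variable R : realType.
Implicit Types x y r p q : R.

(** This is 2 artanh x, the distance from 0 to a point of modulus x; [tanh_half r] below is its
    inverse tanh (r / 2). *)
Definition artanh2 x : R := ln ((1 + x) / (1 - x)).
Definition tanh_half r : R := (expR r - 1) / (expR r + 1).

Lemma artanh2_arg_gt0 x : 0 <= x < 1 -> 0 < (1 + x) / (1 - x).
Proof. by move=> x01; rewrite divr_gt0 //; lra. Qed.

Lemma expR_artanh2 x : 0 <= x < 1 -> expR (artanh2 x) = (1 + x) / (1 - x).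
Proof. by move=> x01; rewrite /artanh2 lnK // posrE artanh2_arg_gt0. Qed.

Lemma artanh2_le x y : 0 <= x < 1 -> 0 <= y < 1 -> (artanh2 x <= artanh2 y) = (x <= y).
Proof.
move=> x01 y01; rewrite -ler_expR !expR_artanh2 // ler_pdivrMr; last by lra.
rewrite mulrAC ler_pdivlMr; last by lra.
by apply/idP/idP; nra.
Qed.

Lemma artanh2_lt x y : 0 <= x < 1 -> 0 <= y < 1 -> (artanh2 x < artanh2 y) = (x < y).
Proof. by move=> x01 y01; rewrite !ltNge artanh2_le. Qed.

Lemma artanh20 : artanh2 0 = 0.
Proof. by rewrite /artanh2 addr0 subr0 divr1 ln1. Qed.

Lemma artanh2_ge0 x : 0 <= x < 1 -> 0 <= artanh2 x.
Proof. by move=> x01; rewrite -artanh20 artanh2_le //; lra. Qed.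

Lemma tanh_half_bnd r : 0 <= r -> 0 <= tanh_half r < 1.
Proof.
move=> r0; have e1 : 1 <= expR r by rewrite -expR0 ler_expR.
rewrite /tanh_half divr_ge0 /=; try lra.
by rewrite ltr_pdivrMr; lra.
Qed.

Lemma artanh2K r : 0 <= r -> artanh2 (tanh_half r) = r.
Proof.
move=> r0; have e0 := expR_gt0 r; rewrite -[RHS]expRK; congr ln.
rewrite /tanh_half; field; apply/andP; split; rewrite gt_eqF //; lra.
Qed.

Lemma tanh_halfK x : 0 <= x < 1 -> tanh_half (artanh2 x) = x.
Proof.
move=> x01; rewrite /tanh_half expR_artanh2 //; field.
by apply/andP; split; rewrite gt_eqF //; lra.
Qed.

Lemma tanh_half_gt0 r : 0 < r -> 0 < tanh_half r.
Proof.
by move=> r0; have e1 : 1 < expR r by [rewrite -expR0 ltr_expR]; rewrite divr_gt0 //; lra.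
Qed.

Lemma tanh_half_le r s : 0 <= r -> r <= s -> tanh_half r <= tanh_half s.
Proof.
by move=> r0 rs; rewrite -artanh2_le ?artanh2K ?tanh_half_bnd //; lra.
Qed.

Lemma tanh_half_compl_ge r x : 0 <= x < 1 -> artanh2 x <= r -> expR (- r) <= 1 - x.
Proof.
move=> x01 xr; have e0 := expR_gt0 (artanh2 x).
have : expR (- r) <= expR (- artanh2 x) by rewrite ler_expR; lra.
move=> /le_trans; apply; rewrite expRN expR_artanh2 // invf_div ler_pdivrMr; last by lra.
nra.
Qed.

Lemma tanh_half_compl_le r : 0 <= r -> 1 - tanh_half r <= 2 * expR (- r).
Proof.
move=> r0; have e0 := expR_gt0 r; rewrite /tanh_half expRN.
have -> : 1 - (expR r - 1) / (expR r + 1) = 2 / (expR r + 1) by field; rewrite gt_eqF //; lra.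
by rewrite ler_wpM2l // lef_pV2 ?posrE; lra.
Qed.

Lemma artanh2_sum p q : 0 <= p < 1 -> 0 <= q < 1 ->
  0 <= (p + q) / (1 + p * q) < 1 /\ artanh2 ((p + q) / (1 + p * q)) = artanh2 p + artanh2 q.
Proof.
move=> p01 q01; have pq0 : 0 < 1 + p * q by nra.
have b : 0 <= (p + q) / (1 + p * q) < 1.
  by rewrite divr_ge0 /=; try nra; rewrite ltr_pdivrMr //; nra.
split=> //; apply: expR_inj; rewrite expRD !expR_artanh2 //; field.
repeat (apply/andP; split); rewrite gt_eqF //; try lra; nra.
Qed.
End Artanh.

(** * Pseudo-hyperbolic distance and the divergence of Moebius translations *)

Section PseudoHyperbolic.
Variable R : realType.
Implicit Types u v w z a c : R[i].

Definition pseudohyp u v : R := cmod ((u - v) / (1 - v^* * u)).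

Lemma pseudohyp_mob u v : pseudohyp u v = cmod (mob (- v) u).
Proof. by rewrite /pseudohyp /mob rmorphN /= mulNr. Qed.

Lemma pseudohyp_bnd u v : cmod u < 1 -> cmod v < 1 -> 0 <= pseudohyp u v < 1.
Proof. by move=> u1 v1; rewrite pseudohyp_mob cmod_ge0 mob_disk // cmodN. Qed.

Lemma pseudohyp_den u v : cmod u < 1 -> cmod v < 1 -> 1 - v^* * u != 0.
Proof.
by move=> u1 v1; have := @mob_den R (- v) u; rewrite cmodN rmorphN /= mulNr; apply.
Qed.

Lemma pseudohypC u v : pseudohyp u v = pseudohyp v u.
Proof.
rewrite /pseudohyp !cmodM !cmodV cmodBC -(cmod_conj (1 - u^* * v)).
by congr (_ / cmod _); rewrite rmorphB rmorph1 rmorphM /= conjcK mulrC.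
Qed.

Lemma pseudohyp0 v : pseudohyp 0 v = cmod v.
Proof. by rewrite /pseudohyp mulr0 subr0 divr1 sub0r cmodN. Qed.

Lemma pseudohypxx v : pseudohyp v v = 0.
Proof. by rewrite /pseudohyp subrr mul0r cmod0. Qed.

Lemma pseudohyp_rot c u v : cmod c = 1 -> pseudohyp (c * u) (c * v) = pseudohyp u v.
Proof.
move=> c1; have cc : c^* * c = 1 by rewrite mulrC -sqr_cmodC c1 expr1n.
rewrite /pseudohyp rmorphM /= mulrACA [_ * c]cc mul1r -mulrBr -mulrA cmodM c1 mul1r //.
Qed.

(** The quotient defining the distance is multiplied by (1 + a conj(v)) / (1 + conj(a) v), a number
    of modulus 1. *)
Lemma pseudohyp_moebius a u v : cmod a < 1 -> cmod u < 1 -> cmod v < 1 ->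
  pseudohyp (mob a u) (mob a v) = pseudohyp u v.
Proof.
move=> a1 u1 v1; have du := mob_den a1 u1; have dv := mob_den a1 v1.
have dv' : 1 + a * v^* != 0.
  by have := @mob_den R a^* v^*; rewrite !cmod_conj conjcK => /(_ a1 v1).
have duv := pseudohyp_den u1 v1; have duv' := pseudohyp_den (mob_disk a1 u1) (mob_disk a1 v1).
have aa : 1 - a * a^* != 0.
  by have := pseudohyp_den a1 a1; rewrite mulrC.
have E : (mob a u - mob a v) / (1 - (mob a v)^* * mob a u) =
    (u - v) / (1 - v^* * u) * ((1 + a * v^*) / (1 + a^* * v)).
  rewrite conj_mob /mob in duv' *; rewrite -[LHS](mulfK (mulf_neq0 dv' du)) .
  have -> : 1 - (v^* + a^*) / (1 + a * v^*) * ((u + a) / (1 + a^* * u)) =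
    (1 - a * a^*) * (1 - v^* * u) / ((1 + a * v^*) * (1 + a^* * u)).
    by field; rewrite du dv'.
  by field; rewrite du dv dv' duv aa.
rewrite /pseudohyp E cmodM [cmod (_ / (1 + a^* * v))]cmodM cmodV.
have -> : cmod (1 + a * v^*) = cmod (1 + a^* * v).
  by rewrite -cmod_conj rmorphD rmorph1 rmorphM /= conjcK.
by rewrite divff ?mulr1 // cmod_eq0.
Qed.

Lemma pseudohyp_le_add u v : cmod u < 1 -> cmod v < 1 ->
  pseudohyp u v <= (cmod u + cmod v) / (1 + cmod u * cmod v).
Proof.
move=> u1 v1; have u0 := cmod_ge0 u; have v0 := cmod_ge0 v.
have nv1 : cmod (- v) < 1 by rewrite cmodN.
have [b _] := @artanh2_sum R (cmod u) (cmod v) ltac:(lra) ltac:(lra).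
rewrite -(@ler_pXn2r _ 2) ?nnegrE ?cmod_ge0 //; last by lra.
have := mob_norm nv1 u1; rewrite -pseudohyp_mob cmodN.
have d0 : 0 < cmod (1 + (- v)^* * u) by rewrite cmod_gt0 // mob_den.
have dle : cmod (1 + (- v)^* * u) <= 1 + cmod u * cmod v.
  apply: le_trans (cmodD _ _) _.
  by rewrite cmod1 cmodM cmod_conj cmodN mulrC lexx.
set d := cmod (1 + _) in d0 dle *; set p := cmod u in u0 u1 b dle *; set q := cmod v in v0 v1 b dle *.
have pq0 : 0 < 1 + p * q by nra.
have dd : d ^+ 2 <= (1 + p * q) ^+ 2 by rewrite ler_pXn2r ?nnegrE //; lra.
have Epq : 1 - ((p + q) / (1 + p * q)) ^+ 2 = (1 - q ^+ 2) * (1 - p ^+ 2) / (1 + p * q) ^+ 2.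
  by field; rewrite gt_eqF.
move=> Ed.
suff : 1 - ((p + q) / (1 + p * q)) ^+ 2 <= 1 - pseudohyp u v ^+ 2 by lra.
rewrite Ed Epq ler_wpM2l //; first by apply: mulr_ge0; nra.
by rewrite lef_pV2 ?posrE ?exprn_gt0.
Qed.

(** The translation by - v moves the middle point to 0. There the inequality is [pseudohyp_le_add],
    and [artanh2_sum] is the addition formula of tanh. *)
Lemma artanh2_triangle u v w : cmod u < 1 -> cmod v < 1 -> cmod w < 1 ->
  artanh2 (pseudohyp u w) <= artanh2 (pseudohyp u v) + artanh2 (pseudohyp v w).
Proof.
move=> u1 v1 w1; have nv1 : cmod (- v) < 1 by rewrite cmodN.
rewrite (pseudohypC v w) -(pseudohyp_moebius nv1 u1 w1) (pseudohyp_mob u) (pseudohyp_mob w).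
have mu := mob_disk nv1 u1; have mw := mob_disk nv1 w1.
have [b <-] := @artanh2_sum R (cmod (mob (- v) u)) (cmod (mob (- v) w))
  ltac:(rewrite cmod_ge0 //) ltac:(rewrite cmod_ge0 //).
by rewrite artanh2_le ?pseudohyp_le_add ?pseudohyp_bnd.
Qed.

Lemma cmod_le_pseudohyp u v : cmod u < 1 -> cmod v < 1 -> cmod (u - v) <= 2 * pseudohyp u v.
Proof.
move=> u1 v1; have dp := cmod_gt0 (pseudohyp_den u1 v1).
rewrite /pseudohyp cmodM cmodV mulrA ler_pdivlMr // mulrC ler_wpM2r ?cmod_ge0 //.
have := cmodD 1 (- (v^* * u)); rewrite cmod1 cmodN cmodM cmod_conj.
by have := cmod_ge0 u; have := cmod_ge0 v; nra.
Qed.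

Lemma pseudohyp_le_cmod u v : cmod u < 1 -> cmod v < 1 ->
  pseudohyp u v <= 2 * cmod (u - v) / (1 - cmod u ^+ 2).
Proof.
move=> u1 v1; have dp := cmod_gt0 (pseudohyp_den u1 v1).
have u0 := cmod_ge0 u; have v0 := cmod_ge0 v.
rewrite /pseudohyp cmodM cmodV ler_pdivlMr; last by nra.
rewrite mulrAC ler_pdivrMr // [2 * _]mulrC -mulrA ler_wpM2l ?cmod_ge0 //.
have := cmod_subr_ge 1 (v^* * u); rewrite cmod1 cmodM cmod_conj; nra.
Qed.

(** From |1 - conj(v) u| <= (1 - |u| ^ 2) + |u - v|: half of the right-hand side bounds |u - v|,
    which is then absorbed on the left. *)
Lemma cmod_le_of_pseudohyp u v : cmod u < 1 -> cmod v < 1 -> pseudohyp u v <= 2^-1 ->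
  cmod (u - v) <= 1 - cmod u ^+ 2.
Proof.
move=> u1 v1; have dp := cmod_gt0 (pseudohyp_den u1 v1).
rewrite /pseudohyp cmodM cmodV ler_pdivrMr // => h.
have : cmod (1 - v^* * u) <= (1 - cmod u ^+ 2) + cmod (u - v).
  have -> : 1 - v^* * u = (1 - cmod u ^+ 2)%:C + (u^* - v^*) * u.
    by rewrite rmorphB rmorph1 /= sqr_cmodC; ring.
  apply: le_trans (cmodD _ _) _; rewrite cmodR ger0_norm; last first.
    by have := cmod_ge0 u; nra.
  rewrite cmodM -rmorphB /= cmod_conj lerD2l.
  by have := cmod_ge0 (u - v); nra.
lra.
Qed.

(** The Euclidean gap is O(|z - z'|) uniformly in w, and passing to the hyperbolic scale divides it
    by 1 - |mob z w| ^ 2, which is at least a multiple of exp (- r). In the constant, 2 comes from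
    [pseudohyp_le_cmod], 4 from the numerator and 4 from |1 + conj(z) w| ^ 2 <= 4; two factors 1 - q
    come from the denominators and one from 1 - |z| ^ 2. *)
Lemma mob_near z z' w (q r : R) : cmod z <= q -> cmod z' <= q -> q < 1 -> cmod w < 1 ->
  artanh2 (cmod w) <= r -> pseudohyp (mob z w) (mob z' w) <= 32 / (1 - q) ^+ 3 * expR r * cmod (z - z').
Proof.
move=> zq z'q q1 w1 wr.
have z1 : cmod z < 1 by lra. have z'1 : cmod z' < 1 by lra.
have w0 := cmod_ge0 w; have z0 := cmod_ge0 z; have z'0 := cmod_ge0 z'.
have d := mob_den z1 w1; have d' := mob_den z'1 w1.
have den (x : R[i]) : cmod x <= q -> 1 - q <= cmod (1 + x^* * w) <= 2.
  move=> xq; have := cmod_subr_ge 1 (- (x^* * w)); have := cmodD 1 (x^* * w).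
  by rewrite opprK cmodN cmod1 cmodM cmod_conj; have := cmod_ge0 x; nra.
have /andP[dl du] := den z zq; have /andP[d'l d'u] := den z' z'q.
apply: le_trans (pseudohyp_le_cmod (mob_disk z1 w1) (mob_disk z'1 w1)) _.
rewrite mob_norm //.
have -> : mob z w - mob z' w = ((z - z') + w * ((z - z') * z'^* + z' * (z' - z)^*) + w * w * (z' - z)^*) /
   ((1 + z^* * w) * (1 + z'^* * w)).
  by rewrite /mob rmorphB /=; field; rewrite d d'.
rewrite cmodM cmodV cmodM.
set A := cmod (1 + z^* * w) in dl du *; set B := cmod (1 + z'^* * w) in d'l d'u *.
set t := cmod (z - z').
have t0 : 0 <= t := cmod_ge0 _.
have N : cmod (z - z' + w * ((z - z') * z'^* + z' * (z' - z)^*) + w * w * (z' - z)^*) <= 4 * t.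
  apply: le_trans (cmodD _ _) _; apply: le_trans (lerD (cmodD _ _) (lexx _)) _.
  rewrite !cmodM cmod_conj (cmodBC z' z) -/t.
  have n1 : cmod ((z - z') * z'^* + z' * (z' - z)^*) <= 2 * t.
    apply: le_trans (cmodD _ _) _; rewrite !cmodM !cmod_conj (cmodBC z' z) -/t; nra.
  have K0 := cmod_ge0 ((z - z') * z'^* + z' * (z' - z)^*).
  have n2 := ler_pM w0 K0 (ltW w1) n1.
  have n3 : cmod w * cmod w * t <= 1 * t by rewrite ler_wpM2r //; nra.
  lra.
have er : expR (- r) <= 1 - cmod w by apply: tanh_half_compl_ge => //; lra.
have e0 := expR_gt0 r; rewrite expRN in er.
have er1 : 1 <= expR r * (1 - cmod w) by rewrite mulrC -ler_pdivrMr // div1r.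
rewrite ler_pdivrMr; last first.
  by rewrite divr_gt0 ?mulr_gt0 ?exprn_gt0 //; nra.
have Y : 1 <= expR r * (1 - cmod w ^+ 2) by nra.
have q0 : 0 < 1 - q by lra.
have Z : 1 - q <= 1 - cmod z ^+ 2 by nra.
have A2 : A ^+ 2 <= 4 by nra.
have AB : (1 - q) ^+ 2 <= A * B by nra.
have AB0 : 0 < A * B by apply: mulr_gt0; lra.
have h1 : 2 * (cmod (z - z' + w * ((z - z') * z'^* + z' * (z' - z)^*) + w * w * (z' - z)^*) / (A * B)) <=
   8 * t / (1 - q) ^+ 2.
  rewrite mulrA ler_pdivrMr // [leRHS]mulrAC ler_pdivlMr ?exprn_gt0 //.
  apply: ler_pM => //; [by rewrite mulr_ge0 ?cmod_ge0|nra|lra].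
apply: le_trans h1 _.
have -> : 32 / (1 - q) ^+ 3 * expR r * t * ((1 - cmod z ^+ 2) * (1 - cmod w ^+ 2) / A ^+ 2) =
  8 * t / (1 - q) ^+ 2 * ((expR r * (1 - cmod w ^+ 2)) * ((1 - cmod z ^+ 2) / (1 - q)) * (4 / A ^+ 2)).
  by field; repeat (apply/andP; split); rewrite gt_eqF //; lra.
have X0 : 0 <= 8 * t / (1 - q) ^+ 2 by rewrite mulr_ge0 ?mulr_ge0 // invr_ge0 sqr_ge0.
rewrite ler_peMr //.
have Z' : 1 <= (1 - cmod z ^+ 2) / (1 - q) by rewrite ler_pdivlMr ?mul1r.
have A' : 1 <= 4 / A ^+ 2 by rewrite ler_pdivlMr ?mul1r // exprn_gt0 //; lra.
by rewrite mulr_ege1 // mulr_ege1.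
Qed.

(* The four-point mean over w, -w, iw, -iw extracts the constant coefficient of a quadratic polynomial. *)
Lemma mob_far z z' a (r : R) : cmod z <= 2^-1 -> cmod z' <= 2^-1 -> cmod a = 1 -> 0 <= r ->
  (forall w, cmod w = tanh_half r -> pseudohyp (mob z w) (mob z' (a * w)) <= 2^-1) ->
  cmod (z - z') <= 64 * expR (- r).
Proof.
move=> zh z'h a1 r0 H.
have /andP[p0 p1] := tanh_half_bnd r0; set p := tanh_half r in p0 p1 H.
have pe : 1 - p <= 2 * expR (- r) by exact: tanh_half_compl_le.
have z1 : cmod z < 1 by lra. have z'1 : cmod z' < 1 by lra.
have z0 := cmod_ge0 z; have z'0 := cmod_ge0 z'.
(* The numerator of mob z w - mob z' (a w). On the circle |w| = p the difference is at most 1 - |mob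
   z w| ^ 2, which is O(1 - p) = O(exp (- r)); this controls P there. *)
pose P w := (z - z') + w * (1 + z * z'^* * a - a - z' * z^*) + a * (z'^* - z^*) * w ^+ 2.
have PB w : cmod w = p -> cmod (P w) <= 64 * expR (- r).
  move=> wp; have w1 : cmod w < 1 by rewrite wp.
  have aw1 : cmod (a * w) < 1 by rewrite cmodM a1 mul1r.
  have d := mob_den z1 w1; have d' := mob_den z'1 aw1.
  have := cmod_le_of_pseudohyp (mob_disk z1 w1) (mob_disk z'1 aw1) (H w wp).
  have -> : mob z w - mob z' (a * w) = P w / ((1 + z^* * w) * (1 + z'^* * (a * w))).
    by rewrite /mob /P; field; rewrite d d'.
  rewrite mob_norm // cmodM cmodV cmodM wp.
  have den (x y : R[i]) : cmod x <= 2^-1 -> cmod y = p -> 2^-1 <= cmod (1 + x^* * y) <= 2.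
    move=> xq yp; have := cmod_subr_ge 1 (- (x^* * y)); have := cmodD 1 (x^* * y).
    by rewrite opprK cmodN cmod1 cmodM cmod_conj yp; have := cmod_ge0 x; nra.
  have /andP[dl du] := den z w zh wp.
  have /andP[d'l d'u] := den z' (a * w) z'h ltac:(by rewrite cmodM a1 mul1r).
  set A := cmod (1 + z^* * w) in dl du *; set B := cmod (1 + _) in d'l d'u *.
  have A0 : 0 < A by lra. have B0 : 0 < B by lra.
  rewrite ler_pdivrMr ?mulr_gt0 // => /le_trans; apply.
  have -> : (1 - cmod z ^+ 2) * (1 - p ^+ 2) / A ^+ 2 * (A * B) =
    (1 - cmod z ^+ 2) * (1 - p ^+ 2) * (B / A) by field; rewrite gt_eqF.
  have BA : B / A <= 4 by rewrite ler_pdivrMr //; lra.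
  have BA0 : 0 <= B / A by rewrite divr_ge0 ?ltW.
  have h1 : (1 - cmod z ^+ 2) * (1 - p ^+ 2) <= 1 * (2 * (1 - p)) by apply: ler_pM; nra.
  have h2 : 0 <= (1 - cmod z ^+ 2) * (1 - p ^+ 2) by apply: mulr_ge0; nra.
  apply: (@le_trans _ _ (1 * (2 * (1 - p)) * 4)); first exact: ler_pM.
  by have := expR_gt0 (- r); lra.
have i1 : cmod ('i : R[i]) = 1 by rewrite cmodE /= expr0n expr1n add0r sqrtr1.
have m (x : R[i]) : cmod x = 1 -> cmod (x * p%:C) = p.
  by move=> x1; rewrite cmodM x1 mul1r cmodR ger0_norm.
have E : (4%:R)%:C * (z - z') = P (1 * p%:C) + P (- 1 * p%:C) + P ('i * p%:C) + P (- 'i * p%:C).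
  by rewrite /P !exprMn !sqrrN sqr_i expr1n rmorphMn rmorph1 ; ring.
have : cmod ((4%:R)%:C * (z - z')) <= 4 * (64 * expR (- r)).
  rewrite E; apply: le_trans (cmodD _ _) _; apply: le_trans (lerD (cmodD _ _) (lexx _)) _.
  apply: le_trans (lerD (lerD (cmodD _ _) (lexx _)) (lexx _)) _.
  have := PB _ (m 1 (cmod1 R)); have := PB _ (m (- 1) ltac:(by rewrite cmodN cmod1)).
  have := PB _ (m 'i i1); have := PB _ (m (- 'i) ltac:(by rewrite cmodN)); lra.
by rewrite cmodM cmodR ger0_norm //; lra.
Qed.
End PseudoHyperbolic.

Section UnitDisk.
Variable R : realType.
Local Notation D := (unit_disk R).
Implicit Types z w x : D.

Definition dval z : R[i] := \val z.
(** Numbers outside the disk are sent to 0, a default that keeps the map total; every use for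
    derivatives or distances stays inside the disk. *)
Definition mkdisk (w : R[i]) : D := insubd (disk0 R) w.

Lemma dval_lt1 z : cmod (dval z) < 1.
Proof.
have := set_valP z; rewrite /unit_disk /= => h.
by rewrite -ltcR cmodC.
Qed.

Lemma dval_inj : injective dval.
Proof. exact: val_inj. Qed.

Lemma mkdiskK (w : R[i]) : cmod w < 1 -> dval (mkdisk w) = w.
Proof.
move=> w1; rewrite /dval /mkdisk val_insubd ifT //.
by rewrite inE /unit_disk /= -cmodC -[1]/(1%:C) ltcR.
Qed.

Lemma dvalK z : mkdisk (dval z) = z.
Proof. by apply: dval_inj; rewrite mkdiskK // dval_lt1. Qed.

Lemma dval0 : dval (disk0 R) = 0.
Proof. by []. Qed.

Lemma dval_rotation t z : dval (rotation t z) = (cos t +i* sin t) * dval z.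
Proof. by []. Qed.

Local Notation pd := (@poincare_dist R).

Lemma pdE z w : pd z w = artanh2 (pseudohyp (dval z) (dval w)).
Proof. by []. Qed.

Lemma pseudohyp_dval z w : 0 <= pseudohyp (dval z) (dval w) < 1.
Proof. by apply: pseudohyp_bnd; exact: dval_lt1. Qed.

Lemma pd_ge0 z w : 0 <= pd z w.
Proof. by rewrite pdE artanh2_ge0 // pseudohyp_dval. Qed.

Lemma pdC z w : pd z w = pd w z.
Proof. by rewrite !pdE pseudohypC. Qed.

Lemma pdxx z : pd z z = 0.
Proof. by rewrite pdE pseudohypxx artanh20. Qed.

Lemma pd_triangle x z w : pd z w <= pd z x + pd x w.
Proof. by rewrite !pdE artanh2_triangle // dval_lt1. Qed.

Lemma pd_lt z w r : 0 <= r -> (pd z w < r) = (pseudohyp (dval z) (dval w) < tanh_half r).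
Proof. by move=> r0; rewrite -{1}(artanh2K r0) artanh2_lt ?tanh_half_bnd ?pseudohyp_dval. Qed.

Lemma pd_le z w r : 0 <= r -> (pd z w <= r) = (pseudohyp (dval z) (dval w) <= tanh_half r).
Proof. by move=> r0; rewrite -{1}(artanh2K r0) artanh2_le ?tanh_half_bnd ?pseudohyp_dval. Qed.

Lemma pd_eq0 z w : pd z w <= 0 -> z = w.
Proof.
rewrite pd_le // /tanh_half expR0 subrr mul0r => h; apply: dval_inj; apply/eqP.
rewrite -subr_eq0 -cmod_eq0 eq_le cmod_ge0 andbT.
by apply: le_trans (cmod_le_pseudohyp (dval_lt1 z) (dval_lt1 w)) _; lra.
Qed.

Lemma pd0 z : pd (disk0 R) z = artanh2 (cmod (dval z)).
Proof. by rewrite pdE pseudohyp0. Qed.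

Lemma pd_of_cmod z r : 0 < r -> exists2 d, 0 < d & forall w,
  cmod (dval w - dval z) < d -> pd z w < r.
Proof.
move=> r0; have z0 := cmod_ge0 (dval z); have z1 := dval_lt1 z; have l0 := tanh_half_gt0 r0.
have q0 : 0 < 1 - cmod (dval z) ^+ 2 by nra.
exists (tanh_half r * (1 - cmod (dval z) ^+ 2) / 2) => [|w h]; first by apply: divr_gt0 => //; exact: mulr_gt0.
rewrite pd_lt ?(ltW r0) //; apply: le_lt_trans (pseudohyp_le_cmod z1 (dval_lt1 w)) _.
by rewrite ltr_pdivrMr // cmodBC; lra.
Qed.

Lemma cmod_of_pd z w r : 0 <= r -> pd z w < r -> cmod (dval z - dval w) < 2 * tanh_half r.
Proof.
move=> r0; rewrite pd_lt // => h.
by apply: le_lt_trans (cmod_le_pseudohyp (dval_lt1 z) (dval_lt1 w)) _; lra.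
Qed.

Lemma nbhs_disk_cmod z (U : set D) : nbhs z U <->
  exists2 r : R, 0 < r & forall w, cmod (dval w - dval z) < r -> U w.
Proof.
split.
  rewrite nbhsE /= => -[B [[A oA <-] Az] BU].
  have : nbhs (\val z : R[i]^o) A by apply: open_nbhs_nbhs.
  move=> /nbhs_ballP[e /= e0 He].
  have eE : e = (Re e)%:C.
    by rewrite RRe_real // ger0_real // ltW.
  exists (Re e); first by rewrite -ltcR -eE.
  move=> w wz; apply: BU => /=; apply: He; rewrite /ball /= distrC eE -cmodC ltcR.
  exact: wz.
case=> r r0 H; rewrite nbhsE /=.
exists [set w | (ball (\val z : R[i]^o) r%:C)° (\val w)]; last first.
  move=> w /= /interior_subset; rewrite /ball /= -cmodC ltcR => zw.
  by apply: H; rewrite cmodBC.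
split; first by exists ((ball (\val z : R[i]^o) r%:C)°) => //; exact: open_interior.
by rewrite /= /interior; apply: nbhsx_ballx; rewrite ltcR.
Qed.

Lemma nbhs_disk z (U : set D) : nbhs z U <->
  exists2 r : R, 0 < r & forall w, pd z w < r -> U w.
Proof.
rewrite nbhs_disk_cmod; split=> -[r r0 H]; last first.
  have [d d0 Hd] := pd_of_cmod z r0; exists d => // w /Hd; exact: H.
pose s := Num.min r 2^-1 / 2.
have h0 : (0:R) < 2^-1 by lra.
have m0 : 0 < Num.min r 2^-1 by rewrite lt_min r0.
have [m1 m2] : Num.min r 2^-1 <= r /\ Num.min r 2^-1 <= 2^-1 by split; rewrite ge_min lexx ?orbT.
have [s0 [sr s4]] : 0 < s /\ s <= r / 2 /\ s <= 2^-1 / 2 by rewrite /s; split; [lra|split; lra].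
have s1 : 0 <= s < 1 by lra.
exists (artanh2 s) => [|w zw]; first by rewrite -(artanh20 R) artanh2_lt //; lra.
apply: H; rewrite cmodBC; have := cmod_of_pd (artanh2_ge0 s1) zw.
by rewrite tanh_halfK //; lra.
Qed.

Lemma open_disk (U : set D) : open U <->
  forall z, U z -> exists2 r : R, 0 < r & forall w, pd z w < r -> U w.
Proof.
rewrite openE; split=> H z Uz; first exact/nbhs_disk/H.
by apply/nbhs_disk; exact: H.
Qed.

Lemma open_pd_ball z r : open [set w | pd z w < r].
Proof.
apply/open_disk => w /= zw; exists (r - pd z w); first by rewrite subr_gt0.
by move=> x wx; apply: le_lt_trans (pd_triangle w _ _) _; rewrite addrC -ltrBrDr.
Qed.

Lemma closed_disk_le r xi : closed_disk r xi -> pd (disk0 R) xi <= r.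
Proof.
move=> H; apply/ler_addgt0Pr => e e0.
have [w [/= w1 w2]] := H [set w | pd xi w < e] ltac:(by apply/nbhs_disk; exists e).
by apply: le_trans (pd_triangle w _ _) _; rewrite (pdC w); apply: lerD; exact: ltW.
Qed.

Lemma closed_disk_lt r xi : pd (disk0 R) xi < r -> closed_disk r xi.
Proof. by move=> h; apply: subset_closure. Qed.

Lemma pd_rotation t z w : pd (rotation t z) (rotation t w) = pd z w.
Proof. by rewrite !pdE !dval_rotation pseudohyp_rot // cmod_angle. Qed.

Lemma rotation0 t : rotation t (disk0 R) = disk0 R.
Proof. by apply: dval_inj; rewrite dval_rotation dval0 mulr0. Qed.

Lemma rotationD s t z : rotation s (rotation t z) = rotation (s + t) z.
Proof.
apply: dval_inj; rewrite !dval_rotation mulrA cosD sinD; congr (_ * _).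
by apply/eqP; rewrite eq_complex /=; apply/andP; split; apply/eqP; ring.
Qed.

Lemma rotation_id z : rotation 0 z = z.
Proof. by apply: dval_inj; rewrite dval_rotation cos0 sin0 mul1r. Qed.

Definition translation z xi : D := mkdisk (mob (dval z) (dval xi)).

Lemma dval_translation z xi : dval (translation z xi) = mob (dval z) (dval xi).
Proof. by rewrite /translation mkdiskK // mob_disk // dval_lt1. Qed.

Lemma pd_translation z x w : pd (translation z x) (translation z w) = pd x w.
Proof. by rewrite !pdE !dval_translation pseudohyp_moebius // dval_lt1. Qed.

Lemma translation0 z : translation z (disk0 R) = z.
Proof. by apply: dval_inj; rewrite dval_translation dval0 mob0. Qed.

Lemma translation_surj z w : exists xi, translation z xi = w.
Proof.
have nz1 : cmod (- dval z) < 1 by rewrite cmodN dval_lt1.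
exists (mkdisk (mob (- dval z) (dval w))); apply: dval_inj.
rewrite dval_translation mkdiskK; last by apply: mob_disk => //; exact: dval_lt1.
by have := @mobK R (- dval z) (dval w); rewrite opprK; apply=> //; exact: dval_lt1.
Qed.

(** The Euclidean radius towards xi is a geodesic, and [tanh_half] parametrizes it by arc length;
    the points are equally spaced on it. *)
Lemma geodesic_chain xi (n : nat) (h : R) : (0 < n)%N -> pd (disk0 R) xi <= n%:R * h ->
  exists p : nat -> D, [/\ p 0%N = disk0 R, p n = xi,
    forall k, pd (p k) (p k.+1) <= h &
    forall k, (k <= n)%N -> pd (disk0 R) (p k) <= pd (disk0 R) xi].
Proof.
move=> n0 xh; have n0R : 0 < n%:R :> R by rewrite ltr0n.
set L := pd (disk0 R) xi in xh *; have L0 : 0 <= L := pd_ge0 _ _.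
pose h' := L / n%:R; have h'0 : 0 <= h' by rewrite divr_ge0 ?ler0n.
have h'h : h' <= h by rewrite ler_pdivrMr // mulrC.
have [e e1 Ee] := ray_decompose (dval xi).
have sb k : 0 <= tanh_half (k%:R * h' : R) < 1 by apply: tanh_half_bnd; rewrite mulr_ge0 ?ler0n.
pose p k := mkdisk ((tanh_half (k%:R * h' : R))%:C * e).
have pv k : dval (p k) = (tanh_half (k%:R * h' : R))%:C * e.
  by apply: mkdiskK; rewrite cmodM e1 mulr1 cmodR ger0_norm; case/andP: (sb k).
have p0 k : pd (disk0 R) (p k) = k%:R * h'.
  rewrite pd0 pv cmodM e1 mulr1 cmodR ger0_norm; last by case/andP: (sb k).
  by rewrite artanh2K // mulr_ge0 ?ler0n.
exists p; split.
- by apply: dval_inj; rewrite pv dval0 mul0r /tanh_half expR0 subrr mul0r mul0r.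
- have nL : n%:R * h' = L by rewrite /h' mulrC divfK // gt_eqF.
  apply: dval_inj; rewrite pv nL /L pd0 tanh_halfK -?Ee //.
  by rewrite cmod_ge0 dval_lt1.
- move=> k; apply: le_trans h'h.
  have sb0 := sb k; have sb1 := sb k.+1.
  have mono : tanh_half (k%:R * h' : R) <= tanh_half (k.+1%:R * h' : R).
    by rewrite tanh_half_le ?mulr_ge0 ?ler0n // ler_wpM2r // ler_nat.
  rewrite pdC pdE !pv (mulrC _ e) (mulrC _ e) pseudohyp_rot //.
  set s := tanh_half _ in sb0 mono *; set t := tanh_half _ in sb1 mono *.
  have st : 0 < 1 - s * t by nra.
  have hE : pseudohyp t%:C s%:C = (t - s) / (1 - s * t).
    rewrite /pseudohyp conjc_real -rmorphB -rmorphM -[1]/(1%:C) -rmorphB -fmorphV -rmorphM /= cmodR.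
    by rewrite ger0_norm // divr_ge0 //; lra.
  have b : 0 <= (t - s) / (1 - s * t) < 1.
    by rewrite divr_ge0 /=; [rewrite ltr_pdivrMr //; nra|lra|lra].
  rewrite hE -ler_expR expR_artanh2 // -(lerD2l (k%:R * h')) .
  have E : expR h' = (1 + t) / (1 - t) / ((1 + s) / (1 - s)).
    rewrite -!expR_artanh2 // /s /t !artanh2K ?mulr_ge0 ?ler0n // -expRB; congr expR.
    by rewrite -natr1; ring.
  rewrite E lerD2l le_eqVlt; apply/orP; left; apply/eqP; field.
  by repeat (apply/andP; split); rewrite gt_eqF //; nra.
- move=> k kn; rewrite p0 /h' mulrA ler_pdivrMr // mulrC ler_wpM2l // ler_nat //.
Qed.

Lemma finite_cover_pd (rho : R) : finite_cover pd [set z : D | pd (disk0 R) z <= rho].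
Proof.
move=> r r0; case: (leP 0 rho) => rho0; last first.
  by exists [::] => z /= h; have := pd_ge0 (disk0 R) z; lra.
have /andP[q0 q1] := tanh_half_bnd rho0.
have /choice[d Hd] : forall z : R[i], exists d : R, 0 < d /\
   (cmod z < 1 -> forall w, cmod (dval w - z) < d -> pd (mkdisk z) w < r (mkdisk z)).
  move=> z; case: (boolP (cmod z < 1)) => z1; last by exists 1; split.
  have [d d0 H] := pd_of_cmod (mkdisk z) (r0 (mkdisk z)).
  by exists d; split=> // _ w; rewrite -{1}(mkdiskK z1); exact: H.
pose d' (z : R[i]) := if cmod z < 1 then d z else cmod z - tanh_half rho.
have d'0 (z : R[i]) : 0 < d' z by rewrite /d'; case: (ltP (cmod z) 1) => h; [exact: (Hd z).1|lra].
have [s Hs] := @finite_cover_disk R (tanh_half rho) _ d'0.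
exists [seq mkdisk z | z : R[i] <- s] => z /=; rewrite pd_le // pseudohyp0 => zr.
have [w ws] := Hs (dval z) zr; rewrite /d'; case: (ltP (cmod w) 1) => w1 wz; last first.
  by have := cmod_subr_ge w (dval z); lra.
exists (mkdisk w); first by apply/mapP; exists w.
by apply: (Hd w).2 => //; rewrite cmodBC.
Qed.
End UnitDisk.

(** * Lifting and the uniformization of leaves *)

Section Holomorphic.
Variable R : realType.
Local Notation D := (unit_disk R).
Local Notation pd := (@poincare_dist R).
Implicit Types (z w : D) (f g : D -> D).

Definition ext f : R[i] -> R[i] := fun w : R[i] => dval (f (mkdisk w)).

Lemma ext_dval f z : ext f (dval z) = dval (f z).
Proof. by rewrite /ext dvalK. Qed.

Lemma derivable_cdiff (F : R[i]^o -> R[i]^o) (z : R[i]^o) :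
  derivable F z 1 -> exists c, cdiff F z c.
Proof.
move=> /cvg_ex[c Hc]; exists c => e e0.
have eC : 0 < e%:C :> R[i] by rewrite ltcR.
move/cvgrPdist_le: Hc => /(_ _ eC); rewrite near_withinE => /nbhs_ballP[d /= d0 H].
have dE : d = (Re d)%:C by rewrite RRe_real // ger0_real // ltW.
exists (Re d); first by rewrite -ltcR -dE.
move=> w wz; have [->|wn] := eqVneq w z; first by rewrite !subrr mulr0 subr0 cmod0 mulr0.
have h0 : w - z != 0 by rewrite subr_eq0.
have := H (w - z); rewrite /ball /= sub0r normrN -cmodC dE ltcR => /(_ wz h0).
rewrite /GRing.scale /= mulr1 subrK distrC -cmodC lecR => L.
have -> : F w - F z - c * (w - z) = ((w - z)^-1 * (F w - F z) - c) * (w - z) by field.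
by rewrite cmodM ler_wpM2r ?cmod_ge0.
Qed.

Lemma holomorphic_cdiff (U : set D) f z : open U -> holomorphic_on U f -> U z ->
  exists c, cdiff (ext f) (dval z) c.
Proof.
move=> oU [F HF] Uz; have [_ /derivable_cdiff[c Hc]] := HF z Uz; exists c.
have /nbhs_disk_cmod[d d0 Hd] : nbhs z U by apply: open_nbhs_nbhs.
have q0 : 0 < Num.min d (1 - cmod (dval z)).
  by rewrite lt_min d0 subr_gt0 dval_lt1.
apply: cdiff_eq q0 _ Hc => w; rewrite lt_min => /andP[wd w1].
have w1' : cmod w < 1 by have := cmod_subr_ge w (dval z); lra.
have Uw : U (mkdisk w) by apply: Hd; rewrite mkdiskK.
by rewrite /ext [RHS](HF _ Uw).1 -/(dval _) mkdiskK.
Qed.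

Definition dcont f z := forall e, 0 < e ->
  exists2 d, 0 < d & forall w, pd z w < d -> pd (f z) (f w) < e.

Lemma dcont_eq f g z (r : R) : 0 < r -> (forall w, pd z w < r -> f w = g w) ->
  dcont f z -> dcont g z.
Proof.
move=> r0 fg fz e /fz[d d0 H]; exists (Num.min d r) => [|w]; first by rewrite lt_min d0.
by rewrite lt_min => /andP[/H h /fg <-]; rewrite -fg // pdxx.
Qed.

Lemma dcont_id z : dcont id z.
Proof. by move=> e e0; exists e. Qed.

Lemma dcont_comp f g z : dcont f z -> dcont g (f z) -> dcont (g \o f) z.
Proof. by move=> fz gz e /gz[d /fz[d' d'0 H'] H]; exists d' => // w /H' /H. Qed.

Lemma dcont_ccont f z : ccont (ext f) (dval z) <-> dcont f z.
Proof.
split=> H e e0.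
  have [d d0 Hd] := pd_of_cmod (f z) e0.
  have [d' d'0 Hd'] := H d d0.
  have /nbhs_disk[r r0 Hr] : nbhs z [set w | cmod (dval w - dval z) < d'].
    by apply/nbhs_disk_cmod; exists d'.
  by exists r => // w /Hr /Hd'; rewrite !ext_dval => /Hd.
have /nbhs_disk[s s0 Hs] : nbhs (f z) [set w | cmod (dval w - dval (f z)) < e].
  by apply/nbhs_disk_cmod; exists e.
have [d d0 Hd] := H s s0; have [d' d'0 Hd'] := pd_of_cmod z d0.
exists (Num.min d' (1 - cmod (dval z))); first by rewrite lt_min d'0 subr_gt0 dval_lt1.
move=> w; rewrite lt_min => /andP[wd w1].
have w1' : cmod w < 1 by have := cmod_subr_ge w (dval z); lra.
by rewrite -(mkdiskK w1') !ext_dval; apply/Hs/Hd/Hd'; rewrite mkdiskK.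
Qed.

Definition dholo f := forall z, exists c, cdiff (ext f) (dval z) c.

Lemma dholo_dcont f z : dholo f -> dcont f z.
Proof. by move=> /(_ z)[c /cdiff_ccont]; apply: (dcont_ccont _ _).1. Qed.

Lemma cdiff_ext_comp f g z a b : cdiff (ext f) (dval z) a -> cdiff (ext g) (dval (f z)) b ->
  cdiff (ext (g \o f)) (dval z) (b * a).
Proof.
rewrite -ext_dval => Hf Hg.
have -> : ext (g \o f) = ext g \o ext f.
  by apply/funext => w; rewrite /= /ext /= dvalK.
exact: cdiff_comp.
Qed.

Lemma translation_rotation_form f g : cancel f g -> cancel g f -> dholo f -> (forall z, dcont g z) ->
  exists th, forall xi, f xi = translation (f (disk0 R)) (rotation th xi).
Proof.
move=> fK gK Hf cg.
have hf : holo_disk (ext f) by move=> z z1; rewrite -(mkdiskK z1).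
have fg : disk_homeo (ext f) (ext g).
  split.
  - by move=> z z1; exact: dval_lt1.
  - by move=> z z1; exact: dval_lt1.
  - by move=> z z1; rewrite /ext dvalK fK mkdiskK.
  - by move=> z z1; rewrite /ext dvalK gK mkdiskK.
  - by move=> z z1; rewrite -(mkdiskK z1); apply/dcont_ccont.
have [c c1 Hc] := disk_automorphism fg hf.
have [th cth] := unit_angle c1; exists th => xi; apply: dval_inj.
rewrite dval_translation dval_rotation -cth.
have := Hc _ (dval_lt1 xi); rewrite ext_dval => ->.
by rewrite -[0]/(dval (disk0 R)) ext_dval.
Qed.

Lemma aut_diskP a : aut_disk a -> dholo a /\ exists b, [/\ dholo b, cancel a b & cancel b a].
Proof.
have T f : holomorphic_on setT f -> dholo f.
  by move=> Hf z; apply: (holomorphic_cdiff openT Hf).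
by move=> [/T Ha [b /T Hb [ab ba]]]; split=> //; exists b.
Qed.

Lemma aut_disk_isometry a z w : aut_disk a -> pd (a z) (a w) = pd z w.
Proof.
move=> /aut_diskP[Ha [b [Hb ab ba]]].
have [th H] := translation_rotation_form ab ba Ha (fun z => dholo_dcont z Hb).
by rewrite (H z) (H w) pd_translation pd_rotation.
Qed.
End Holomorphic.

(** * Lifting along rays of the disk *)

Section Lifting.
Variable R : realType.
Local Notation D := (unit_disk R).
Local Notation pd := (@poincare_dist R).
Implicit Types (x y z w : D) (s : R).

(** Connectedness of [0, 1] as an induction principle: the infimum of the failures would have a
    neighbourhood without failures. *)
Lemma real_induction (A : R -> Prop) :
  (forall s, 0 <= s <= 1 -> (forall s', 0 <= s' < s -> A s') ->
     exists2 d, 0 < d & forall s', 0 <= s' <= 1 -> `|s' - s| < d -> A s') ->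
  forall s, 0 <= s <= 1 -> A s.
Proof.
move=> H s s01; apply: contrapT => nA.
pose S := [set s : R | 0 <= s <= 1 /\ ~ A s].
have Ss : S s by [].
have lbS : has_lbound S by exists 0 => u [/andP[]].
have hi : has_inf S by split=> //; exists s.
set m := inf S.
have m01 : 0 <= m <= 1.
  apply/andP; split; first by apply: lb_le_inf => [|u [/andP[]]//]; exists s.
  by apply: le_trans (ge_inf lbS Ss) _; case/andP: s01.
have below s' : 0 <= s' < m -> A s'.
  move=> /andP[s'0 s'm]; apply: contrapT => nAs'.
  have s'S : S s' by split=> //; rewrite s'0 /=; case/andP: m01; lra.
  by have := ge_inf lbS s'S; rewrite -/m; lra.
have [d d0 Hd] := H m m01 below.
have [u [u01 nAu] um] := @inf_adherent _ S d d0 hi.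
have uS : S u by [].
have mu := ge_inf lbS uS; apply: nAu; apply: Hd => //.
by rewrite -/m in mu um; rewrite ger0_norm; lra.
Qed.

Lemma convex_lt (a b c s : R) : 0 <= s <= 1 -> a < c -> b < c -> (1 - s) * a + s * b < c.
Proof. by move=> s01 ac bc; case: (leP a b) => ab; nra. Qed.

Definition seg x y s : D := mkdisk ((1 - s)%:C * dval x + s%:C * dval y).

Lemma dval_seg x y s : 0 <= s <= 1 -> dval (seg x y s) = (1 - s)%:C * dval x + s%:C * dval y.
Proof.
move=> s01; apply: mkdiskK; apply: le_lt_trans (cmodD _ _) _.
rewrite !cmodM !cmodR !ger0_norm; try lra.
apply: convex_lt => //; exact: dval_lt1.
Qed.

Lemma seg0 x y : seg x y 0 = x.
Proof. by apply: dval_inj; rewrite dval_seg ?subr0 ?mul1r ?mul0r ?addr0 ?lexx ?ler01. Qed.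

Lemma seg1 x y : seg x y 1 = y.
Proof. by apply: dval_inj; rewrite dval_seg ?subrr ?mul1r ?mul0r ?add0r ?lexx ?ler01. Qed.

Lemma seg_cont x y s : 0 <= s <= 1 -> forall e, 0 < e -> exists2 d, 0 < d &
  forall s', 0 <= s' <= 1 -> `|s' - s| < d -> pd (seg x y s) (seg x y s') < e.
Proof.
move=> s01 e e0; have [d d0 H] := pd_of_cmod (seg x y s) e0.
exists (d / 2) => [|s' s'01 h]; first by rewrite divr_gt0.
apply: H; rewrite !dval_seg //.
have -> : (1 - s')%:C * dval x + s'%:C * dval y - ((1 - s)%:C * dval x + s%:C * dval y) =
  (s' - s)%:C * (dval y - dval x) by rewrite !rmorphB rmorph1; ring.
rewrite cmodM cmodR; have := cmodD (dval y) (- dval x); rewrite cmodN.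
by have := dval_lt1 x; have := dval_lt1 y; have := normr_ge0 (s' - s);
   have := cmod_ge0 (dval y - dval x); nra.
Qed.

Definition dconvex (U : set D) := forall x y s, U x -> U y -> 0 <= s <= 1 -> U (seg x y s).

Lemma dconvexI U V : dconvex U -> dconvex V -> dconvex (U `&` V).
Proof. by move=> cU cV x y s [Ux Vx] [Uy Vy] s01; split; [exact: cU|exact: cV]. Qed.

(** [X] is a bare type. A leaf carries a topology finer than that of the suspension, so continuity
    is required only of lifts, which are maps between disks; [q] enters through its local
    injectivity. *)
Variables (X : Type) (p q : D -> X).
Hypothesis q_inj : forall a, exists2 r, 0 < r &
  forall b b', pd a b < r -> pd a b' < r -> q b = q b' -> b = b'.

Definition lift_on (U : set D) (f : D -> D) := forall y, U y -> p y = q (f y) /\ dcont f y.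

(** Continuous induction along the segment from x to y: agreement passes to the limit by continuity
    of the lifts, and spreads to a neighbourhood by local injectivity of [q]. *)
Lemma lift_on_unique (U : set D) f g x : open U -> dconvex U -> lift_on U f -> lift_on U g ->
  U x -> f x = g x -> forall y, U y -> f y = g y.
Proof.
move=> oU cU Uf Ug Ux fgx y Uy; rewrite -(seg1 x y).
apply: (@real_induction (fun s => f (seg x y s) = g (seg x y s))); last by rewrite ler01 lexx.
move=> s s01 IH; set c := seg x y s.
have Uc : U c by exact: cU.
have [pf cf] := Uf c Uc; have [pg cg] := Ug c Uc.
have fgc : f c = g c.
  move: (s01); rewrite le_eqVlt => /andP[/predU1P[s0|s0] s1].
    by rewrite /c -s0 seg0.
  apply: pd_eq0; apply/ler_addgt0Pr => e e0; rewrite add0r.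
  have e2 : 0 < e / 2 by rewrite divr_gt0.
  have [d1 d10 H1] := cf _ e2; have [d2 d20 H2] := cg _ e2.
  have d0 : 0 < Num.min d1 d2 by rewrite lt_min d10.
  have [|d' d'0 Hd'] := @seg_cont x y s _ _ d0; first by rewrite ltW.
  pose s' := Num.max 0 (s - d' / 2).
  have [s'0 s'1] : 0 <= s' /\ s - d' / 2 <= s' by rewrite !le_max !lexx orbT.
  have s's : s' < s by rewrite gt_max s0; lra.
  have := Hd' s' ltac:(lra) ltac:(rewrite ltr_norml; apply/andP; split; lra).
  rewrite lt_min => /andP[/H1 h1 /H2 h2].
  apply: le_trans (pd_triangle (f (seg x y s')) _ _) _.
  by rewrite (IH s' ltac:(lra)) in h1 *; rewrite [pd _ (g c)]pdC; lra.
have [r r0 Hr] := q_inj (f c).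
have [d1 d10 H1] := cf _ r0; have [d2 d20 H2] := cg _ r0.
have /open_disk/(_ c Uc)[d3 d30 H3] := oU.
have d0 : 0 < Num.min (Num.min d1 d2) d3 by rewrite !lt_min d10 d20.
have [d' d'0 Hd'] := @seg_cont x y s s01 _ d0; exists d' => // s' s'01 /(Hd' _ s'01).
rewrite !lt_min => /andP[/andP[/H1 h1 /H2 h2] /H3 h3].
by apply: Hr => //; rewrite ?fgc //; rewrite -(Uf _ h3).1 -(Ug _ h3).1.
Qed.

(* [q] plays the role of a covering: it is locally injective and [p] lifts locally through it. *)
Hypothesis loc : forall z, exists2 r, 0 < r & forall z1 w1, pd z z1 < r -> p z1 = q w1 ->
  exists2 f, f z1 = w1 & lift_on [set y | pd z y < r] f.

(** A Euclidean neighbourhood of the segment from 0 to s z. Tubes are open and convex, and so are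
    their intersections, on which lifts can be compared. *)
Definition tube z s (e : R) : set D :=
  [set y | exists2 s', 0 <= s' <= s & cmod (dval y - s'%:C * dval z) < e].

Lemma open_cmod (U : set D) :
  (forall y, U y -> exists2 r : R, 0 < r & forall w, cmod (dval w - dval y) < r -> U w) -> open U.
Proof. by move=> H; rewrite openE => y /H K; apply/nbhs_disk_cmod. Qed.

Lemma tube_open z s e : open (tube z s e).
Proof.
apply: open_cmod => y [s' s's h]; exists (e - cmod (dval y - s'%:C * dval z)).
  by rewrite subr_gt0.
move=> w wy; exists s' => //.
have -> : dval w - s'%:C * dval z = (dval w - dval y) + (dval y - s'%:C * dval z) by ring.
by apply: le_lt_trans (cmodD _ _) _; lra.
Qed.

Lemma tube_convex z s e : dconvex (tube z s e).
Proof.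
move=> x y c [s1 s1s h1] [s2 s2s h2] c01.
exists ((1 - c) * s1 + c * s2); first by apply/andP; split; nra.
rewrite dval_seg //.
have -> : (1 - c)%:C * dval x + c%:C * dval y - ((1 - c) * s1 + c * s2)%:C * dval z =
  (1 - c)%:C * (dval x - s1%:C * dval z) + c%:C * (dval y - s2%:C * dval z).
  by rewrite [((1 - c) * s1 + c * s2)%:C]rmorphD !rmorphM /=; ring.
apply: le_lt_trans (cmodD _ _) _; rewrite !cmodM !cmodR !ger0_norm; try lra.
exact: convex_lt.
Qed.

Lemma cball_convex z e : dconvex [set y | cmod (dval y - dval z) < e].
Proof.
move=> x y c /= h1 h2 c01; rewrite dval_seg //.
have -> : (1 - c)%:C * dval x + c%:C * dval y - dval z =
  (1 - c)%:C * (dval x - dval z) + c%:C * (dval y - dval z).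
  by rewrite rmorphB rmorph1; ring.
apply: le_lt_trans (cmodD _ _) _; rewrite !cmodM !cmodR !ger0_norm; try lra.
exact: convex_lt.
Qed.

Lemma cball_open z e : open [set y : D | cmod (dval y - dval z) < e].
Proof.
apply: open_cmod => y /= h; exists (e - cmod (dval y - dval z)); first by rewrite subr_gt0.
move=> w wy; have -> : dval w - dval z = (dval w - dval y) + (dval y - dval z) by ring.
by apply: le_lt_trans (cmodD _ _) _; lra.
Qed.

Lemma lift_on_near (U : set D) f g y : open U -> U y -> (forall w, U w -> f w = g w) ->
  lift_on U f -> p y = q (g y) /\ dcont g y.
Proof.
move=> oU Uy fg /(_ y Uy)[pf cf]; rewrite -fg //; split=> //.
have /open_disk/(_ y Uy)[r r0 Hr] := oU.
by apply: dcont_eq r0 _ cf => w /Hr /fg.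
Qed.

Lemma tube0 z s e : 0 <= s -> 0 < e -> tube z s e (disk0 R).
Proof. by move=> s0 e0; exists 0; rewrite ?lexx // dval0 rmorph0 mul0r subrr cmod0. Qed.

(** Continuous induction on s: a lift on a shorter tube is glued with a local lift around s z, and
    the two agree on the convex overlap. *)
Lemma lift_tube z w0 s : p (disk0 R) = q w0 -> 0 <= s <= 1 ->
  exists e, 0 < e /\ exists2 f, f (disk0 R) = w0 & lift_on (tube z s e) f.
Proof.
move=> pq0; move: s; apply: real_induction => s s01 IH.
pose c := seg (disk0 R) z s.
have cE (u : R) : 0 <= u <= 1 -> dval (seg (disk0 R) z u) = u%:C * dval z.
  by move=> u01; rewrite dval_seg // dval0 mulr0 add0r.
have [r r0 Hr] := loc c; have [r' r'0 Hr'] := pd_of_cmod c r0.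
have z1 := dval_lt1 z; have z0 := cmod_ge0 (dval z).
have near_c (u v : R) y (e : R) : `|u - s| < v -> cmod (dval y - u%:C * dval z) < e ->
    cmod (dval y - dval c) < e + v.
  move=> us ye; rewrite cE //.
  have -> : dval y - s%:C * dval z = (dval y - u%:C * dval z) + (u - s)%:C * dval z.
    by rewrite rmorphB; ring.
  apply: le_lt_trans (cmodD _ _) _; rewrite cmodM cmodR; have := normr_ge0 (u - s); nra.
move: (s01); rewrite le_eqVlt => /andP[/predU1P[s0|s0] s1].
  exists (r' / 2) => [|s' s'01 s's]; first by rewrite divr_gt0.
  have cz : c = disk0 R by rewrite /c -s0 seg0.
  have [f f0 Lf] := Hr (disk0 R) w0 ltac:(by rewrite cz pdxx) pq0.
  exists (r' / 2); split; first by rewrite divr_gt0.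
  exists f => // y [u us yu]; apply: Lf => /=; apply: Hr'.
  have -> : r' = r' / 2 + r' / 2 by field.
  apply: near_c yu; move: s's; rewrite !ltr_norml => /andP[? ?]; apply/andP; split; lra.
(* An earlier parameter, already covered by the induction, whose point lies in the ball of the local
   lift at [c]; the local lift is normalized there. *)
pose s1' := Num.max 0 (s - r' / 4).
have [s'0 s'1] : 0 <= s1' /\ s - r' / 4 <= s1' by rewrite !le_max !lexx orbT.
have s's : s1' < s by rewrite gt_max s0; lra.
have [e1 [e10 [f1 f10 L1]]] := IH s1' ltac:(lra).
pose z1' := seg (disk0 R) z s1'.
have z1c : cmod (dval z1' - dval c) < r'.
  have -> : r' = r' / 2 + r' / 2 by field.
  apply: (near_c s1'); first by rewrite ltr_norml; apply/andP; split; lra.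
  by rewrite cE; [rewrite subrr cmod0 divr_gt0|lra].
have T1z : tube z s1' e1 z1'.
  exists s1'; first by lra.
  by rewrite cE; [rewrite subrr cmod0|lra].
have [f2 f21 L2] := Hr z1' (f1 z1') (Hr' _ z1c) (L1 _ T1z).1.
pose B := [set y : D | cmod (dval y - dval c) < r'].
have L2B : lift_on B f2 by move=> y /Hr'; exact: L2.
have agree y : tube z s1' e1 y -> B y -> f1 y = f2 y.
  move=> Ty By; apply: (@lift_on_unique (tube z s1' e1 `&` B) f1 f2 z1') => //.
  - by apply: openI; [exact: tube_open|exact: cball_open].
  - by apply: dconvexI; [exact: tube_convex|exact: cball_convex].
  - by move=> u [Tu _]; exact: L1.
  - by move=> u [_ Bu]; exact: L2B.
pose f y := if `[< tube z s1' e1 y >] then f1 y else f2 y.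
have ff1 y : tube z s1' e1 y -> f1 y = f y by move=> Ty; rewrite /f asboolT.
have ff2 y : B y -> f2 y = f y.
  by move=> By; rewrite /f; case: asboolP => // Ty; rewrite agree.
exists (r' / 4) => [|s' s'01 s's'']; first by rewrite divr_gt0.
exists (Num.min e1 (r' / 2)); split; first by rewrite lt_min e10 divr_gt0.
exists f; first by rewrite -ff1 //; exact: tube0.
move=> y [u us]; rewrite lt_min => /andP[ye1 ye2].
case: (leP u s1') => us1.
  have Ty : tube z s1' e1 y by exists u => //; lra.
  exact: (lift_on_near (@tube_open z s1' e1) Ty ff1 L1).
have By : B y.
  have rr : r' / 2 + r' / 2 = r' by field.
  rewrite /B /= -rr.
  apply: near_c ye2; move: s's''; rewrite !ltr_norml => /andP[? ?]; apply/andP; split; lra.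
exact: (lift_on_near (@cball_open c r') By ff2 L2B).
Qed.

(** The value at z is that of the lift along the tube to z. If y lies in the tube of z, both lifts
    agree on the intersection of the two tubes, which contains 0 and y; so the choice is locally a
    single lift. *)
Lemma lift_exists w0 : p (disk0 R) = q w0 -> exists2 f, f (disk0 R) = w0 & lift_on setT f.
Proof.
move=> pq0.
have /choice[ef Hef] : forall z, exists ef : R * (D -> D),
    [/\ 0 < ef.1, ef.2 (disk0 R) = w0 & lift_on (tube z 1 ef.1) ef.2].
  move=> z; have [|e [e0 [f f0 Lf]]] := @lift_tube z w0 1 pq0; first by rewrite ler01 lexx.
  by exists (e, f).
pose f z := (ef z).2 z.
have Tz z e : 0 < e -> tube z 1 e z.
  by move=> e0; exists 1; rewrite ?ler01 ?lexx // rmorph1 mul1r subrr cmod0.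
have fE z y : tube z 1 (ef z).1 y -> (ef z).2 y = f y.
  move=> Ty; have [ez0 z0 Lz] := Hef z; have [ey0 y0 Ly] := Hef y.
  apply: (@lift_on_unique (tube z 1 (ef z).1 `&` tube y 1 (ef y).1) (ef z).2 (ef y).2 (disk0 R)).
  - by apply: openI; exact: tube_open.
  - by apply: dconvexI; exact: tube_convex.
  - by move=> u [Tu _]; exact: Lz.
  - by move=> u [_ Tu]; exact: Ly.
  - by split; exact: tube0.
  - by rewrite z0 y0.
  - by split=> //; exact: Tz.
exists f; first by have [] := Hef (disk0 R).
move=> z _; have [ez0 z0 Lz] := Hef z.
exact: (lift_on_near (@tube_open z 1 (ef z).1) (Tz _ _ ez0) (fE z) Lz).
Qed.
End Lifting.

(** * Normal form of the leaf uniformizations *)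

Section LeafNormalForm.
Variables (R : realType) (Gam : aut_subgroup R) (T : topologicalType) (r : representation Gam T).
Local Notation D := (unit_disk R).
Local Notation pd := (@poincare_dist R).
Implicit Types (x y z w : D) (s t : T).

Lemma susp_eqP z t z' t' : susp_pi r z t = susp_pi r z' t' <->
  exists2 a, Gam a & a z = z' /\ r a t = t'.
Proof.
split.
  move=> /eqquotP /asboolP[a Ga] /= [az at']; by exists a.
move=> [a Ga [<- <-]]; apply/eqquotP/asboolP; by exists a.
Qed.

Lemma susp_pi_surj (X : suspension r) : exists z t, X = susp_pi r z t.
Proof.
have := reprK X; case: (repr X) => z t <-.
by exists z, t.
Qed.

Lemma susp_pi_act a z t : Gam a -> susp_pi r (a z) (r a t) = susp_pi r z t.
Proof. by move=> Ga; symmetry; apply/susp_eqP; exists a. Qed.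

Lemma Gam_inv a : Gam a -> exists b, [/\ Gam b, cancel a b & cancel b a].
Proof. by move=> /(@aut_setV _ Gam)[b Gb [ab ba]]; exists b. Qed.

Lemma Gam_isometry a z w : Gam a -> pd (a z) (a w) = pd z w.
Proof. by move=> Ga; apply: aut_disk_isometry; exact: (aut_set_sub Ga). Qed.

Hypothesis deck : acts_by_deck_transformations Gam.

Lemma leaf_param_inj t a : exists2 e, 0 < e & forall b b', pd a b < e -> pd a b' < e ->
  susp_pi r b t = susp_pi r b' t -> b = b'.
Proof.
have [V /nbhs_disk[e e0 He] HV] := deck a; exists e => // b b' ab ab' /susp_eqP[c Gc [cb _]].
case: (pselect (c = idfun)) => [c1|c1]; first by rewrite -cb c1.
have : (c @` V `&` V) b' by split; [exists b => //; exact: He|exact: He].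
by rewrite (HV c Gc c1).
Qed.

Lemma covering_locally_inj t phi : range phi = leaf r t -> leaf_covering t phi ->
  forall a, exists2 e, 0 < e & forall b b', pd a b < e -> pd a b' < e -> phi b = phi b' -> b = b'.
Proof.
move=> Hr Hc a; have La : leaf r t (phi a) by rewrite -Hr; exists a.
have [U [oU Ua] [I [V [HU _ HV]]]] := Hc _ La.
have [i _ Via] : (\bigcup_i V i) a by rewrite -HU.
have [oVi [_ inj _] _ _] := HV i.
have /open_disk/(_ a Via)[e e0 He] := oVi; exists e => // b b' /He Vb /He Vb' E.
by apply: inj => //; rewrite inE.
Qed.

(** A local branch exists by definition. To reach a prescribed point [w1], it is composed with an
    element of Gamma, which fixes t because both points have the same T-coordinate. *)
Lemma leaf_holomorphic_lifts t phi : leaf_holomorphic t phi ->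
  forall z, exists2 e, 0 < e & forall z1 w1, pd z z1 < e -> phi z1 = susp_pi r w1 t ->
    exists f, [/\ f z1 = w1,
      forall y, pd z y < e -> phi y = susp_pi r (f y) t &
      forall y, pd z y < e -> exists c, cdiff (ext f) (dval y) c].
Proof.
move=> Hh z; have [V [f0 [oV Vz Hf0 Ef0]]] := Hh z.
have /open_disk/(_ z Vz)[e e0 He] := oV; exists e => // z1 w1 /He Vz1.
rewrite (Ef0 _ Vz1) => /susp_eqP[a Ga [aw at_]].
have [Da _] := aut_diskP (aut_set_sub Ga).
exists (a \o f0); split => //.
  by move=> y /He Vy; rewrite (Ef0 _ Vy) -(susp_pi_act _ _ Ga) at_.
move=> y /He Vy; have [c Hc] := holomorphic_cdiff oV Hf0 Vy.
by have [c' Hc'] := Da (f0 y); exists (c' * c); exact: cdiff_ext_comp Hc Hc'.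
Qed.

(** The local lift is the inverse of [phi] on the sheet containing [w1]; it is continuous because
    [phi] is open on sheets. *)
Lemma covering_lifts t phi : range phi = leaf r t -> leaf_covering t phi ->
  forall z, exists2 e, 0 < e & forall z1 w1, pd z z1 < e -> susp_pi r z1 t = phi w1 ->
    exists2 f, f z1 = w1 & lift_on (fun z => susp_pi r z t) phi [set y | pd z y < e] f.
Proof.
move=> Hr Hc z; have Lz : leaf r t (susp_pi r z t) by exists z.
have [U [[_ oU] Uz] [I [V [HU tV HV]]]] := Hc _ Lz.
have /open_disk/(_ z Uz)[e e0 He] := oU; exists e => // z1 w1 /He Uz1 E.
have [i _ Viw] : (\bigcup_i V i) w1 by rewrite -HU /= -E.
have [oVi [Vmap Vinj Vsurj] _ Vopen] := HV i.
have /choice[f Hf] : forall y, exists w, pd z y < e -> V i w /\ phi w = susp_pi r y t.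
  move=> y; case: (boolP (pd z y < e)) => [/He Uy|_]; last by exists y.
  by have [w Vw Ew] := Vsurj _ Uy; exists w.
have inz1 : U (susp_pi r z1 t) := Uz1.
pose g y := if y == z1 then w1 else f y.
exists g; first by rewrite /g eqxx.
have Hg y : pd z y < e -> V i (g y) /\ phi (g y) = susp_pi r y t.
  by rewrite /g => zy; case: eqP => [->|_]; [split|exact: Hf].
move=> y /= zy; have [Vy Ey] := Hg y zy; split=> // d d0.
set w := g y in Vy Ey *.
have := Vopen _ (@open_pd_ball R w d) => -[_ oW].
have yW : (phi @` (V i `&` [set v | pd w v < d])) (susp_pi r y t).
  by exists w => //; split=> //=; rewrite pdxx.
have /open_disk/(_ y yW)[e1 e10 He1] := oW.
exists (Num.min e1 (e - pd z y)); first by rewrite lt_min e10 subr_gt0.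
move=> y'; rewrite lt_min => /andP[/He1 /= [v [Vv wv] Ev] yy'].
have zy' : pd z y' < e by apply: le_lt_trans (pd_triangle y _ _) _; lra.
have [Vg Eg] := Hg y' zy'.
suff -> : g y' = v by [].
by apply: Vinj; rewrite ?inE //; rewrite Ev.
Qed.

Theorem leaf_uniformization_form z t phi : leaf_uniformization (susp_pi r z t) phi ->
  exists th, forall xi, phi xi = susp_pi r (translation z (rotation th xi)) t.
Proof.
move=> [phi0 [t0 [Hr Hh Hc]]].
pose q y := susp_pi r y t0.
have qinj := leaf_param_inj t0.
have phi_inj := covering_locally_inj Hr Hc.
have [w0 _ w0E] : leaf r t0 (phi (disk0 R)) by rewrite -Hr; exists (disk0 R).
have loc1 : forall z, exists2 e, 0 < e & forall z1 w1, pd z z1 < e -> phi z1 = q w1 ->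
    exists2 f, f z1 = w1 & lift_on phi q [set y | pd z y < e] f.
  move=> y; have [e e0 He] := leaf_holomorphic_lifts Hh y; exists e => // z1 w1 yz1 E.
  have [f [f1 Ef Df]] := He z1 w1 yz1 E; exists f => // y' yy'; split; first exact: Ef.
  by have [c /cdiff_ccont] := Df y' yy'; apply: (dcont_ccont _ _).1.
have [f f0 Lf] := lift_exists qinj loc1 (esym w0E).
(* The lift is so far only continuous. Near y it coincides with the holomorphic branch through f y,
   by local injectivity of [q]. *)
have Df : dholo f.
  move=> y; have [e e0 He] := leaf_holomorphic_lifts Hh y.
  have [pf cf] := Lf y I.
  have [g [gy Eg Dg]] := He y (f y) ltac:(by rewrite pdxx) pf.
  have [c Hc'] := Dg y ltac:(by rewrite pdxx); exists c.
  have cg : dcont g y by apply: (dcont_ccont _ _).1; exact: cdiff_ccont Hc'.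
  have [d d0 Hd] := qinj (f y); have [d1 d10 H1] := cf d d0; have [d2 d20 H2] := cg d d0.
  rewrite gy in H2.
  have m0 : 0 < Num.min e (Num.min d1 d2) by rewrite !lt_min e0 d10.
  have fg y' : pd y y' < Num.min e (Num.min d1 d2) -> g y' = f y'.
    rewrite !lt_min => /and3P[ye /H1 h1 /H2 h2]; apply: Hd => //.
    by rewrite -Eg // (Lf y' I).1.
  have /nbhs_disk_cmod[d3 d30 H3] : nbhs y [set y' | pd y y' < Num.min e (Num.min d1 d2)].
    by apply/nbhs_disk; exists (Num.min e (Num.min d1 d2)).
  have n0 : 0 < Num.min d3 (1 - cmod (dval y)) by rewrite lt_min d30 subr_gt0 dval_lt1.
  apply: cdiff_eq n0 _ Hc' => w; rewrite lt_min => /andP[wd w1].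
  have w1' : cmod w < 1 by have := cmod_subr_ge w (dval y); lra.
  by rewrite /ext fg //; apply: H3; rewrite mkdiskK.
(* Lift [q] through [phi] along the automorphism moving the base point to 0. *)
have [b ab] : exists b, translation w0 b = disk0 R by exact: translation_surj.
pose q' y := q (translation w0 y).
have tcont y : dcont (translation w0) y by move=> e e0; exists e => // w; rewrite pd_translation.
have loc2 : forall z, exists2 e, 0 < e & forall z1 w1, pd z z1 < e -> q' z1 = phi w1 ->
    exists2 k, k z1 = w1 & lift_on q' phi [set y | pd z y < e] k.
  move=> y; have [e e0 He] := covering_lifts Hr Hc (translation w0 y); exists e => // z1 w1 yz1 E.
  have [k k1 Lk] := He (translation w0 z1) w1 ltac:(by rewrite pd_translation) E.
  exists (k \o translation w0) => // y' yy'.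
  have [|Ek ck] := Lk (translation w0 y'); first by rewrite /= pd_translation.
  by split=> //; apply: dcont_comp.
have [|k' k'0 Lk'] := lift_exists phi_inj loc2 (w0 := disk0 R).
  by rewrite /q' translation0 /q w0E.
have /choice[tinv Ht] := fun y => translation_surj w0 y.
have tinvK y : tinv (translation w0 y) = y.
  by apply: pd_eq0; rewrite -(pd_translation w0) Ht pdxx.
pose k y := k' (tinv y).
have ticont y : dcont tinv y by move=> e e0; exists e => // w; rewrite -(pd_translation w0 (tinv _)) !Ht.
have Lk : lift_on q phi setT k.
  move=> y _; have [E c] := Lk' (tinv y) I; split; first by rewrite -E /q' Ht.
  exact: dcont_comp.
have k0 : k w0 = disk0 R by rewrite /k -[X in tinv X](translation0 w0) tinvK.
have cvT : dconvex [set: D] by [].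
have kf y : k (f y) = y.
  apply: (@lift_on_unique _ _ phi phi phi_inj setT (k \o f) id (disk0 R)) => //=.
  - exact: openT.
  - move=> u _; have [E c] := Lf u I; have [E' c'] := Lk (f u) I; split.
      exact: etrans E E'.
    exact: dcont_comp.
  - by move=> u _; split=> //; exact: dcont_id.
  - by rewrite f0 k0.
have fk y : f (k y) = y.
  apply: (@lift_on_unique _ _ q q qinj setT (f \o k) id w0) => //=.
  - exact: openT.
  - move=> u _; have [E c] := Lk u I; have [E' c'] := Lf (k u) I; split.
      exact: etrans E E'.
    exact: dcont_comp.
  - by move=> u _; split=> //; exact: dcont_id.
  - by rewrite k0 f0.
(* The leaf is parametrized by [t0], whereas the base point is given with t; an element of Gamma
   relates the two and is composed with [f]. *)
have : susp_pi r (f (disk0 R)) t0 = susp_pi r z t by rewrite -phi0 (Lf (disk0 R) I).1.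
move=> /susp_eqP[a Ga [az at_]].
have [a' [Ga' aa' a'a]] := Gam_inv Ga.
have [Da _] := aut_diskP (aut_set_sub Ga).
have [Da' _] := aut_diskP (aut_set_sub Ga').
have [|||y|th Hth] := @translation_rotation_form R (a \o f) (k \o a').
- by move=> y /=; rewrite aa' kf.
- by move=> y /=; rewrite fk a'a.
- move=> y; have [c Hc'] := Df y; have [c' Hc''] := Da (f y); exists (c' * c).
  exact: cdiff_ext_comp.
- apply: dcont_comp; first exact: dholo_dcont.
  by have [] := Lk (a' y) I.
exists th => xi; rewrite (Lf xi I).1 /q -(susp_pi_act _ _ Ga) at_.
by rewrite -[X in translation X _]az -[a (f (disk0 R))]/((a \o f) (disk0 R)) -Hth.
Qed.
End LeafNormalForm.

(** * The action of Gamma and the Svarc-Milnor lemma *)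

Section Cocompact.
Variables (R : realType) (Gam : aut_subgroup R).
Local Notation D := (unit_disk R).
Local Notation pd := (@poincare_dist R).
Local Notation o := (disk0 R).
Implicit Types (x y z w : D).

Lemma Gam_open_saturation (U : set D) : open U -> open [set z | exists2 a, Gam a & U (a z)].
Proof.
move=> oU; apply/open_disk => z [a Ga /=]; have /open_disk H := oU.
by move=> /H[e e0 He]; exists e => // w zw; exists a => //; apply: He; rewrite (Gam_isometry _ _ Ga).
Qed.

(** The images of the balls of integer radius about 0 form an open cover of the compact quotient. *)
Lemma cocompact_radius : compact [set: surface Gam] ->
  exists2 q, 0 <= q & forall z, exists2 a, Gam a & pd o (a z) <= q.
Proof.
move=> cS.
pose f (n : nat) : set (surface Gam) := [set X | exists2 z, pd o z < n%:R & X = orbit_pi (disk_action Gam) z].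
have fE n : orbit_pi (disk_action Gam) @^-1` f n = [set z | exists2 a, Gam a & [set y | pd o y < n%:R] (a z)].
  apply/seteqP; split=> z /=.
    by move=> [w wn] /eqquotP /asboolP[a Ga /= az]; exists a => //; rewrite az.
  by move=> [a Ga an]; exists (a z) => //; apply/eqquotP/asboolP; exists a.
have [||s Hs] := @compact_open_cover _ _ nat f cS.
- move=> n; rewrite /open /=; change (open (orbit_pi (disk_action Gam) @^-1` f n)).
  by rewrite fE; apply: Gam_open_saturation; exact: open_pd_ball.
- move=> X _; rewrite -(reprK X); exists (Num.truncn (pd o (repr X))).+1.
  by exists (repr X) => //; exact: truncnS_gt.
have [q q0 Hq] : exists2 q : R, 0 <= q & forall n, n \in s -> n%:R <= q.
  elim: {Hs} s => [|n s [q q0 Hq]]; first by exists 0.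
  exists (Num.max n%:R q) => [|m]; first by rewrite le_max q0 orbT.
  by rewrite inE le_max => /predU1P[->|/Hq->]; rewrite ?lexx ?orbT.
exists q => // z; have [n ns] := Hs (orbit_pi (disk_action Gam) z) I.
have -> : f n (orbit_pi (disk_action Gam) z) = (orbit_pi (disk_action Gam) @^-1` f n) z by [].
rewrite fE => -[a Ga /= an]; exists a => //.
by apply: le_trans (Hq n ns); exact: ltW.
Qed.

Variable q : R.
Hypothesis q0 : 0 <= q.
Hypothesis Hq : forall z, exists2 a, Gam a & pd o (a z) <= q.

(** A Lebesgue number on the ball of radius q, with local radii given by the deck property.
    Conjugation by an element bringing z into that ball preserves the displacement, which extends
    the bound to the whole disk. *)
Lemma injectivity_radius : acts_by_deck_transformations Gam ->
  exists2 e, 0 < e & forall a z, Gam a -> pd z (a z) < e -> a = idfun.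
Proof.
move=> deck.
have /choice[e He] : forall z, exists e : R, 0 < e /\ forall a y, Gam a ->
    pd z y < e -> pd z (a y) < e -> a = idfun.
  move=> z; have [V /nbhs_disk[e e0 He] HV] := deck z; exists e; split=> // a y Ga zy zay.
  apply: contrapT => a1; have : (a @` V `&` V) (a y) by split; [exists y => //; exact: He|exact: He].
  by rewrite HV.
have e20 z : 0 < e z / 2 by rewrite divr_gt0 //; exact: (He z).1.
have [s Hs] := @finite_cover_pd R q _ e20.
have [m m0 Hm] := @min_radius R _ s _ e20; exists m => // a z Ga za.
have [b Gb bz] := Hq z; have [b' [Gb' bb' b'b]] := Gam_inv Gb.
have [c cs cz] := Hs (b z) bz; have ec := Hm c cs; have [ec0 Hc] := He c.
have c1 : b \o a \o b' = idfun.
  apply: (Hc _ (b z)).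
  - by apply: aut_setM => //; exact: aut_setM.
  - by lra.
  - apply: le_lt_trans (pd_triangle (b z) _ _) _; rewrite /= bb' (Gam_isometry _ _ Gb); lra.
apply/funext => y; apply: (can_inj bb').
by have := congr1 (fun f => f (b y)) c1; rewrite /= bb'.
Qed.

Lemma word_cat (A : Type) (s1 s2 : seq (A -> A)) : word (s1 ++ s2) = word s1 \o word s2.
Proof. by elim: s1 => [|a s1 IH] //=; rewrite IH. Qed.

Variable G : set (D -> D).
Hypothesis HG : symmetric_generators Gam G.

Lemma Gam_word s : {in s, forall b, G b} -> Gam (word s).
Proof.
have [_ GG _ _ _] := HG; elim: s => [|a s IH] H; first exact: aut_set1.
by apply: aut_setM; [apply: GG; apply: H; rewrite inE eqxx|apply: IH => b bs; apply: H; rewrite inE bs orbT].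
Qed.

Local Notation weight s := (\sum_(a <- s) poincare_weight a).

Lemma word_displacement s : {in s, forall b, G b} -> pd o (word s o) <= weight s.
Proof.
have [_ GG _ _ _] := HG; elim: s => [|a s IH] H; first by rewrite big_nil pdxx.
have Ga : Gam a by apply: GG; apply: H; rewrite inE eqxx.
rewrite big_cons /=; apply: le_trans (pd_triangle (a o) _ _) _.
rewrite (Gam_isometry _ _ Ga) lerD2l; apply: IH => b bs; apply: H; by rewrite inE bs orbT.
Qed.

Lemma Gam_displacement a b : Gam a -> Gam b -> cancel a b -> pd o (a o) = pd o (b o).
Proof. by move=> Ga Gb ab; rewrite -(Gam_isometry _ _ Gb) ab pdC. Qed.

(** Elements of Gamma are placed along the geodesic from 0 to a 0, within q of points one unit
    apart. Successive quotients move 0 by at most 2 q + 1, and words of bounded weight represent all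
    such elements; about d (0, a 0) of them are multiplied. *)
Theorem svarc_milnor : acts_by_deck_transformations Gam -> exists2 W, 0 < W &
  forall a, Gam a -> exists s, [/\ {in s, forall b, G b}, a = word s &
    weight s <= W * (pd o (a o) + 1)].
Proof.
move=> deck; have [e e0 He] := injectivity_radius deck; have [_ GG _ gen _] := HG.
have e20 : 0 < e / 2 by rewrite divr_gt0.
have [W W0 HW] : exists2 W, 0 < W & forall c, Gam c -> pd o (c o) <= 2 * q + 1 ->
    exists s, [/\ {in s, forall b, G b}, c = word s & weight s <= W].
  (* Two elements sending 0 into the same ball of radius e / 2 coincide by the injectivity radius,
     so one word per center is enough. *)
  have /choice[w Hw] : forall b : D, exists w : seq (D -> D), forall c, Gam c -> pd b (c o) < e / 2 ->
      {in w, forall b, G b} /\ c = word w.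
    move=> b; case: (pselect (exists2 c, Gam c & pd b (c o) < e / 2)) => [[c Gc bc]|nc]; last first.
      by exists [::] => c Gc bc; exfalso; apply: nc; exists c.
    have [w Gw cw] := gen c Gc; exists w => c' Gc' bc'; suff <- : c = c' by [].
    have [c1 [Gc1 cc1 c1c]] := Gam_inv Gc.
    have : c1 \o c' = idfun.
      apply: (He _ o); first exact: aut_setM.
      rewrite -(Gam_isometry _ _ Gc) /= c1c; apply: le_lt_trans (pd_triangle b _ _) _.
      by rewrite (pdC _ b); lra.
    move=> E; apply/funext => y; have := congr1 (fun f => c (f y)) E.
    by rewrite /= c1c.
  have [s Hs] := @finite_cover_pd R (2 * q + 1) _ (fun=> e20).
  have [W W0 HW] : exists2 W, 0 < W & forall b, b \in s -> weight (w b) <= W.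
    elim: {Hs} s => [|b s [W W0 HW]]; first by exists 1.
    exists (Num.max W (weight (w b))) => [|b']; first by rewrite lt_max W0.
    by rewrite inE le_max => /predU1P[->|/HW->]; rewrite ?lexx ?orbT.
  exists W => // c Gc cq; have [b bs bc] := Hs (c o) cq.
  have [Gw cw] := Hw b c Gc bc; exists (w b); split=> //; exact: HW.
exists W => // a Ga; set L := pd o (a o); have L0 : 0 <= L := pd_ge0 _ _.
pose n := (Num.truncn L).+1.
have nL : L <= n%:R * 1 by rewrite mulr1; apply/ltW/truncnS_gt.
have [p [p0 pn pS _]] := @geodesic_chain R (a o) n 1 isT nL.
(* The two ends are prescribed, so that the product of the quotients telescopes exactly to a. *)
have /choice[g Hgg] : forall k, exists c, [/\ Gam c, pd (c o) (p k) <= q, k = n -> c = a & k = 0%N -> c = idfun].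
  move=> k; have [k0|k0] := eqVneq k 0%N.
    exists idfun; split => //; [exact: aut_set1|by rewrite k0 p0 pdxx|by rewrite k0].
  have [kn|kn] := eqVneq k n.
    by exists a; split=> //; [rewrite kn pn pdxx|move=> k0'; rewrite k0' eqxx in k0].
  have [c Gc cp] := Hq (p k); have [c' [Gc' cc' c'c]] := Gam_inv Gc.
  exists c'; split=> //; [|by move=> k'; rewrite k' eqxx in kn|by move=> k'; rewrite k' eqxx in k0].
  by rewrite -(Gam_isometry _ _ Gc) c'c.
have Hk k : exists s, [/\ {in s, forall b, G b}, g k = word s & weight s <= W * k%:R].
  elim: k => [|k [s [Gs gs ws]]].
    by exists [::]; have [_ _ _ ->] := Hgg 0%N; rewrite // big_nil mulr0.
  have [Gk kp _ _] := Hgg k; have [Gk1 k1p _ _] := Hgg k.+1.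
  have [h [Gh gh hg]] := Gam_inv Gk.
  have [|s' [Gs' gs' ws']] := HW (h \o g k.+1) (aut_setM Gh Gk1).
    rewrite /= -(Gam_isometry _ _ Gk) hg; apply: le_trans (pd_triangle (p k) _ _) _.
    have := pd_triangle (p k.+1) (p k) (g k.+1 o); rewrite (pdC (p k.+1)); have := pS k; lra.
  exists (s ++ s'); split.
  - by move=> b; rewrite mem_cat => /orP[/Gs|/Gs'].
  - rewrite word_cat -gs -gs'; apply/funext => y; by rewrite /= hg.
  - by rewrite big_cat /= -natr1; lra.
have [s [Gs gs ws]] := Hk n; exists s; split=> //.
  by rewrite -gs; have [_ _ ga _] := Hgg n; rewrite ga.
apply: le_trans ws _; rewrite ler_wpM2l ?(ltW W0) // /n -natr1 lerD2r.
by rewrite truncn_le.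
Qed.
End Cocompact.

(** * Uniform continuity and separation in the suspension *)

Section Uniformity.
Variables (R : realType) (Gam : aut_subgroup R) (T : metricType R) (r : representation Gam T).
Variables (M : metricType R) (iota : suspension r -> M).
Hypothesis iota_emb : topological_embedding iota.
Hypothesis compactT : compact [set: T].
Local Notation D := (unit_disk R).
Local Notation pd := (@poincare_dist R).
Local Notation o := (disk0 R).
Implicit Types (x y z w : D) (s t : T).

Definition susp_dist (X Y : suspension r) : R := mdist (iota X) (iota Y).

Lemma nbhs_disk_prod z t (U : set (D * T)) : nbhs (z, t) U <->
  exists2 e, 0 < e & forall w s, pd z w < e -> mdist t s < e -> U (w, s).
Proof.
split.
  move=> [[A B] /= [/nbhs_disk[e1 e10 H1] /nbhs_ballP[e2 /= e20 H2]] AB].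
  exists (Num.min e1 e2) => [|w s]; first by rewrite lt_min e10.
  rewrite !lt_min => /andP[/H1 Aw _] /andP[_ ts]; apply: AB; split=> //.
  by apply: H2; rewrite ballEmdist.
move=> [e e0 He]; exists ([set w | pd z w < e], ball t e).
  by split=> /=; [apply/nbhs_disk; exists e|exact: nbhsx_ballx].
by move=> [w s] /= [zw]; rewrite ballEmdist => ts; exact: He.
Qed.

Lemma susp_pi_near z t e : 0 < e -> exists2 d, 0 < d & forall w s, pd z w < d -> mdist t s < d ->
  susp_dist (susp_pi r z t) (susp_pi r w s) < e.
Proof.
move=> e0; have oB : open [set Y : M | mdist (iota (susp_pi r z t)) Y < e].
  rewrite openE => Y /= h; apply/nbhs_ballP; exists (e - mdist (iota (susp_pi r z t)) Y) => /=.
    by rewrite subr_gt0.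
  move=> Z; rewrite ballEmdist => /= YZ.
  by apply: le_lt_trans (metric_triangle _ Y _) _; lra.
have oU : open (iota @^-1` [set Y : M | mdist (iota (susp_pi r z t)) Y < e]).
  by apply/(iota_emb.2 _).2; eexists; first exact: oB.
have {}oU : open (orbit_pi (diag_action r) @^-1` (iota @^-1` [set Y : M | mdist (iota (susp_pi r z t)) Y < e])).
  exact: oU.
have : nbhs ((z, t) : D * T) (orbit_pi (diag_action r) @^-1` (iota @^-1` [set Y : M | mdist (iota (susp_pi r z t)) Y < e])).
  by apply: open_nbhs_nbhs; split=> //=; rewrite mdistxx.
by move=> /nbhs_disk_prod[d d0 H]; exists d => // w s zw ts; exact: H.
Qed.

(** The preimage is the union of the Gamma-translates of a product box; Gamma acts by isometries on
    the disk and by homeomorphisms on T. *)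
Lemma susp_box_open z t e :
  open [set X | exists w s, [/\ pd z w < e, mdist t s < e & X = susp_pi r w s]].
Proof.
set O := (X in open X).
change (open (orbit_pi (diag_action r) @^-1` O)); rewrite openE => -[w s] [w' [s' [zw ts E]]].
have /susp_eqP[a Ga [aw as_]] : susp_pi r w s = susp_pi r w' s' by exact: E.
rewrite -aw in zw; rewrite -as_ in ts.
have ra : {for s, continuous (r a)} by have [c _] := rho_homeo r Ga; exact: c.
have : nbhs (r a s) (ball (r a s) (e - mdist t (r a s))) by apply: nbhsx_ballx; rewrite subr_gt0.
move=> /ra /nbhs_ballP[d /= d0 Hd].
apply/nbhs_disk_prod; exists (Num.min d (e - pd z (a w))); first by rewrite lt_min d0 subr_gt0.
move=> v u; rewrite !lt_min => /andP[_ wv] /andP[su _].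
exists (a v), (r a u); split.
- apply: le_lt_trans (pd_triangle (a w) _ _) _; rewrite (Gam_isometry _ _ Ga); lra.
- have := Hd u; rewrite !ballEmdist /= => /(_ su) h.
  by apply: le_lt_trans (metric_triangle _ (r a s) _) _; lra.
- by rewrite susp_pi_act.
Qed.

Lemma susp_box_ball z t e : 0 < e -> exists2 d, 0 < d & forall w s,
  susp_dist (susp_pi r z t) (susp_pi r w s) < d ->
  exists2 a, Gam a & pd z (a w) < e /\ mdist t (r a s) < e.
Proof.
move=> e0; have /(iota_emb.2 _)[V oV VE] := @susp_box_open z t e.
have : V (iota (susp_pi r z t)).
  suff : (iota @^-1` V) (susp_pi r z t) by [].
  by rewrite VE; exists z, t; rewrite pdxx mdistxx.
have := oV; rewrite openE => /[apply] /nbhs_ballP[d /= d0 Hd]; exists d => // w s h.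
have : (iota @^-1` V) (susp_pi r w s) by apply: Hd; rewrite ballEmdist.
rewrite VE => -[w' [s' [zw ts /susp_eqP[a Ga [aw as_]]]]].
by exists a => //; rewrite aw as_.
Qed.

(** A Lebesgue number for the compact product of a closed ball and T. The restriction to the ball
    matters since Gamma need not act on T by isometries; every orbit meets it when q is the
    cocompactness radius. *)
Lemma susp_uniformly_continuous q e : 0 < e -> exists2 d, 0 < d & forall z w t s,
  pd o z <= q -> pd z w < d -> mdist t s < d -> susp_dist (susp_pi r z t) (susp_pi r w s) < e.
Proof.
move=> e0; have e20 : 0 < e / 2 by rewrite divr_gt0.
have /choice[d Hd] : forall zt : D * T, exists d, 0 < d /\ forall w s, pd zt.1 w < d -> mdist zt.2 s < d ->
    susp_dist (susp_pi r zt.1 zt.2) (susp_pi r w s) < e / 2.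
  by move=> [z t]; have [d d0 H] := susp_pi_near z t e20; exists d.
have d20 z t : 0 < d (z, t) / 2 by rewrite divr_gt0 //; exact: (Hd (z, t)).1.
have [L HL] := finite_cover_prod (@finite_cover_pd R q) (finite_cover_compact compactT) d20.
have [m m0 Hm] := @min_radius R _ L (fun p => d p / 2) (fun p => ltac:(by case: p => z t; exact: d20)).
exists m => // z w t s zq zw ts; have [p pL [p1 p2]] := HL z t zq I.
have := Hm p pL; have [dp0 Hp] := Hd p; rewrite -surjective_pairing in p1 p2 => mp.
have A := Hp z t ltac:(lra) ltac:(lra).
have B : susp_dist (susp_pi r p.1 p.2) (susp_pi r w s) < e / 2.
  apply: Hp; first by apply: le_lt_trans (pd_triangle z _ _) _; lra.
  by apply: le_lt_trans (metric_triangle _ t _) _; lra.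
rewrite /susp_dist in A B *.
by apply: le_lt_trans (metric_triangle _ (iota (susp_pi r p.1 p.2)) _) _; rewrite metric_sym; lra.
Qed.

(** The converse uniformity: nearness in the suspension gives nearness in the product after an
    element of Gamma. At each center, [d.1] is the size of the box in the cover and [d.2] the
    distance threshold, halved so that it survives moving from the center to (z, t). *)
Lemma susp_uniformly_separated q e : 0 < e -> exists2 d, 0 < d & forall z w t s,
  pd o z <= q -> susp_dist (susp_pi r z t) (susp_pi r w s) < d ->
  exists2 a, Gam a & pd z (a w) < e /\ mdist t (r a s) < e.
Proof.
move=> e0; have e20 : 0 < e / 2 by rewrite divr_gt0.
have /choice[d Hd] : forall zt : D * T, exists d : R * R, [/\ 0 < d.1, 0 < d.2,
    d.1 <= e / 2, forall w s, pd zt.1 w < d.1 -> mdist zt.2 s < d.1 ->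
      susp_dist (susp_pi r zt.1 zt.2) (susp_pi r w s) < d.2 &
    forall w s, susp_dist (susp_pi r zt.1 zt.2) (susp_pi r w s) < 2 * d.2 ->
      exists2 a, Gam a & pd zt.1 (a w) < e / 2 /\ mdist zt.2 (r a s) < e / 2].
  move=> [z t]; have [d d0 Hd] := susp_box_ball z t e20.
  have d20 : 0 < d / 2 by rewrite divr_gt0.
  have [d' d'0 Hd'] := susp_pi_near z t d20; exists (Num.min d' (e / 2), d / 2).
  have dd : 2 * (d / 2) = d by field.
  split=> //=; rewrite ?dd //; first by rewrite lt_min d'0.
    by rewrite ge_min lexx orbT.
  by move=> w s; rewrite !lt_min => /andP[zw _] /andP[ts _]; exact: Hd'.
have d10 z t : 0 < (d (z, t)).1 by have [] := Hd (z, t).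
have [L HL] := finite_cover_prod (@finite_cover_pd R q) (finite_cover_compact compactT) d10.
have d20 p : 0 < (d p).2 by have [] := Hd p.
have [m m0 Hm] := @min_radius R _ L _ d20.
exists m => // z w t s zq zw; have [p pL [p1 p2]] := HL z t zq I.
have mp := Hm p pL; have [dp1 dp2 de Hp Hp'] := Hd p; rewrite -surjective_pairing in p1 p2.
have A := Hp z t p1 p2.
have [|a Ga [a1 a2]] := Hp' w s.
  apply: le_lt_trans (metric_triangle _ (iota (susp_pi r z t)) _) _.
  by rewrite /susp_dist in A zw; lra.
exists a => //; split.
  by apply: le_lt_trans (pd_triangle p.1 _ _) _; rewrite (pdC z); lra.
by apply: le_lt_trans (metric_triangle _ p.2 _) _; rewrite (metric_sym t); lra.
Qed.
End Uniformity.

(** * Counting balls *)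

Section Counting.
Variable R : realType.

Lemma covering_number_le_card (X : Type) (delta : X -> X -> \bar R) (Y : set X) (e : R)
  (F : finType) (c : F -> X) : (forall y, Y y -> exists i, (delta (c i) y < e%:E)%E) ->
  (covering_number delta Y e <= (#|F|%:R)%:E)%E.
Proof.
move=> H; apply: ereal_inf_lbound; exists #|F| => //; exists (c \o enum_val) => y /H[i yi].
by exists (enum_rank i) => //=; rewrite enum_rankK.
Qed.

Lemma le_covering_number (X : Type) (delta : X -> X -> \bar R) (Y : set X) (e : R) (a : \bar R) :
  (forall n (c : 'I_n -> X), (forall y, Y y -> exists i, (delta (c i) y < e%:E)%E) ->
     (a <= (n%:R)%:E)%E) -> (a <= covering_number delta Y e)%E.
Proof.
move=> H; apply: le_ereal_inf_tmp => _ [n [c Hc] <-]; apply: (H n c) => y /Hc[i _ yi].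
by exists i.
Qed.

Lemma covering_number_ge0 (X : Type) (delta : X -> X -> \bar R) (Y : set X) (e : R) :
  (0 <= covering_number delta Y e)%E.
Proof. by apply: le_covering_number => n c _; rewrite lee_fin ler0n. Qed.

(** A separated family of maximal size is a net. The factor k keeps the size of the grid in the
    disk: each separated point of T accounts for k different balls. *)
Lemma maximal_separated (T : Type) (close : T -> T -> Prop) (N k : nat) : (0 < k)%N ->
  (forall t, close t t) -> (forall t s, close t s -> close s t) ->
  (forall m (f : 'I_m -> T), (forall i j, i != j -> ~ close (f i) (f j)) -> (m * k <= N)%N) ->
  exists m (f : 'I_m -> T), (m * k <= N)%N /\ forall t, exists i, close (f i) t.
Proof.
move=> k0 refl sym bound.
pose sep m := `[< exists f : 'I_m -> T, forall i j, i != j -> ~ close (f i) (f j) >].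
have sep0 : sep 0%N by apply/asboolP; exists (fun i : 'I_0 => False_rect T (notF (ltn_ord i))); case.
have sepN m : sep m -> (m <= N)%N.
  by move=> /asboolP[f /bound]; apply: leq_trans; rewrite leq_pmulr.
have exsep : exists m, sep m by exists 0%N.
case: (ex_maxnP exsep sepN) => m /asboolP[f Hf] max; exists m, f; split; first exact: (bound m f Hf).
move=> t; apply: contrapT => nt.
suff /max : sep m.+1 by rewrite ltnn.
apply/asboolP; exists (fun i => oapp f t (unlift ord_max i)) => i j.
case: unliftP => [i' ->|->]; case: unliftP => [j' ->|->] //=.
- by move=> ij; apply: Hf; apply: contra_neq ij => ->.
- by move=> _ h; apply: nt; exists i'.
- by move=> _ h; apply: nt; exists j'; exact: sym.
- by rewrite eqxx.
Qed.
End Counting.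

(** * Leafwise distance against weighted distance *)

Section Dynamics.
Variables (R : realType) (Gam : aut_subgroup R) (T : metricType R) (r : representation Gam T).
Variables (M : metricType R) (iota : suspension r -> M).
Variable phi : suspension r -> unit_disk R -> suspension r.
Variable G : set (unit_disk R -> unit_disk R).
Local Notation D := (unit_disk R).
Local Notation pd := (@poincare_dist R).
Local Notation o := (disk0 R).
Local Notation weight s := (\sum_(a <- s) poincare_weight a).
Implicit Types (x y z xi : D) (t : T).

Hypothesis deck : acts_by_deck_transformations Gam.
Hypothesis iota_emb : topological_embedding iota.
Hypothesis compactT : compact [set: T].
Hypothesis Hphi : forall X, leaf_uniformization X (phi X).
Hypothesis HG : symmetric_generators Gam G.
Variable q : R.
Hypothesis q0 : 0 <= q.
Hypothesis Hq : forall z, exists2 a, Gam a & pd o (a z) <= q.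

Local Notation sdist := (susp_dist iota).

Lemma leafwise_dist_lt rad (X Y : suspension r) (e : R) :
  (leafwise_dist iota phi rad X Y < e%:E)%E ->
  exists th, forall xi, closed_disk rad xi -> sdist (phi X xi) (phi Y (rotation th xi)) < e.
Proof.
move=> /ereal_inf_lt[_ [th _ <-]] h; exists th => xi xr; rewrite -lte_fin.
by apply: le_lt_trans h; apply: ereal_sup_ubound; exists xi.
Qed.

Lemma leafwise_dist_le rad (X Y : suspension r) (e th : R) :
  (forall xi, closed_disk rad xi -> sdist (phi X xi) (phi Y (rotation th xi)) <= e) ->
  (leafwise_dist iota phi rad X Y <= e%:E)%E.
Proof.
move=> H; apply: ge_ereal_inf; exists (ereal_sup
      [set (sdist (phi X xi) (phi Y (rotation th xi)))%:E | xi in closed_disk rad]).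
  by exists th.
by apply: ge_ereal_sup => _ [xi /H h <-]; rewrite lee_fin.
Qed.

Lemma weighted_dist_lt rad (t s : T) (e : R) :
  (weighted_dist r G (@poincare_weight R) rad t s < e%:E)%E ->
  forall w, {in w, forall a, G a} -> weight w <= rad -> mdist (r (word w) t) (r (word w) s) < e.
Proof.
move=> h w Gw ww; rewrite -lte_fin; apply: le_lt_trans h; apply: ereal_sup_ubound.
by exists w.
Qed.

Lemma weighted_dist_le rad (t s : T) (e : R) :
  (forall w, {in w, forall a, G a} -> weight w <= rad ->
     mdist (r (word w) t) (r (word w) s) <= e) ->
  (weighted_dist r G (@poincare_weight R) rad t s <= e%:E)%E.
Proof. by move=> H; apply: ge_ereal_sup => _ [w [Gw ww] <-]; rewrite lee_fin H. Qed.

(** The triangle inequality through the leaf of the center. Rotating the parameter removes the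
    rotation from the first point and collects all angles in the second, hyperbolic disks about 0
    being rotation invariant. *)
Lemma common_ball rad (C : suspension r) z t z' t' (e : R) :
  (leafwise_dist iota phi rad C (susp_pi r z t) < e%:E)%E ->
  (leafwise_dist iota phi rad C (susp_pi r z' t') < e%:E)%E ->
  exists th, forall xi, pd o xi < rad ->
    sdist (susp_pi r (translation z xi) t) (susp_pi r (translation z' (rotation th xi)) t') < 2 * e.
Proof.
move=> /leafwise_dist_lt[th1 H1] /leafwise_dist_lt[th2 H2].
have [al Hal] := leaf_uniformization_form deck (Hphi (susp_pi r z t)).
have [be Hbe] := leaf_uniformization_form deck (Hphi (susp_pi r z' t')).
exists (be + th2 - (al + th1)) => xi xr.
pose ze := rotation (- (al + th1)) xi.
have zr : closed_disk rad ze.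
  by apply: closed_disk_lt; rewrite -(rotation0 (- (al + th1))) pd_rotation.
have := H1 ze zr; have := H2 ze zr.
rewrite Hal Hbe /ze !rotationD.
rewrite subrr rotation_id /susp_dist => h2 h1.
by apply: le_lt_trans (metric_triangle _ (iota (phi C ze)) _) _; rewrite metric_sym /ze; lra.
Qed.

(* The element of Gamma matching the two leafwise disks is locally constant along rays by the
   injectivity radius, and it is the identity at the center. *)
Lemma shadowing (e0 : R) : 0 < e0 -> (forall a z, Gam a -> pd z (a z) < e0 -> a = idfun) ->
  forall eta, 0 < eta -> 5 * eta <= e0 ->
  exists2 d, 0 < d & forall z t z' t' th rad, 0 < rad -> pd o z <= eta -> pd o z' <= eta ->
    (forall xi, pd o xi < rad ->
       sdist (susp_pi r (translation z xi) t) (susp_pi r (translation z' (rotation th xi)) t') < d) ->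
    (forall xi, pd o xi < rad -> pd (translation z xi) (translation z' (rotation th xi)) < eta) /\
    forall w, {in w, forall a, G a} -> weight w <= rad - 2 * eta ->
      mdist (r (word w) t) (r (word w) t') < eta.
Proof.
move=> e00 inj eta eta0 eta5.
have [d d0 Hd] := susp_uniformly_separated iota_emb compactT q eta0.
exists d => // z t z' t' th rad rad0 zo z'o H.
(* Here 4 eta + eta stays within the injectivity radius. Along the chain below the two disks
   separate by at most 3 eta between consecutive points, which leaves room. *)
have near_id x y a : Gam a -> pd x (a y) < eta -> pd x y <= 4 * eta -> a = idfun.
  move=> Ga xa xy; apply: (inj a y Ga).
  by apply: le_lt_trans (pd_triangle x _ _) _; rewrite (pdC y); lra.
have step xi : pd o xi < rad -> exists2 a, Gam a &
    pd (translation z xi) (a (translation z' (rotation th xi))) < eta.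
  (* Uniform separation holds near the ball of radius q, so both points are first moved by b and
     then back. *)
  move=> xr; have [b Gb bq] := Hq (translation z xi); have [b' [Gb' bb' b'b]] := Gam_inv Gb.
  have := H xi xr; rewrite -(susp_pi_act r _ _ Gb) => /(Hd _ _ _ _ bq)[a Ga [ab _]].
  exists (b' \o a); first exact: aut_setM.
  by rewrite -(Gam_isometry _ _ Gb) /= b'b.
have close xi : pd o xi < rad -> pd (translation z xi) (translation z' (rotation th xi)) < eta.
  move=> xr; pose n := (Num.truncn (pd o xi / eta)).+1.
  have xn : pd o xi <= n%:R * eta by rewrite -ler_pdivrMr //; apply/ltW/truncnS_gt.
  have [p [p0 pn pS pr]] := @geodesic_chain R xi n eta isT xn.
  have K k : (k <= n)%N -> pd (translation z (p k)) (translation z' (rotation th (p k))) < eta.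
    elim: k => [_|k IH kn].
      have [|a Ga] := step (p 0%N); first by rewrite p0 pdxx.
      rewrite p0 rotation0 !translation0 => za.
      have a1 : a = idfun.
        apply: near_id Ga za _; apply: le_trans (pd_triangle o _ _) _.
        by rewrite (pdC z); lra.
      by rewrite a1 in za.
    have [|a Ga ak] := step (p k.+1); first by apply: le_lt_trans (pr _ kn) xr.
    have {}IH := IH (ltnW kn).
    have a1 : a = idfun; last by rewrite a1 in ak.
    apply: near_id Ga ak _; apply: le_trans (pd_triangle (translation z (p k)) _ _) _.
    rewrite pd_translation (pdC (p k.+1)).
    have := pd_triangle (translation z' (rotation th (p k))) (translation z (p k)) (translation z' (rotation th (p k.+1))).
    by rewrite pd_translation pd_rotation; have := pS k; lra.
  by rewrite -pn; exact: K.
split=> // w Gw ww.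
have Ga := Gam_word HG Gw; have wd := word_displacement HG Gw.
set a := word w in Ga wd *; have [a' [Ga' aa' a'a]] := Gam_inv Ga.
(* At this xi the first disk passes through a^-1 0. Applying a brings it to 0 and turns the
   T-coordinates into their images under a; d (0, xi) < rad because the weight bounds d (0, a 0) and
   z is within eta of 0. *)
have [xi xiE] := translation_surj z (a' o).
have xr : pd o xi < rad.
  rewrite -(pd_translation z) translation0 xiE; apply: le_lt_trans (pd_triangle o _ _) _.
  by rewrite (pdC z) -(Gam_displacement Ga Ga' aa'); lra.
have := H xi xr; have := close xi xr; rewrite xiE.
set y := translation z' _ => ay.
rewrite -(susp_pi_act r _ _ Ga) -(susp_pi_act r y t' Ga) a'a => /(Hd o (a y) _ _).
rewrite pdxx => /(_ q0)[b Gb [b1 b2]].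
have oy : pd o (a y) < eta by have := Gam_isometry (a' o) y Ga; rewrite a'a => ->.
have b3 : b = idfun by apply: near_id Gb b1 _; lra.
by rewrite b3 rho1 in b2.
Qed.

(** The angle is chosen to cancel the rotations of the two normal forms. A point of the disk at
    scale rad returns to the ball of radius q by an element b with d (0, b 0) <= rad + 2 q, hence a
    word of weight at most W (rad + 2 q + 1). *)
Lemma word_reach (W : R) : 0 < W ->
  (forall a, Gam a -> exists s, [/\ {in s, forall b, G b}, a = word s &
     weight s <= W * (pd o (a o) + 1)]) ->
  forall e, 0 < e -> exists2 d, 0 < d & exists2 sg, 0 < sg & forall rad z z' t t',
    0 <= rad -> pd o z <= q -> pd o z' <= q -> cmod (dval z' - dval z) <= sg * expR (- rad) ->
    (weighted_dist r G (@poincare_weight R) (W * (rad + 2 * q + 1)) t t' < d%:E)%E ->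
    (leafwise_dist iota phi rad (susp_pi r z t) (susp_pi r z' t') < e%:E)%E.
Proof.
move=> W0 HW e e0; have e20 : 0 < e / 2 by rewrite divr_gt0.
have [d d0 Hd] := susp_uniformly_continuous iota_emb compactT q e20.
have /andP[l0 l1] := tanh_half_bnd q0; have ld := tanh_half_gt0 d0.
have q1 : 0 < 1 - tanh_half q by lra.
(* The constant of [mob_near] times sg equals tanh_half d / 2, so the disk coordinates stay within d
   at scale rad. *)
pose sg := tanh_half d * (1 - tanh_half q) ^+ 3 / 64.
have sg0 : 0 < sg.
  by apply: divr_gt0 => //; apply: mulr_gt0 => //; exact: exprn_gt0.
exists d => //; exists sg => // rad z z' t t' rad0 zq z'q zz' tt'.
have [al Hal] := leaf_uniformization_form deck (Hphi (susp_pi r z t)).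
have [be Hbe] := leaf_uniformization_form deck (Hphi (susp_pi r z' t')).
apply: (@le_lt_trans _ _ (e / 2)%:E); last by rewrite lte_fin; lra.
apply: (@leafwise_dist_le _ _ _ _ (al - be)) => xi /closed_disk_le xr.
rewrite Hal Hbe rotationD (_ : be + (al - be) = al); last by ring.
set ze := rotation al xi.
have zer : pd o ze <= rad by rewrite -(rotation0 al) pd_rotation.
have [b Gb bq] := Hq (translation z ze).
rewrite -(susp_pi_act r _ _ Gb) -[susp_pi r (translation z' ze) t'](susp_pi_act r _ _ Gb).
apply/ltW/Hd => //.
  rewrite (Gam_isometry _ _ Gb) pd_lt ?(ltW d0) // !dval_translation.
  have zl : cmod (dval z) <= tanh_half q by rewrite -pseudohyp0 -dval0 -pd_le.
  have z'l : cmod (dval z') <= tanh_half q by rewrite -pseudohyp0 -dval0 -pd_le.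
  have zel : artanh2 (cmod (dval ze)) <= rad by rewrite -pd0.
  apply: le_lt_trans (mob_near zl z'l l1 (dval_lt1 ze) zel) _.
  rewrite cmodBC; apply: (@le_lt_trans _ _ (32 / (1 - tanh_half q) ^+ 3 * expR rad * (sg * expR (- rad)))).
    by rewrite ler_wpM2l // mulr_ge0 ?expR_ge0 // divr_ge0 // exprn_ge0 // ltW.
  have -> : 32 / (1 - tanh_half q) ^+ 3 * expR rad * (sg * expR (- rad)) = tanh_half d / 2.
    by rewrite /sg expRN; field; rewrite !gt_eqF ?expR_gt0.
  by lra.
have [w [Gw bw ww]] := HW b Gb; rewrite bw; apply: weighted_dist_lt tt' _ Gw _.
apply: le_trans ww _; rewrite ler_wpM2l ?(ltW W0) // lerD2r.
apply: le_trans (pd_triangle (b (translation z ze)) _ _) _.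
rewrite (Gam_isometry _ _ Gb).
have := pd_triangle (translation z o) (translation z ze) o.
by rewrite pd_translation translation0 (pdC ze) (pdC z); lra.
Qed.

End Dynamics.

(** * Comparison of the two covering numbers *)

Section Counts.
Variables (R : realType) (Gam : aut_subgroup R) (T : metricType R) (r : representation Gam T).
Variables (M : metricType R) (iota : suspension r -> M).
Variable phi : suspension r -> unit_disk R -> suspension r.
Variable G : set (unit_disk R -> unit_disk R).
Local Notation D := (unit_disk R).
Local Notation pd := (@poincare_dist R).
Local Notation o := (disk0 R).
Local Notation weight s := (\sum_(a <- s) poincare_weight a).

Hypothesis deck : acts_by_deck_transformations Gam.
Hypothesis iota_emb : topological_embedding iota.
Hypothesis compactT : compact [set: T].
Hypothesis Hphi : forall X, leaf_uniformization X (phi X).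
Hypothesis HG : symmetric_generators Gam G.
Variable q : R.
Hypothesis q0 : 0 <= q.
Hypothesis Hq : forall z, exists2 a, Gam a & pd o (a z) <= q.

Local Notation NX rad e := (covering_number (leafwise_dist iota phi rad) setT e).
Local Notation NT rad e := (covering_number (weighted_dist r G (@poincare_weight R) rad) setT e).

(* Points of one ball at scale [rad] have their disk coordinates within O(exp (- rad)) and their
   T-coordinates close for [weighted_dist], so each ball contains at most one point of the grid [z]
   times a separated family. *)
Lemma lower_count_grid : exists2 e0, 0 < e0 & forall e, 0 < e -> e <= e0 ->
  exists2 d, 0 < d & forall rad (K : finType) (z : K -> D), 1 <= rad -> (0 < #|K|)%N ->
    (forall i, pd o (z i) <= e) ->
    (forall i j, i != j -> 64 * expR (1 - rad) < cmod (dval (z i) - dval (z j))) ->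
    ((#|K|%:R)%:E * NT (rad - 1)%R (2 * e)%R <= NX rad d)%E.
Proof.
have [e1 e10 inj] := injectivity_radius Hq deck.
have h12 : 0 < artanh2 (2^-1 : R) by rewrite -(artanh20 R) artanh2_lt; lra.
(* The first bound is the one required by [shadowing], the second puts centers and gaps below 1 / 2
   for [mob_far], and the third gives 2 e <= 1, so that weights up to rad - 1 are admissible. *)
exists (Num.min (e1 / 5) (Num.min (artanh2 2^-1) 2^-1)) => [|e e_0].
  by rewrite !lt_min h12 invr_gt0 divr_gt0 //= ltr0n.
rewrite !le_min => /and3P[ee1 ee2 ee3].
have ee5 : 5 * e <= e1 by lra.
have [d d0 Hd] := shadowing iota_emb compactT HG q0 Hq e10 inj e_0 ee5.
have d20 : 0 < d / 2 by rewrite divr_gt0.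
exists (d / 2) => // rad K z rad1 K0 zo zsep.
have rad0 : 0 < rad by lra.
pose close t s := forall w, {in w, forall a, G a} -> weight w <= rad - 1 ->
  mdist (r (word w) t) (r (word w) s) <= e.
apply: le_covering_number => n c Hc.
have /choice[ball Hball] : forall p : K * T, exists i,
    (leafwise_dist iota phi rad (c i) (susp_pi r (z p.1) p.2) < (d / 2)%:E)%E.
  by move=> p; exact: Hc.
have zhalf i : cmod (dval (z i)) <= 2^-1.
  rewrite -pseudohyp0 -dval0 -(@tanh_halfK R 2^-1); last by lra.
  by rewrite -pd_le ?(ltW h12) //; apply: le_trans (zo i) _.
have same (p p' : K * T) : ball p = ball p' -> p.1 = p'.1 /\ close p.2 p'.2.
  move=> bb; have H1 := Hball p; have H2 := Hball p'; rewrite -bb in H2.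
  have [th] := common_ball deck Hphi H1 H2; rewrite (_ : 2 * (d / 2) = d); last by field.
  move=> /(Hd _ _ _ _ th rad rad0 (zo _) (zo _))[near cl]; split; last first.
    by move=> w Gw ww; apply/ltW/cl => //; lra.
  apply: contrapT => /eqP /zsep; apply/negP; rewrite -leNgt (_ : 1 - rad = - (rad - 1)); last by ring.
  (* The unknown rotation is the unimodular factor. Nearness holds strictly inside radius rad,
     whence the circle at distance rad - 1. *)
  apply: (@mob_far R _ _ (cos th +i* sin th)) => //; [exact: cmod_angle|by lra|].
  move=> w wr; have /andP[l0 l1] : 0 <= tanh_half (rad - 1) < 1 by apply: tanh_half_bnd; lra.
  have w1 : cmod w < 1 by rewrite wr.
  have := near (mkdisk w); rewrite pd0 mkdiskK // wr artanh2K; last by lra.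
  move=> /(_ ltac:(lra)) h.
  have := @pseudohyp_dval R (translation (z p.1) (mkdisk w)) (translation (z p'.1) (rotation th (mkdisk w))).
  move: h; rewrite pdE !dval_translation dval_rotation mkdiskK // => h hb.
  by apply/ltW; rewrite -artanh2_lt //; lra.
(* Pairs of a separated point and a grid point lie in different balls, so m times the size of the
   grid is at most n. *)
have [|||m [f [mk cov]]] := @maximal_separated T close n #|K| K0.
- by move=> t w _ _; rewrite mdistxx ltW.
- by move=> t s H w Gw ww; rewrite metric_sym; exact: H.
- move=> m f Hf; have inj' : injective (fun p : 'I_m * K => ball (p.2, f p.1)).
    move=> [i k] [j l] /= /same[/= -> cl]; congr (_, _).
    by apply/eqP; apply: contrapT => /negP /Hf.
  by have := leq_card _ inj'; rewrite card_prod !card_ord.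
apply: (@le_trans _ _ ((#|K|%:R)%:E * (m%:R)%:E)%E).
  apply: lee_wpmul2l; first by rewrite lee_fin ler0n.
  rewrite -[X in (_ <= X%:R%:E)%E](card_ord m); apply: (@covering_number_le_card _ _ _ _ _ _ f) => t _.
  have [i Hi] := cov t; exists i; apply: (@le_lt_trans _ _ e%:E); last by rewrite lte_fin; lra.
  exact: weighted_dist_le.
by rewrite -EFinM lee_fin -natrM ler_nat mulnC.
Qed.

Lemma lower_count : exists2 e0, 0 < e0 & forall e, 0 < e -> e <= e0 ->
  exists2 d, 0 < d & exists2 c, 0 < c & exists rad0, forall rad, rad0 <= rad ->
    ((c * expR (2 * rad))%:E * NT (rad - 1)%R (2 * e)%R <= NX rad d)%E.
Proof.
have [e0 e00 H] := lower_count_grid; exists e0 => // e e_0 ee0.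
have [d d0 Hd] := H e e_0 ee0; exists d => //.
have le := tanh_half_gt0 e_0; have /andP[_ le1] := tanh_half_bnd (ltW e_0).
(* The spacing A exp (- rad) of the grid exceeds 64 exp (1 - rad), and a square of side tanh_half e
   / 2 has room for about b exp (rad) points in each direction. *)
pose A : R := 130 * expR 1.
have A0 : 0 < A by rewrite mulr_gt0 // expR_gt0.
pose b := tanh_half e / (2 * A).
have b0 : 0 < b by rewrite divr_gt0 // mulr_gt0.
exists ((b / 2) ^+ 2); first by rewrite exprn_gt0 // divr_gt0.
(* From this scale on b exp (rad) >= 2, so truncation loses at most half of the points in each
   direction. *)
exists (Num.max 1 (2 / b)) => rad; rewrite ge_max => /andP[rad1 rad2].
pose s := A * expR (- rad).
have s0 : 0 < s by rewrite mulr_gt0 // expR_gt0.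
pose n := Num.truncn (b * expR rad).
have E0 := expR_gt0 rad.
have be : 2 <= b * expR rad.
  have := expR_ge1Dx rad; rewrite ler_pdivrMr // in rad2; nra.
have /andP[n1 n2] : n%:R <= b * expR rad < n.+1%:R by apply: truncn_itv; lra.
have n3 : b * expR rad / 2 <= n%:R by rewrite -natr1 in n2; lra.
have ng : (0 < n)%N by rewrite -(@ltr0n R); lra.
have sb : s * (b * expR rad) = tanh_half e / 2.
  by rewrite /s /b expRN; field; rewrite !gt_eqF.
pose zc (p : 'I_n * 'I_n) : R[i] := (s * p.1%:R) +i* (s * p.2%:R).
have snat (i : 'I_n) : 0 <= s * i%:R <= tanh_half e / 2.
  rewrite mulr_ge0 ?ler0n ?(ltW s0) //= -sb ler_wpM2l ?(ltW s0) //.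
  by apply: le_trans n1; rewrite ler_nat ltnW.
have zcn p : cmod (zc p) <= tanh_half e.
  apply: le_trans (cmod_le_ReIm _) _; rewrite /zc /=.
  by rewrite !ger0_norm; have := snat p.1; have := snat p.2; lra.
have zc1 p : cmod (zc p) < 1 by apply: le_lt_trans (zcn p) le1.
pose z p := mkdisk (zc p).
have natsep (i j : 'I_n) : i != j -> s <= `|s * i%:R - s * j%:R|.
  move=> ij; rewrite -mulrBr normrM gtr0_norm // ler_peMr ?(ltW s0) //.
  wlog ij' : i j ij / (i < j)%N.
    move=> W; have := ij; rewrite neq_ltn => /orP[/W|/W h]; first by apply.
    by rewrite distrC; apply: h; rewrite eq_sym.
  rewrite distrC ger0_norm; last by rewrite subr_ge0 ler_nat ltnW.
  by rewrite lerBrDl natr1 ler_nat.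
have c1 : (0 < #|{: 'I_n * 'I_n}|)%N by rewrite card_prod card_ord muln_gt0 ng.
have c2 p : pd o (z p) <= e by rewrite pd_le ?(ltW e_0) // pseudohyp0 mkdiskK.
have c3 p p' : p != p' -> 64 * expR (1 - rad) < cmod (dval (z p) - dval (z p')).
  move=> pp'; rewrite /z !mkdiskK //.
  have ss : 64 * expR (1 - rad) < s.
    by rewrite /s /A expRD; have := mulr_gt0 (expR_gt0 1) (expR_gt0 (- rad)); lra.
  apply: lt_le_trans ss _.
  have [p1|p1] := eqVneq p.1 p'.1.
    apply: le_trans (Im_le_cmod _); rewrite ImB /=; apply: natsep.
    by apply: contraNneq pp' => p2; rewrite [p]surjective_pairing p1 p2 -surjective_pairing.
  by apply: le_trans (Re_le_cmod _); rewrite ReB /=; exact: natsep.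
apply: le_trans (Hd rad _ z rad1 c1 c2 c3).
apply: lee_wpmul2r; first exact: covering_number_ge0.
rewrite lee_fin card_prod card_ord natrM (_ : 2 * rad = rad + rad) ?expRD; last by ring.
have bE0 : 0 <= b * expR rad / 2 by lra.
by apply: le_trans (ler_pM bE0 bE0 n3 n3); rewrite le_eqVlt; apply/orP; left; apply/eqP; field.
Qed.

Lemma upper_count (W : R) : 0 < W ->
  (forall a, Gam a -> exists s, [/\ {in s, forall b, G b}, a = word s &
     weight s <= W * (pd o (a o) + 1)]) ->
  forall e, 0 < e -> exists2 d, 0 < d & exists2 C, 0 < C & forall rad, 0 <= rad ->
    (NX rad e <= (C * expR (2 * rad))%:E * NT (W * (rad + 2 * q + 1))%R d)%E.
Proof.
move=> W0 HW e e_0.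
have [d d0 [sg sg0 H]] := word_reach deck iota_emb compactT Hphi q0 Hq W0 HW e_0.
(* The square [-1, 1] ^ 2 is cut into N ^ 2 cells of side 2 / N <= sg exp (- rad) / 2, the two
   coordinates sharing the tolerance of [word_reach]. The added 1 absorbs rounding N up. *)
exists d => //; pose A := 4 / sg + 1.
have A0 : 0 < A by rewrite ltr_wpDl // divr_ge0 // ltW.
exists (A ^+ 2); first by rewrite exprn_gt0.
move=> rad rad0; have E0 := expR_gt0 rad; have E1 : 1 <= expR rad by rewrite -expR0 ler_expR.
have C0 : 0 < A ^+ 2 * expR (2 * rad) by rewrite mulr_gt0 ?expR_gt0 // exprn_gt0.
rewrite -lee_pdivrMl //; apply: le_covering_number => n c Hc; rewrite lee_pdivrMl //.
pose N := (Num.truncn (4 / sg * expR rad)).+1.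
have N0 : 0 < N%:R :> R by rewrite ltr0n.
have [N1 N2] : 4 / sg * expR rad < N%:R /\ N%:R <= A * expR rad.
  have x0 : 0 <= 4 / sg * expR rad by rewrite mulr_ge0 ?divr_ge0 // ltW.
  have /andP[h1 h2] := truncn_itv x0; split=> //.
  have -> : N%:R = (Num.truncn (4 / sg * expR rad))%:R + 1 :> R by rewrite /N natr1.
  have -> : A * expR rad = 4 / sg * expR rad + expR rad by rewrite /A mulrDl mul1r.
  by lra.
pose cell (x : R) : nat := Num.truncn ((x + 1) * (N%:R / 2)).
have cellN (x : R) : -1 <= x < 1 -> (cell x < N)%N.
  move=> x1; rewrite /cell -(@ltr_nat R).
  have x0 : 0 <= (x + 1) * (N%:R / 2) by rewrite mulr_ge0 ?divr_ge0 ?(ltW N0) //; lra.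
  have /andP[h1 h2] := truncn_itv x0; apply: le_lt_trans h1 _.
  have : 0 < (1 - x) * N%:R by rewrite mulr_gt0 // subr_gt0; case/andP: x1.
  by move: (N%:R : R) => u; lra.
have cell_close (x y : R) : -1 <= x < 1 -> -1 <= y < 1 -> cell x = cell y ->
    `|x - y| <= sg * expR (- rad) / 2.
  move=> x1 y1 xy.
  have x0 : 0 <= (x + 1) * (N%:R / 2) by rewrite mulr_ge0 ?divr_ge0 ?(ltW N0) //; lra.
  have y0 : 0 <= (y + 1) * (N%:R / 2) by rewrite mulr_ge0 ?divr_ge0 ?(ltW N0) //; lra.
  have /andP[h1 h2] := truncn_itv x0; have /andP[h3 h4] := truncn_itv y0.
  rewrite -/(cell x) xy in h1 h2; rewrite -/(cell y) in h3 h4; rewrite -[(cell y).+1%:R]natr1 in h2 h4.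
  have : `|x - y| * (N%:R / 2) <= 1.
    have nn : `|N%:R / 2 : R| = N%:R / 2 by rewrite ger0_norm // divr_ge0 // ltW.
    rewrite -nn -normrM ler_norml.
    by apply/andP; split; lra.
  have n0 := normr_ge0 (x - y).
  have -> : sg * expR (- rad) / 2 = 2 / (4 / sg * expR rad).
    by rewrite expRN; field; rewrite !gt_eqF.
  rewrite ler_pdivlMr; last by rewrite mulr_gt0 // divr_gt0.
  have : `|x - y| * (4 / sg * expR rad) <= `|x - y| * N%:R by rewrite ler_wpM2l // ltW.
  lra.
have bnd (z : D) : (-1 <= Re (dval z) < 1) /\ (-1 <= Im (dval z) < 1).
  have z1 := dval_lt1 z.
  have := le_lt_trans (Re_le_cmod _) z1; have := le_lt_trans (Im_le_cmod _) z1.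
  rewrite !ltr_norml => /andP[? ?] /andP[? ?].
  by split; apply/andP; split; lra.
(* Each cell meeting the ball of radius q is represented by one of its points there; the other cells
   get 0 as a harmless default. *)
have /choice[rep Hrep] : forall p : 'I_N * 'I_N, exists z0 : D, pd o z0 <= q /\
    forall z, pd o z <= q -> cell (Re (dval z)) = p.1 -> cell (Im (dval z)) = p.2 ->
      cell (Re (dval z0)) = p.1 /\ cell (Im (dval z0)) = p.2.
  move=> p; case: (pselect (exists z, [/\ pd o z <= q, cell (Re (dval z)) = p.1 & cell (Im (dval z)) = p.2])).
    by move=> [z [zq z1 z2]]; exists z.
  move=> nz; exists o; split; first by rewrite pdxx.
  by move=> z zq z1 z2; exfalso; apply: nz; exists z.
apply: (@le_trans _ _ ((#|{: ('I_N * 'I_N) * 'I_n}|%:R)%:E)).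
  apply: (@covering_number_le_card _ _ _ _ _ _ (fun p => susp_pi r (rep p.1) (c p.2))) => X _.
  have [z' [t' ->]] := susp_pi_surj X.
  have [a Ga aq] := Hq z'; rewrite -(susp_pi_act r _ _ Ga).
  have [bR bI] := bnd (a z'); have [i Hi] := Hc (r a t') I.
  pose p := (Ordinal (cellN _ bR), Ordinal (cellN _ bI)).
  have [rq] := Hrep p; move=> /(_ (a z') aq erefl erefl)[c1 c2].
  exists (p, i); apply: H => //=; apply: le_trans (cmod_le_ReIm _) _.
  have [rR rI] := bnd (rep p).
  have := cell_close _ _ bR rR (esym c1); have := cell_close _ _ bI rI (esym c2).
  by rewrite ReB ImB; lra.
rewrite lee_fin !card_prod !card_ord !natrM ler_wpM2r ?ler0n //.
have -> : A ^+ 2 * expR (2 * rad) = (A * expR rad) * (A * expR rad).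
  by rewrite (_ : 2 * rad = rad + rad) ?expRD; ring.
by rewrite ler_pM ?ler0n.
Qed.
End Counts.

(** * From exponential bounds on covering numbers to entropy *)

Section Growth.
Variable R : realType.
Implicit Types (N : R -> \bar R) (A B : R).

(** A form of the exponential rate in which count estimates are multiplied directly. A rate below A
    gives it, and it gives a rate at most A. *)
Definition growth_le N A := exists rad0, forall rad, rad0 < rad -> (N rad <= (expR (A * rad))%:E)%E.

Local Notation rate N := (limf_esup (fun rad : R => (rad^-1)%:E * lne (N rad))%E (pinfty_nbhs R)).

Lemma lne_le_exp (x : \bar R) (y : R) : (0 <= x)%E -> (lne x <= y%:E)%E = (x <= (expR y)%:E)%E.
Proof.
move=> x0; rewrite -[in LHS](expRK y) -lne_EFin ?expR_gt0 //.
by rewrite lee_lne // in_itv /= ?x0 ?leey // lee_fin expR_ge0.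
Qed.

Lemma growth_of_rate N A : (forall rad, (0 <= N rad)%E) -> (rate N < A%:E)%E -> growth_le N A.
Proof.
move=> N0 /ereal_inf_lt[_ [V [rad0 [_ HV]] <-]] h.
exists (Num.max 0 rad0) => rad; rewrite gt_max => /andP[rad_0 /HV Vrad].
rewrite -lne_le_exp // mulrC EFinM -lee_pdivrMl //; apply/ltW; apply: le_lt_trans h.
by apply: ereal_sup_ubound; exists rad.
Qed.

Lemma rate_of_growth N A : (forall rad, (0 <= N rad)%E) -> growth_le N A -> (rate N <= A%:E)%E.
Proof.
move=> N0 [rad0 H]; apply: ge_ereal_inf.
exists (ereal_sup [set ((rad^-1)%:E * lne (N rad))%E | rad in [set rad : R | Num.max 0 rad0 < rad]]).
  exists [set rad : R | Num.max 0 rad0 < rad] => //.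
  by exists (Num.max 0 rad0); rewrite num_real.
apply: ge_ereal_sup => _ [rad /= + <-]; rewrite gt_max => /andP[rad_0 /H].
by rewrite -lne_le_exp // lee_pdivrMl // -EFinM mulrC.
Qed.

Lemma growth_le_affine N A a e : 0 < e ->
  (exists rad0, forall rad, rad0 < rad -> (N rad <= (expR (a + A * rad))%:E)%E) ->
  growth_le N (A + e).
Proof.
move=> e0 [rad0 H]; exists (Num.max rad0 (a / e)) => rad; rewrite gt_max => /andP[/H h].
rewrite ltr_pdivrMr // => ae; apply: le_trans h _; rewrite lee_fin ler_expR; lra.
Qed.

Lemma entropy_le (X : Type) (delta : R -> X -> X -> \bar R) (Y : set X) A :
  (forall e, 0 < e -> forall e', 0 < e' ->
     growth_le (fun rad => covering_number (delta rad) Y e) (A + e')) ->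
  (entropy delta Y <= A%:E)%E.
Proof.
move=> H; apply: ge_ereal_sup => _ [e /= e0 <-].
apply/lee_addgt0Pr => e' e'0; rewrite -EFinD; apply: rate_of_growth; last exact: H.
by move=> rad; exact: covering_number_ge0.
Qed.

Lemma entropy_growth (X : Type) (delta : R -> X -> X -> \bar R) (Y : set X) A e : 0 < e ->
  (entropy delta Y < A%:E)%E -> growth_le (fun rad => covering_number (delta rad) Y e) A.
Proof.
move=> e0 h; apply: growth_of_rate; first by move=> rad; exact: covering_number_ge0.
by apply: le_lt_trans h; apply: ereal_sup_ubound; exists e.
Qed.

Lemma covering_numberS (X : Type) (delta : X -> X -> \bar R) (Y : set X) (e e' : R) : e <= e' ->
  (covering_number delta Y e' <= covering_number delta Y e)%E.
Proof.
move=> ee'; apply: le_covering_number => n c Hc; rewrite -[X in (_ <= X%:R%:E)%E](card_ord n).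
apply: (@covering_number_le_card _ _ _ _ _ _ c) => y /Hc[i Hi]; exists i.
by apply: lt_le_trans Hi _; rewrite lee_fin.
Qed.

(** Testing against real A above x treats infinite entropies uniformly. At x = -oo, which occurs for
    empty T, arbitrarily negative A force y = -oo. *)
Lemma ereal_le_scale (x y : \bar R) (K c : R) : 0 < K ->
  (forall A, (x < A%:E)%E -> (y <= (c + K * A)%:E)%E) -> (y <= c%:E + K%:E * x)%E.
Proof.
move=> K0; case: x => [x H||H].
- rewrite -EFinM -EFinD; apply/lee_addgt0Pr => e e0.
  have := H (x + e / K); rewrite lte_fin ltrDl divr_gt0 // => /(_ isT).
  by rewrite -EFinD (_ : c + K * (x + e / K) = c + K * x + e) //; field; rewrite gt_eqF.
- by rewrite gt0_muley ?lte_fin // addey // leey.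
- rewrite gt0_muleNy ?lte_fin // addeNy.
  case: y H => [y|/(_ 0)|] H //; last by have := H (ltNyr _).
  have := H ((y - c - 1) / K)%R (ltNyr _).
  rewrite lee_fin (_ : K * ((y - c - 1) / K) = y - c - 1); last by field; rewrite gt_eqF.
  by move=> h; exfalso; lra.
Qed.
End Growth.


Theorem theorem1p1 (R : realType) (Gam : aut_subgroup R) (g : nat)
    (G : set (unit_disk R -> unit_disk R)) :
  fuchsian Gam -> acts_freely Gam -> acts_by_deck_transformations Gam ->
  compact [set: surface Gam] -> has_genus Gam g -> (2 <= g)%N ->
  symmetric_generators Gam G ->
  exists2 K : R, 1 < K &
  forall (T : metricType R), compact [set: T] ->
  forall (r : representation Gam T)
    (M : metricType R) (iota : suspension r -> M)
    (phi : suspension r -> unit_disk R -> suspension r),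
  topological_embedding iota ->
  (forall x, leaf_uniformization x (phi x)) ->
  (2%:E + weighted_entropy r G (@poincare_weight R)
      <= hyperbolic_entropy iota phi
      <= 2%:E + K%:E * weighted_entropy r G (@poincare_weight R))%E.
Proof.
move=> _ _ deck cS _ _ HG.
have [q q0 Hq] := cocompact_radius cS.
have [W0 W00 HW0] := svarc_milnor q0 Hq HG deck.
(* The Svarc-Milnor constant is only known to be positive; the maximum gives K > 1. It is fixed
   before T and the representation are introduced. *)
pose W := Num.max 2 W0.
have [W2 WW0] : 2 <= W /\ W0 <= W by rewrite !le_max !lexx orbT.
have Wp : 0 < W by lra.
have HW a : Gam a -> exists s, [/\ {in s, forall b, G b}, a = word s &
    \sum_(b <- s) poincare_weight b <= W * (poincare_dist (disk0 R) (a (disk0 R)) + 1)].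
  move=> /HW0[s [Gs as_ ws]]; exists s; split=> //; apply: le_trans ws _.
  by rewrite ler_wpM2r // addr_ge0 // pd_ge0.
exists W => [|T cT r M iota phi emb Hphi]; first by lra.
apply/andP; split; last first.
  apply: ereal_le_scale => // A hA; apply: entropy_le => e e0 e' e'0.
  have [d d0 [C C0 HC]] := upper_count deck emb cT Hphi q0 Hq Wp HW e0.
  have [rad0 Hg] := entropy_growth d0 hA.
  apply: (@growth_le_affine _ _ _ (ln C + A * (W * (2 * q + 1)))) => //.
  exists (Num.max 0 rad0) => rad; rewrite gt_max => /andP[rad_0 rad1].
  apply: le_trans (HC rad (ltW rad_0)) _.
  have reach : rad0 < W * (rad + 2 * q + 1) by nra.
  apply: le_trans (lee_wpmul2l _ (Hg _ reach)) _.
    by rewrite lee_fin mulr_ge0 ?expR_ge0 // ltW.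
  rewrite -EFinM lee_fin -{1}(lnK C0) -!expRD ler_expR le_eqVlt; apply/orP; left; apply/eqP; ring.
(* The lower bound is proved with 2 moved to the other side, so that only real upper bounds A of the
   hyperbolic entropy are handled; 2 is added back at the end. *)
have key A : (hyperbolic_entropy iota phi < A%:E)%E ->
    (weighted_entropy r G (@poincare_weight R) <= (- 2 + 1 * A)%:E)%E.
  move=> hA; apply: entropy_le => e e0 e' e'0.
  have [e1 e10 H] := lower_count deck emb cT Hphi HG q0 Hq.
  pose e2 := Num.min e1 (e / 2).
  have [e21 e22] : e2 <= e1 /\ e2 <= e / 2 by split; rewrite ge_min lexx ?orbT.
  have e20 : 0 < e2 by rewrite lt_min e10 divr_gt0.
  have [d d0 [c c0 [rad1 Hc]]] := H e2 e20 e21.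
  have [rad0 Hg] := entropy_growth d0 hA.
  apply: (@growth_le_affine _ _ _ (- ln c - 2 + A)) => //.
  exists (Num.max rad0 rad1) => rad; rewrite gt_max => /andP[rad_0 rad_1].
  have ce : 0 < c * expR (2 * (rad + 1)) by rewrite mulr_gt0 ?expR_gt0.
  (* [lower_count] loses one unit of scale, so scale rad on T is read off from scale rad + 1 on X;
     the shift only changes the additive constant in the exponent. *)
  have := Hc (rad + 1) ltac:(lra); rewrite addrK => h.
  have := le_trans h (Hg (rad + 1) ltac:(lra)); rewrite -lee_pdivlMl //.
  move=> h'; apply: le_trans (covering_numberS _ _ (_ : 2 * e2 <= e)) _; first by lra.
  apply: le_trans h' _; rewrite -EFinM lee_fin -{1}(lnK c0) -expRD -expRN -expRD ler_expR.
  by rewrite le_eqVlt; apply/orP; left; apply/eqP; ring.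
have := ereal_le_scale ltr01 key; rewrite mul1e => h.
apply: le_trans (leeD2l _ h) _.
by rewrite addeA -EFinD subrr add0e.
Qed.
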